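(* Let $\mathcal M=\mathbb R_t\times(r_-,r_+)\times\mathbb S^2$ be the black hole interior of a subextremal Kerr--Newman--de Sitter spacetime, with the double null functions $u=\frac{r_\star-t}{2}$ and $v=\frac{r_\star+t}{2}$. Then for all $u_0,v_0\in\mathbb R$ the topological two-sphere $\{u=u_0\}\cap\{v=v_0\}\subset\mathcal M$ is $C^\infty$ in the Boyer--Lindquist coordinates, i.e. it is a $C^\infty$ submanifold of $\mathcal M$ with respect to the smooth structure given by the atlas $\mathcal A_{\rm BL}=\{(t,r,\theta,\phi),(t,r,\tilde x,\tilde y)\}$, where $\tilde x=\sin\theta\cos\phi$, $\tilde y=\sin\theta\sin\phi$ (including at the poles $\theta=0$ and $\theta=\pi$).
   Context: Parameters: $\Lambda>0$, $M>0$, $a>0$, $e\in\mathbb R$; $\Delta_r=(r^2+a^2)(1-\frac{\Lambda}{3}r^2)-2Mr+e^2$, $\Delta_\theta=1+\frac{\Lambda}{3}a^2\cos^2\theta$. Subextremality (assumed): $\Delta_r$ has four distinct real roots $r_n<0<r_-<r_+<r_c$; hence $\Delta_r<0$ on $(r_-,r_+)$. Boyer--Lindquist coordinates are $(t,r,\theta,\phi)\in\mathbb R\times(r_-,r_+)\times[0,\pi]\times\mathbb S^1$, where $\theta$ is the colatitude and $\phi$ the longitude on $\mathbb S^2$; the chart $(t,r,\tilde x,\tilde y)$ is used near each pole. Set $P(\theta,\theta_\star)=a\sqrt{\sin^2\theta_\star\Delta_\theta-\sin^2\theta}$ and $Q(r,\theta_\star)=\sqrt{(r^2+a^2)^2-a^2\sin^2\theta_\star\Delta_r}$.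 For $r\in[r_-,r_+]$ and $\theta\in(0,\frac\pi2)$, $\theta_\star=\theta_\star(r,\theta)\in[\theta,\frac\pi2)$ is the (unique) solution of $$F(r,\theta,\theta_\star):=\int_{\theta_\star}^{\theta}\frac{d\theta'}{P(\theta',\theta_\star)}+\int_r^{r_+}\frac{dr'}{Q(r',\theta_\star)}=0;$$ also $\theta_\star(r,0)=0$, $\theta_\star(r,\frac\pi2)=\frac\pi2$, and $\theta_\star(r,\theta)=\pi-\theta_\star(r,\pi-\theta)$ for $\theta\in(\frac\pi2,\pi]$. With $\hat P(\theta,\lambda)=a\sqrt{\lambda\Delta_\theta-\sin^2\theta}$ and $\hat Q(r,\lambda)=\sqrt{(r^2+a^2)^2-a^2\lambda\Delta_r}$, let $f:[0,1]\to\mathbb R$ satisfy $f(0)=0$ and $f'(\lambda)=-\int_0^{\arcsin\sqrt\lambda}\frac{d\theta'}{\hat P(\theta',\lambda)}$, fix $r_0\in(r_-,r_+)$, and put $$\varrho(r,\theta,\lambda)=\int_{r_0}^r\frac{r'^2+a^2}{\Delta_{r'}}dr'+\int_r^{r_+}\frac{r'^2+a^2-\hat Q(r',\lambda)}{\Delta_{r'}}dr'+\int_0^\theta\frac{\hat P(\theta',\lambda)}{\Delta_{\theta'}}d\theta'+\frac{a^2}{2}f(\lambda).$$ Then $r_\star(r,\theta)=\varrho(r,\theta,\sin^2\theta_\star(r,\theta))$ for $\theta\in[0,\frac\pi2]$, extended by $r_\star(r,\theta)=r_\star(r,\pi-\theta)$ for $\theta\in(\frac\pi2,\pi]$. For each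 fixed $r_\star$-value and $t$-value the corresponding set is a topological two-sphere, parametrized by $(\theta_\star,\phi)$. *)

(* Defs.v *)
From Stdlib Require Import Reals.
From Coquelicot Require Import Coquelicot.

Open Scope R_scope.

Record KNdS := { Lam : R; mass : R; spin : R; charge : R }.

Definition Delta_r (K : KNdS) (r : R) : R :=
  (r ^ 2 + spin K ^ 2) * (1 - Lam K / 3 * r ^ 2) - 2 * mass K * r
  + charge K ^ 2.

Definition Delta_theta (K : KNdS) (theta : R) : R :=
  1 + Lam K / 3 * spin K ^ 2 * cos theta ^ 2.

Definition subextremal (K : KNdS) (rn rm rp rc : R) : Prop :=
  (rn < 0 /\ 0 < rm /\ rm < rp /\ rp < rc) /\
  (Delta_r K rn = 0 /\ Delta_r K rm = 0 /\
   Delta_r K rp = 0 /\ Delta_r K rc = 0).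

Definition Phat (K : KNdS) (theta lambda : R) : R :=
  spin K * sqrt (lambda * Delta_theta K theta - sin theta ^ 2).

Definition Qhat (K : KNdS) (r lambda : R) : R :=
  sqrt ((r ^ 2 + spin K ^ 2) ^ 2 - spin K ^ 2 * lambda * Delta_r K r).

Definition P (K : KNdS) (theta thetastar : R) : R :=
  spin K * sqrt (sin thetastar ^ 2 * Delta_theta K theta - sin theta ^ 2).

Definition Q (K : KNdS) (r thetastar : R) : R :=
  sqrt ((r ^ 2 + spin K ^ 2) ^ 2
        - spin K ^ 2 * sin thetastar ^ 2 * Delta_r K r).

Definition F (K : KNdS) (rp r theta thetastar : R) : R :=
  RInt (fun x => / P K x thetastar) thetastar theta
  + RInt (fun s => / Q K s thetastar) r rp.

Definition is_theta_star (K : KNdS) (rm rp : R) (ts : R -> R -> R) : Prop :=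
  forall r, rm <= r <= rp ->
    (forall theta, 0 < theta < PI / 2 ->
       unique (fun x => theta <= x < PI / 2 /\ F K rp r theta x = 0)
              (ts r theta)) /\
    ts r 0 = 0 /\
    ts r (PI / 2) = PI / 2 /\
    (forall theta, PI / 2 < theta <= PI ->
       ts r theta = PI - ts r (PI - theta)).

(* The formula for the derivative cannot hold at the end points of [0,1]: the
   integral tends to a nonzero limit as lambda -> 0 although it vanishes at
   lambda = 0, and it diverges at lambda = 1.  Hence the formula on (0,1) and
   continuity on [0,1], which together determine f on [0,1]. *)
Definition is_f (K : KNdS) (f : R -> R) : Prop :=
  f 0 = 0 /\
  continuous_on (fun l => 0 <= l <= 1) f /\
  forall l, 0 < l < 1 ->
    is_derive f l (- RInt (fun x => / Phat K x l) 0 (asin (sqrt l))).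

(* Delta_r vanishes at r = rp, where the second integrand is 0 by the
   convention x / 0 = 0; its singularity there is removable, so the value at
   this end point does not affect the integral. *)
Definition varrho (K : KNdS) (rp r0 : R) (f : R -> R)
    (r theta lambda : R) : R :=
  RInt (fun s => (s ^ 2 + spin K ^ 2) / Delta_r K s) r0 r
  + RInt (fun s => (s ^ 2 + spin K ^ 2 - Qhat K s lambda) / Delta_r K s) r rp
  + RInt (fun x => Phat K x lambda / Delta_theta K x) 0 theta
  + spin K ^ 2 / 2 * f lambda.

Definition rstar (K : KNdS) (rp r0 : R) (f : R -> R) (ts : R -> R -> R)
    (r theta : R) : R :=
  if Rle_dec theta (PI / 2)
  then varrho K rp r0 f r theta (sin (ts r theta) ^ 2)
  else varrho K rp r0 f r (PI - theta) (sin (ts r (PI - theta)) ^ 2).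

(* Points (t, r, (x, y, z)) with (x, y, z) on the unit sphere of R^3; the
   colatitude of such a point is acos z. *)
Definition point : Type := (R * R * (R * R * R))%type.

Definition black_hole_interior (rm rp : R) (p : point) : Prop :=
  let '(t, r, (x, y, z)) := p in
  rm < r < rp /\ x ^ 2 + y ^ 2 + z ^ 2 = 1.

Definition u_null (K : KNdS) (rp r0 : R) (f : R -> R) (ts : R -> R -> R)
    (p : point) : R :=
  let '(t, r, (x, y, z)) := p in (rstar K rp r0 f ts r (acos z) - t) / 2.

Definition v_null (K : KNdS) (rp r0 : R) (f : R -> R) (ts : R -> R -> R)
    (p : point) : R :=
  let '(t, r, (x, y, z)) := p in (rstar K rp r0 f ts r (acos z) + t) / 2.

Fixpoint Ck {V W : NormedModule R_AbsRing} (k : nat) (D : V -> Prop)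
    (g : V -> W) : Prop :=
  match k with
  | O => forall x, D x -> continuous g x
  | S k' => exists dg : V -> V -> W,
      (forall x, D x -> filterdiff g (locally x) (dg x)) /\
      forall w, Ck k' D (fun x => dg x w)
  end.

Definition smooth_on {V W : NormedModule R_AbsRing} (D : V -> Prop)
    (g : V -> W) : Prop :=
  forall k, Ck k D g.

Definition R4 : NormedModule R_AbsRing :=
  prod_NormedModule R_AbsRing
    (prod_NormedModule R_AbsRing
      (prod_NormedModule R_AbsRing R_NormedModule R_NormedModule)
      R_NormedModule)
    R_NormedModule.

Definition diffeo (U V : R4 -> Prop) (Phi Psi : R4 -> R4) : Prop :=
  open U /\ open V /\
  (forall x, U x -> V (Phi x) /\ Psi (Phi x) = x) /\
  (forall y, V y -> U (Psi y) /\ Phi (Psi y) = y) /\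
  smooth_on U Phi /\ smooth_on V Psi.

(* Two-dimensional embedded submanifolds of R^4: near each of its points, S is
   mapped by a diffeomorphism of open sets onto a piece of R^2 x {0}. *)
Definition smooth_surface (S : R4 -> Prop) : Prop :=
  forall p, S p ->
    exists (U V : R4 -> Prop) (Phi Psi : R4 -> R4),
      U p /\ diffeo U V Phi Psi /\
      forall x, U x ->
        (S x <-> let '(y1, y2, y3, y4) := Phi x in y3 = 0 /\ y4 = 0).

(* A chart is given by the open subset of R^4 in which its coordinates range
   and by the map recovering a point from its coordinates. *)
Record chart := { range : R4 -> Prop; param : R4 -> point }.

(* The angle phi on the circle is represented in the interval
   (alpha, alpha + 2 PI), with alpha arbitrary. *)
Definition polar_chart (rm rp alpha : R) : chart :=
  {| range := fun w => let '(t, r, theta, phi) := w in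
       rm < r < rp /\ 0 < theta < PI /\ alpha < phi < alpha + 2 * PI;
     param := fun w => let '(t, r, theta, phi) := w in
       (t, r, (sin theta * cos phi, sin theta * sin phi, cos theta)) |}.

Definition north_chart (rm rp : R) : chart :=
  {| range := fun w => let '(t, r, x, y) := w in
       rm < r < rp /\ x ^ 2 + y ^ 2 < 1;
     param := fun w => let '(t, r, x, y) := w in
       (t, r, (x, y, sqrt (1 - x ^ 2 - y ^ 2))) |}.

Definition south_chart (rm rp : R) : chart :=
  {| range := fun w => let '(t, r, x, y) := w in
       rm < r < rp /\ x ^ 2 + y ^ 2 < 1;
     param := fun w => let '(t, r, x, y) := w in
       (t, r, (x, y, - sqrt (1 - x ^ 2 - y ^ 2))) |}.

Inductive BL_atlas (rm rp : R) : chart -> Prop :=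
  | BL_polar alpha : BL_atlas rm rp (polar_chart rm rp alpha)
  | BL_north : BL_atlas rm rp (north_chart rm rp)
  | BL_south : BL_atlas rm rp (south_chart rm rp).

(* Two-dimensional embedded submanifolds with respect to an atlas: in every
   chart, the coordinate image of S is such a submanifold of R^4. *)
Definition smooth_2submanifold (A : chart -> Prop) (S : point -> Prop) : Prop :=
  forall c, A c -> smooth_surface (fun w => range c w /\ S (param c w)).

(* Main.v *)
Require Import Defs.
From Stdlib Require Import Reals Lra Lia Psatz ClassicalEpsilon.
From Coquelicot Require Import Coquelicot.

(** Put [L = Lam a^2 / 3], [l = sin^2 theta_star] and
    [s = tan theta / tan theta_star].  The substitution
    [tan theta' = s' tan theta_star] turns the defining equation of
    [theta_star] into [G(s, l) = H(r, l)], where [G] and [H] are integrals that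
    are smooth in [l] also slightly beyond [0] (the poles) and [1] (the
    equator).  There [s] lies strictly between [0] and [1]; at the poles this
    is the inequality [Lam r_+^2 < 3], which follows from Vieta's formulas.
    Moreover [x = sin^2 theta = s^2 l / (1 - l + l s^2)] and
    [r_star = B0(r, l) + E(s, l)], so that near every point [s], [l] and
    [r_star] become differentiable functions of [(r, x)] by three applications
    of a parametric inverse function theorem, with
    [d r_star / d r = Q / Delta_r < 0].  The level set of [r_star] is thus
    locally a graph [r = rho(x)] with [x = sin^2 theta = x~^2 + y~^2].  The
    derivatives of [rho], [s] and [l] belong to the algebra generated by these
    three functions and the [l]-derivatives of [G] and [H], which is closed
    under differentiation; hence [rho] is smooth. *)

Open Scope R_scope.

(** The definitions degenerate exactly where smoothness is delicate: the equation for [theta_star]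
    breaks down at the poles and the equator, [r_star] is continued across the equator by
    reflection, and [f'] diverges at [lambda = 1]. There [x = sin^2 theta] is also at an end of its
    range, whereas smoothness in the chart calls for a function of [x] on a full neighbourhood of 0
    or 1. The quotient [s] removes the degeneracy because the factor [sin theta_star cos theta_star]
    of [P] cancels against the Jacobian, and [f] joins with the integral up to [theta_star] into an
    elementary logarithm of [l].

    The simple form of [d r_star] rests on a cancellation. The [l]-derivatives of [B0] and [E]
    contain [a^2 H / 2] and [- a^2 G / 2], which annihilate each other on [G = H]; the rest of [dE]
    is a multiple of [dx]. Hence the [r]-derivative at fixed [x] equals that of [B0] at fixed
    [l]. *)

(** * Calculus of functions of two real variables *)

Lemma locally_2d_swap (P : R -> R -> Prop) (x y : R) :
  locally_2d P x y -> locally_2d (fun u v => P v u) y x.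
Proof.
  intros [d Hd]; exists d; intros u v Hu Hv; now apply Hd.
Qed.

Lemma continuity_2d_pt_swap (f : R -> R -> R) (x y : R) :
  continuity_2d_pt f x y -> continuity_2d_pt (fun u v => f v u) y x.
Proof.
  intros H eps; exact (locally_2d_swap _ _ _ (H eps)).
Qed.

Lemma locally_2d_pos (f : R -> R -> R) (x y : R) :
  continuity_2d_pt f x y -> 0 < f x y -> locally_2d (fun u v => 0 < f u v) x y.
Proof.
  intros Hc Hp.
  destruct (Hc (mkposreal _ Hp)) as [d Hd]; exists d; intros u v Hu Hv.
  specialize (Hd u v Hu Hv); simpl in Hd; apply Rabs_def2 in Hd; lra.
Qed.

Lemma continuity_2d_pt_fix_snd (f : R -> R -> R) (x y : R) :
  continuity_2d_pt f x y -> continuous (fun u => f u y) x.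
Proof.
  intros H; apply continuity_pt_filterlim, continuity_pt_locally; intros eps.
  exact (locally_2d_1d_const_y _ _ _ (H eps)).
Qed.

Lemma differentiable_pt_lim_continuity (f : R -> R -> R) (x y lx ly : R) :
  differentiable_pt_lim f x y lx ly -> continuity_2d_pt f x y.
Proof.
  intros H; apply differentiable_continuity_pt; now exists lx, ly.
Qed.

Lemma locally_2d_comp (P : R -> R -> Prop) (f g : R -> R -> R) (x y : R) :
  continuity_2d_pt f x y -> continuity_2d_pt g x y ->
  locally_2d P (f x y) (g x y) ->
  locally_2d (fun u v => P (f u v) (g u v)) x y.
Proof.
  intros Hf Hg [d Hd].
  apply (locally_2d_impl _ _ _ _
    (locally_2d_forall _ _ _ (fun u v H => Hd _ _ (proj1 H) (proj2 H)))).
  now apply locally_2d_and; [apply Hf | apply Hg].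
Qed.

Lemma continuity_2d_pt_comp (h f g : R -> R -> R) (x y : R) :
  continuity_2d_pt f x y -> continuity_2d_pt g x y ->
  continuity_2d_pt h (f x y) (g x y) ->
  continuity_2d_pt (fun u v => h (f u v) (g u v)) x y.
Proof.
  intros Hf Hg Hh eps.
  exact (locally_2d_comp _ f g x y Hf Hg (Hh eps)).
Qed.

Lemma locally_2d_locally_2d (P : R -> R -> Prop) (x y : R) :
  locally_2d P x y -> locally_2d (fun u v => locally_2d P u v) x y.
Proof.
  intros H; apply locally_2d_impl_strong with (2 := H).
  now apply locally_2d_forall.
Qed.

(** Total differentiability follows from the [y]-derivative [- k y l], which is continuous in both
    variables, and from differentiation under the integral in [l] at the point itself. The open set
    [Om] confines the hypotheses to where the integrand is regular, since the radicands used below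
    may fail to be positive elsewhere. *)
Lemma RInt_param_differentiable
    (k kl : R -> R -> R) (Om : R -> R -> Prop) (b y l : R) :
  (forall s z, Om s z -> locally_2d Om s z) ->
  (forall s z, Om s z -> is_derive (fun z => k s z) z (kl s z)) ->
  (forall s z, Om s z -> continuity_2d_pt k s z) ->
  (forall s z, Om s z -> continuity_2d_pt kl s z) ->
  locally_2d (fun y l => forall s, Rmin y b <= s <= Rmax y b -> Om s l) y l ->
  differentiable_pt_lim (fun y l => RInt (fun s => k s l) y b) y l
    (- k y l) (RInt (fun s => kl s l) y b).
Proof.
  intros Hop Hd Hk Hkl Hloc.
  assert (Hin : forall y l,
    locally_2d (fun y l => forall s, Rmin y b <= s <= Rmax y b -> Om s l) y l ->
    Om y l).
  { intros y' l' H; apply (locally_2d_singleton _ _ _ H y').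
    split; [apply Rmin_l | apply Rmax_l]. }
  assert (Hint : forall y' l',
    (forall s, Rmin y' b <= s <= Rmax y' b -> Om s l') ->
    ex_RInt (fun s => k s l') y' b).
  { intros y' l' H; apply (@ex_RInt_continuous R_CompleteNormedModule).
    intros s Hs; apply continuity_2d_pt_fix_snd, Hk, H, Hs. }
  apply filterdiff_differentiable_pt_lim.
  eapply filterdiff_ext_lin.
  - apply (is_derive_filterdiff (fun y l => RInt (fun s => k s l) y b) y l
             (fun y l => - k y l) (RInt (fun s => kl s l) y b)).
    + apply (proj1 (locally_2d_locally
        (fun u v => is_derive (fun z => RInt (fun s => k s v) z b) u (- k u v))
        y l)).
      apply locally_2d_impl with (2 := locally_2d_locally_2d _ _ _ Hloc).
      apply locally_2d_forall; intros u v Huv.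
      apply (is_derive_RInt' (fun s => k s v) _ u b).
      * generalize (locally_2d_1d_const_y _ _ _ Huv).
        apply filter_imp; intros z Hz.
        apply (@RInt_correct R_CompleteNormedModule), Hint, Hz.
      * apply continuity_2d_pt_fix_snd, Hk, Hin, Huv.
    + evar_last.
      * apply (is_derive_RInt_param (fun l s => k s l) y b l).
        -- generalize (locally_2d_1d_const_x _ _ _ Hloc).
           apply filter_imp; intros z Hz t Ht; eexists; apply Hd, Hz, Ht.
        -- intros t Ht.
           assert (HO := locally_2d_singleton _ _ _ Hloc t Ht).
           apply continuity_2d_pt_ext_loc with (fun u v => kl v u).
           ++ apply locally_2d_swap with (P := fun v u => kl v u = _).
              generalize (Hop _ _ HO); apply locally_2d_impl.
              apply locally_2d_forall; intros u v H.
              symmetry; apply is_derive_unique, Hd, H.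
           ++ apply continuity_2d_pt_swap, Hkl, HO.
        -- generalize (locally_2d_1d_const_x _ _ _ Hloc).
           apply filter_imp; intros z Hz; apply Hint, Hz.
      * apply RInt_ext; intros s Hs; apply is_derive_unique, Hd.
        apply (locally_2d_singleton _ _ _ Hloc); lra.
    + apply (proj1 (continuity_2d_pt_filterlim (fun y l => - k y l) y l)).
      apply continuity_2d_pt_opp, Hk, Hin, Hloc.
  - reflexivity.
Qed.

(** ** Inverse functions depending on a parameter *)

(** Total differentiability near the base point replaces continuous differentiability: monotonicity
    in [y] comes from the mean value theorem, the derivative of [eta] from a direct estimate of the
    remainder. The inverse is then differentiable on a neighbourhood too, so the lemma can be
    iterated. The last clause expresses local uniqueness of the solution. *)
Lemma param_inverse (g gp gy : R -> R -> R) (p0 y0 : R) :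
  locally_2d (fun p y => differentiable_pt_lim g p y (gp p y) (gy p y) /\
                         0 < gy p y) p0 y0 ->
  exists eta : R -> R -> R,
    locally_2d (fun p q =>
      g p (eta p q) = q /\
      differentiable_pt_lim eta p q
        (- gp p (eta p q) / gy p (eta p q)) (/ gy p (eta p q)))
      p0 (g p0 y0) /\
    locally_2d (fun p y => eta p (g p y) = y) p0 y0.
Proof.
  intros [d Hd].
  (* Half of the radius leaves room: the closed interval of radius [e] around [y0] lies where [g p]
     is increasing. *)
  set (e := d / 2).
  assert (He : 0 < e < d) by (unfold e; generalize (cond_pos d); lra).
  assert (Hmon : forall p y1 y2, Rabs (p - p0) < d ->
            Rabs (y1 - y0) < d -> Rabs (y2 - y0) < d -> y1 < y2 ->
            g p y1 < g p y2).
  { intros p y1 y2 Hp H1 H2 H12.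
    apply Rabs_def2 in H1; apply Rabs_def2 in H2.
    assert (Hder : forall y, y1 <= y <= y2 ->
              is_derive (fun y => g p y) y (gy p y) /\ 0 < gy p y).
    { intros y Hy.
      destruct (Hd p y Hp) as [Hdiff Hpos].
      { apply Rabs_def1; lra. }
      split; [|exact Hpos].
      apply is_derive_Reals.
      replace (gy p y) with (gp p y * 0 + gy p y * 1) by ring.
      apply (derivable_pt_lim_comp_2d g (fun _ => p) (fun y => y)).
      - exact Hdiff.
      - apply derivable_pt_lim_const.
      - apply derivable_pt_lim_id. }
    destruct (MVT_gen (fun y => g p y) y1 y2 (fun y => gy p y)) as [c [Hc Heq]].
    - rewrite Rmin_left, Rmax_right by lra.
      intros y Hy; apply Hder; lra.
    - rewrite Rmin_left, Rmax_right by lra.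
      intros y Hy; apply continuity_pt_filterlim.
      apply (ex_derive_continuous (fun y => g p y)).
      eexists; apply Hder; lra.
    - rewrite Rmin_left, Rmax_right in Hc by lra.
      destruct (Hder c Hc) as [_ Hpos]; nra. }
  assert (Hcont : forall p y, Rabs (p - p0) < d -> Rabs (y - y0) < d ->
            continuity_2d_pt g p y).
  { intros p y Hp Hy; eapply differentiable_pt_lim_continuity, Hd; assumption. }
  set (sol := fun p q y => Rabs (y - y0) < e /\ g p y = q).
  set (eta := fun p q => epsilon (inhabits 0) (sol p q)).
  assert (Huniq : forall p y y', Rabs (p - p0) < d ->
            Rabs (y - y0) < d -> Rabs (y' - y0) < d -> g p y = g p y' -> y = y').
  { intros p y y' Hp Hy Hy' Heq.
    destruct (Rtotal_order y y') as [H|[H|H]]; [|exact H|].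
    - generalize (Hmon p y y' Hp Hy Hy' H); lra.
    - generalize (Hmon p y' y Hp Hy' Hy H); lra. }
  (* The inequalities [g p1 (y1 - r) < g p1 y1 < g p1 (y1 + r)] are strict and persist for nearby
     [(p, q)]; the intermediate value theorem then gives a solution within [r] of [y1]. *)
  assert (Hsolve : forall p1 y1 r, Rabs (p1 - p0) < d ->
            0 < r -> Rabs (y1 - y0) + r < d ->
            locally_2d (fun p q => exists y, Rabs (y - y1) < r /\ g p y = q)
              p1 (g p1 y1)).
  { intros p1 y1 r Hp1 Hr Hy1.
    assert (Hm : Rabs (y1 - r - y0) < d /\ Rabs (y1 - y0) < d /\
                 Rabs (y1 + r - y0) < d).
    { revert Hy1; unfold Rabs; repeat destruct Rcase_abs; lra. }
    destruct Hm as (Hm1 & Hm2 & Hm3).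
    assert (Hlow := Hmon p1 (y1 - r) y1 Hp1 Hm1 Hm2 ltac:(lra)).
    assert (Hhigh := Hmon p1 y1 (y1 + r) Hp1 Hm2 Hm3 ltac:(lra)).
    assert (Hfix : forall z, Rabs (z - y0) < d ->
              continuity_2d_pt (fun p _ => g p z) p1 (g p1 y1)).
    { intros z Hz; apply continuity_2d_pt_comp with (f := fun p _ => p)
        (g := fun _ _ => z) (h := g).
      - apply continuity_2d_pt_id1.
      - apply continuity_2d_pt_const.
      - apply Hcont; assumption. }
    assert (HA : locally_2d (fun p q => 0 < q - g p (y1 - r)) p1 (g p1 y1)).
    { apply (locally_2d_pos (fun p q => q - g p (y1 - r))); [|lra].
      apply continuity_2d_pt_minus; [apply continuity_2d_pt_id2 | now apply Hfix]. }
    assert (HB : locally_2d (fun p q => 0 < g p (y1 + r) - q) p1 (g p1 y1)).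
    { apply (locally_2d_pos (fun p q => g p (y1 + r) - q)); [|lra].
      apply continuity_2d_pt_minus; [now apply Hfix | apply continuity_2d_pt_id2]. }
    assert (HC : locally_2d (fun p _ => 0 < d - Rabs (p - p0)) p1 (g p1 y1)).
    { apply (locally_2d_pos (fun p _ => d - Rabs (p - p0))); [|lra].
      apply continuity_2d_pt_minus; [apply continuity_2d_pt_const|].
      apply (continuity_1d_2d_pt_comp Rabs (fun p _ => p - p0)).
      - apply Rcontinuity_abs.
      - apply continuity_2d_pt_minus;
          [apply continuity_2d_pt_id1 | apply continuity_2d_pt_const]. }
    generalize (locally_2d_and _ _ _ _ HA (locally_2d_and _ _ _ _ HB HC)).
    apply locally_2d_impl, locally_2d_forall; intros p q (H1 & H2 & H3).
    destruct (Ranalysis5.IVT_interv (fun y => g p y - q) (y1 - r) (y1 + r))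
      as [y [Hy Hy']]; try lra.
    - intros a Ha; apply continuity_pt_minus.
      + apply continuity_pt_filterlim.
        apply (continuity_2d_pt_fix_snd (fun y p => g p y)).
        apply continuity_2d_pt_swap, Hcont; [lra|].
        revert Hy1 Ha; unfold Rabs; repeat destruct Rcase_abs; lra.
      + apply continuity_pt_const; now intros ? ?.
    - exists y; split; [|lra].
      assert (y <> y1 - r) by (intros ->; lra).
      assert (y <> y1 + r) by (intros ->; lra).
      apply Rabs_def1; lra. }
  assert (Heta : forall p y, Rabs (p - p0) < d -> Rabs (y - y0) < e ->
            eta p (g p y) = y).
  { intros p y Hp Hy.
    destruct (epsilon_spec (inhabits 0) (sol p (g p y))) as [H1 H2].
    { now exists y. }
    apply Huniq with p; try assumption; fold (eta p (g p y)) in *; try lra. }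
  exists eta; split.
  - assert (HS := Hsolve p0 y0 e ltac:(rewrite Rminus_diag, Rabs_R0; lra)
                    (proj1 He) ltac:(rewrite Rminus_diag, Rabs_R0; lra)).
    assert (HC : locally_2d (fun p _ => Rabs (p - p0) < d) p0 (g p0 y0)).
    { exists d; intros u v Hu _; exact Hu. }
    generalize (locally_2d_and _ _ _ _ HS HC).
    apply locally_2d_impl, locally_2d_forall.
    intros p q [[y [Hy Hq]] Hp].
    assert (Hey : eta p q = y) by (rewrite <- Hq; now apply Heta).
    rewrite Hey; split; [exact Hq|].
    destruct (Hd p y Hp ltac:(lra)) as [Hdiff Hpos].
    set (A := gp p y) in *; set (B := gy p y) in *.
    (* Continuity of [eta] at [(p, q)]; the radius [r'] keeps the nearby solution within [e] of
       [y0], where it is the one that [eta] selects. *)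
    assert (Hctn : forall r, 0 < r -> locally_2d (fun p' q' =>
              exists y', Rabs (y' - y) < r /\ g p' y' = q' /\ eta p' q' = y') p q).
    { intros r Hr.
      set (r' := Rmin r (e - Rabs (y - y0))).
      assert (Hr' : 0 < r') by (apply Rmin_case; lra).
      assert (Hr1 : r' <= r) by apply Rmin_l.
      assert (Hr2 : r' <= e - Rabs (y - y0)) by apply Rmin_r.
      rewrite <- Hq.
      assert (HC' : locally_2d (fun p _ => 0 < d - Rabs (p - p0)) p (g p y)).
      { apply (locally_2d_pos (fun p _ => d - Rabs (p - p0))); [|lra].
        apply continuity_2d_pt_minus; [apply continuity_2d_pt_const|].
        apply (continuity_1d_2d_pt_comp Rabs (fun p _ => p - p0)).
        - apply Rcontinuity_abs.
        - apply continuity_2d_pt_minus;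
            [apply continuity_2d_pt_id1 | apply continuity_2d_pt_const]. }
      generalize (locally_2d_and _ _ _ _
        (Hsolve p y r' Hp Hr' ltac:(lra)) HC').
      apply locally_2d_impl, locally_2d_forall.
      intros p' q' [[y' [Hy' Hq']] Hp']; exists y'; repeat split; try lra.
      rewrite <- Hq'; apply Heta; [lra|].
      replace (y' - y0) with ((y' - y) + (y - y0)) by ring.
      generalize (Rabs_triang (y' - y) (y - y0)); lra. }
    (* The remainder h = dq - (A dp + B dy) is at most mu max(|dp|, |dy|) with
       mu <= B / 2, whence |dy| <= (1 + 2 C) max(|dp|, |dq|). *)
    intros eps.
    set (C := (1 + Rabs A) / B).
    assert (HC0 : 0 < C).
    { apply Rdiv_lt_0_compat; [generalize (Rabs_pos A); lra | exact Hpos]. }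
    set (mu := Rmin (B / 2) (eps * B / (1 + 2 * C))).
    assert (Hmu : 0 < mu).
    { apply Rmin_case; [lra|].
      apply Rdiv_lt_0_compat; [|lra].
      apply Rmult_lt_0_compat; [apply cond_pos | exact Hpos]. }
    assert (Hmu1 : mu <= B / 2) by apply Rmin_l.
    assert (Hmu2 : mu * (1 + 2 * C) <= eps * B).
    { apply Rle_trans with (eps * B / (1 + 2 * C) * (1 + 2 * C)).
      - apply Rmult_le_compat_r; [lra | apply Rmin_r].
      - right; field; lra. }
    destruct (Hdiff (mkposreal mu Hmu)) as [dl Hdl].
    assert (Hnear : locally_2d (fun p' _ => Rabs (p' - p) < dl) p q).
    { exists dl; intros u v Hu _; exact Hu. }
    generalize (locally_2d_and _ _ _ _ (Hctn dl (cond_pos dl)) Hnear).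
    apply locally_2d_impl, locally_2d_forall.
    intros p' q' [[y' (Hy' & Hq' & Hey')] Hp'].
    rewrite Hey', Hey.
    specialize (Hdl p' y' Hp' Hy'); simpl in Hdl.
    rewrite Hq', Hq in Hdl.
    set (m := Rmax (Rabs (p' - p)) (Rabs (q' - q))).
    assert (Hm1 : Rabs (p' - p) <= m) by apply Rmax_l.
    assert (Hm2 : Rabs (q' - q) <= m) by apply Rmax_r.
    set (h := q' - q - (A * (p' - p) + B * (y' - y))) in *.
    assert (Hy1 : y' - y = ((q' - q) - A * (p' - p) - h) / B).
    { unfold h; field; lra. }
    assert (Hh : Rabs h <= mu * (Rabs (p' - p) + Rabs (y' - y))).
    { apply Rle_trans with (1 := Hdl), Rmult_le_compat_l; [lra|].
      apply Rmax_case; generalize (Rabs_pos (p' - p)) (Rabs_pos (y' - y)); lra. }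
    assert (Hm0 : 0 <= m) by (generalize (Rabs_pos (p' - p)); lra).
    assert (Hnum : Rabs (q' - q - A * (p' - p)) <= (1 + Rabs A) * m).
    { apply Rle_trans with (1 := Rabs_triang _ _).
      rewrite Rabs_Ropp, Rabs_mult.
      generalize (Rmult_le_compat_l _ _ _ (Rabs_pos A) Hm1); lra. }
    assert (Hmaxb : forall z, Rmax (Rabs (p' - p)) z <= Rmax m z).
    { intros z; apply Rmax_case; [|apply Rmax_r].
      apply Rle_trans with (1 := Hm1), Rmax_l. }
    assert (Hdy : Rabs (y' - y) <= (1 + 2 * C) * m).
    { destruct (Rle_dec (Rabs (y' - y)) m) as [Hle|Hgt].
      { assert (0 <= 2 * C * m) by (apply Rmult_le_pos; lra); lra. }
      assert (Hdl' : Rabs h <= mu * Rabs (y' - y)).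
      { apply Rle_trans with (1 := Hdl), Rmult_le_compat_l; [lra|].
        apply Rmax_lub; lra. }
      assert (HB1 : B * Rabs (y' - y) <= (1 + Rabs A) * m + mu * Rabs (y' - y)).
      { rewrite <- (Rabs_pos_eq B) at 1 by lra.
        rewrite <- Rabs_mult.
        replace (B * (y' - y)) with ((q' - q - A * (p' - p)) + - h)
          by (unfold h; ring).
        apply Rle_trans with (1 := Rabs_triang _ _).
        rewrite Rabs_Ropp; lra. }
      assert (HB2 : B * Rabs (y' - y) <= 2 * (1 + Rabs A) * m).
      { generalize (Rmult_le_compat_r _ _ _ (Rabs_pos (y' - y)) Hmu1); lra. }
      apply Rmult_le_reg_l with B; [exact Hpos|].
      apply Rle_trans with (1 := HB2).
      replace (B * ((1 + 2 * C) * m)) with (B * m + 2 * (1 + Rabs A) * m)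
        by (unfold C; field; lra).
      assert (0 <= B * m) by (apply Rmult_le_pos; lra); lra. }
    replace (y' - y - (- A / B * (p' - p) + / B * (q' - q))) with (- h / B)
      by (rewrite Hy1; field; lra).
    rewrite Rabs_div, Rabs_Ropp, (Rabs_pos_eq B) by lra.
    apply Rmult_le_reg_r with B; [exact Hpos|].
    replace (Rabs h / B * B) with (Rabs h) by (field; lra).
    apply Rle_trans with (1 := Hdl).
    apply Rle_trans with (mu * ((1 + 2 * C) * m)).
    { apply Rmult_le_compat_l; [lra|].
      apply Rmax_lub; [|exact Hdy].
      assert (0 <= 2 * C * m) by (apply Rmult_le_pos; lra); lra. }
    rewrite <- Rmult_assoc.
    apply Rle_trans with (eps * B * m); [now apply Rmult_le_compat_r|].
    right; unfold m; ring.
  - assert (Hde : 0 < e) by lra.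
    exists (mkposreal e Hde); intros p y Hp Hy; simpl in *; apply Heta; lra.
Qed.

(** * Smooth functions on R^4, and graphs as smooth surfaces *)

(* Smoothness on [I], witnessed by a class of functions containing [f] and
   closed under differentiation; this avoids choosing all derivatives. *)
Definition smooth1 (I : R -> Prop) (f : R -> R) : Prop :=
  exists C : (R -> R) -> Prop, C f /\
    forall g, C g -> exists g', C g' /\ forall x, I x -> is_derive g x (g' x).

(** The directional derivative of a member in a fixed direction is again a member, so a single
    induction on membership serves all orders of [Ck]. *)
Inductive smooth_expr {V : NormedModule R_AbsRing} (D : V -> Prop) :
    (V -> R) -> Prop :=
  | se_const c : smooth_expr D (fun _ => c)
  | se_linear (l : V -> R) :
      is_linear (V := R_NormedModule) l -> smooth_expr D l
  | se_plus f g :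
      smooth_expr D f -> smooth_expr D g -> smooth_expr D (fun x => f x + g x)
  | se_mult f g :
      smooth_expr D f -> smooth_expr D g -> smooth_expr D (fun x => f x * g x)
  | se_comp I h f :
      smooth1 I h -> smooth_expr D f -> (forall x, D x -> I (f x)) ->
      smooth_expr D (fun x => h (f x)).

Lemma smooth_expr_filterdiff {V : NormedModule R_AbsRing} (D : V -> Prop) f :
  smooth_expr D f ->
  exists df : V -> V -> R,
    (forall x, D x -> filterdiff (V := R_NormedModule) f (locally x) (df x)) /\
    forall w, smooth_expr D (fun x => df x w).
Proof.
  induction 1 as [c|l Hl|f g Hf [df [Hdf Sdf]] Hg [dg [Hdg Sdg]]
                 |f g Hf [df [Hdf Sdf]] Hg [dg [Hdg Sdg]]
                 |I h f Hh Hf [df [Hdf Sdf]] HI].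
  - exists (fun _ _ => 0); split; [|intros; apply se_const].
    intros x _; apply (filterdiff_const (V := R_NormedModule) c).
  - exists (fun _ => l); split; [|intros; apply se_const].
    intros x _; now apply filterdiff_linear.
  - exists (fun x w => df x w + dg x w); split; [|intros; now apply se_plus].
    intros x Hx; apply (filterdiff_plus_fct (V := R_NormedModule)); auto.
  - exists (fun x w => df x w * g x + f x * dg x w); split.
    + intros x Hx; apply (filterdiff_mult_fct (K := R_AbsRing)); auto.
      intros; apply Rmult_comm.
    + intros w; apply se_plus; now apply se_mult.
  - destruct Hh as [C [Ch HC]].
    destruct (HC h Ch) as [h' [Ch' Hh']].
    exists (fun x w => df x w * h' (f x)); split.
    + intros x Hx.
      apply (filterdiff_comp' (V := R_NormedModule) (W := R_NormedModule)
               f h x (df x) (fun y => y * h' (f x))); auto.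
      apply Hh'; auto.
    + intros w; apply se_mult; [apply Sdf|].
      apply se_comp with I; auto; now exists C.
Qed.

Lemma smooth_expr_smooth {V : NormedModule R_AbsRing} (D : V -> Prop) f :
  smooth_expr D f -> smooth_on (W := R_NormedModule) D f.
Proof.
  intros Hf k; revert f Hf; induction k as [|k IH]; intros f Hf;
    destruct (smooth_expr_filterdiff D f Hf) as [df [Hdf Sdf]].
  - intros x Hx; apply (@filterdiff_continuous _ V R_NormedModule f x).
    exists (df x); auto.
  - exists df; split; [exact Hdf|]; intros w; apply IH, Sdf.
Qed.

Lemma smooth_pair {V W1 W2 : NormedModule R_AbsRing} (D : V -> Prop)
    (f : V -> W1) (g : V -> W2) :
  smooth_on D f -> smooth_on D g ->
  smooth_on (W := prod_NormedModule R_AbsRing W1 W2) D (fun x => (f x, g x)).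
Proof.
  intros Hf Hg k; generalize (Hf k) (Hg k); clear Hf Hg; revert f g.
  induction k as [|k IH]; intros f g Hf Hg.
  - intros x Hx.
    apply (filterlim_filter_le_2 (G := filter_prod (locally (f x)) (locally (g x)))).
    + intros P [e He]; exists (fun y => ball (f x) e y) (fun y => ball (g x) e y).
      * now exists e.
      * now exists e.
      * intros u v Hu Hv; apply He; split; assumption.
    + apply filterlim_pair; [apply Hf | apply Hg]; assumption.
  - destruct Hf as [df [Hdf Cdf]], Hg as [dg [Hdg Cdg]].
    exists (fun x w => (df x w, dg x w)); split.
    + intros x Hx.
      apply (filterdiff_comp'_2 (W := prod_NormedModule R_AbsRing W1 W2)
               f g (fun u v => (u, v)) x (df x) (dg x) (fun u v => (u, v)));
        auto.
      apply filterdiff_linear, is_linear_prod;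
        [apply is_linear_fst | apply is_linear_snd].
    + intros w; apply (IH (fun x => df x w) (fun x => dg x w)); auto.
Qed.

Definition R4coord (i : nat) (w : R4) : R :=
  match i with
  | 0%nat => fst (fst (fst w)) | 1%nat => snd (fst (fst w))
  | 2%nat => snd (fst w) | _ => snd w
  end.

Lemma R4coord_linear (i : nat) :
  is_linear (U := R4) (V := R_NormedModule) (R4coord i).
Proof.
  assert (H1 : is_linear (U := R4) fst) by apply is_linear_fst.
  assert (H2 : is_linear (U := R4) (fun w => fst (fst w))).
  { apply (is_linear_comp (fun w : R4 => fst w) fst); [exact H1|].
    apply is_linear_fst. }
  destruct i as [|[|[|i]]].
  - apply (is_linear_comp (fun w : R4 => fst (fst w)) fst); [exact H2|].
    apply is_linear_fst.
  - apply (is_linear_comp (fun w : R4 => fst (fst w)) snd); [exact H2|].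
    apply is_linear_snd.
  - apply (is_linear_comp (fun w : R4 => fst w) snd); [exact H1|].
    apply is_linear_snd.
  - apply is_linear_snd.
Qed.

Lemma smooth_expr_coord (D : R4 -> Prop) (i : nat) :
  smooth_expr D (R4coord i).
Proof. apply se_linear, R4coord_linear. Qed.

Lemma smooth_expr_opp {V : NormedModule R_AbsRing} (D : V -> Prop) f :
  smooth_expr D f -> smooth_expr D (fun x => (-1) * f x).
Proof. intros H; apply (se_mult D (fun _ => -1)); [apply se_const | exact H]. Qed.

Lemma smooth_on_R4 (D : R4 -> Prop) (f1 f2 f3 f4 : R4 -> R) :
  smooth_expr D f1 -> smooth_expr D f2 -> smooth_expr D f3 ->
  smooth_expr D f4 ->
  smooth_on (V := R4) (W := R4) D (fun w => (f1 w, f2 w, f3 w, f4 w)).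
Proof.
  intros H1 H2 H3 H4.
  apply (smooth_pair D (fun w => (f1 w, f2 w, f3 w)) f4);
    [|now apply smooth_expr_smooth].
  apply (smooth_pair D (fun w => (f1 w, f2 w)) f3);
    [|now apply smooth_expr_smooth].
  apply (smooth_pair D f1 f2); now apply smooth_expr_smooth.
Qed.

(** Smoothness in two variables is expressed by stability under substitution of smooth expressions,
    so that no partial derivatives of [h] have to be named. *)
Definition smooth2 (O : R -> R -> Prop) (h : R -> R -> R) : Prop :=
  forall (D : R4 -> Prop) f g, smooth_expr D f -> smooth_expr D g ->
    (forall w, D w -> O (f w) (g w)) -> smooth_expr D (fun w => h (f w) (g w)).

Lemma smooth_expr_near (D : R4 -> Prop) (f : R4 -> R) (x : R4) (d : posreal) :
  smooth_expr D f -> D x -> locally x (fun y => Rabs (f y - f x) < d).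
Proof.
  intros Hf Hx.
  exact (smooth_expr_smooth D f Hf 0%nat x Hx _ (locally_ball (f x) d)).
Qed.

Lemma open_smooth_preimage (D : R4 -> Prop) (O : R -> R -> Prop) (f g : R4 -> R) :
  smooth_expr D f -> smooth_expr D g ->
  (forall a b, O a b -> locally_2d O a b) ->
  forall x, D x -> O (f x) (g x) -> locally x (fun y => O (f y) (g y)).
Proof.
  intros Hf Hg HO x Dx Ox.
  destruct (HO _ _ Ox) as [d Hd].
  generalize (filter_and _ _ (smooth_expr_near D f x d Hf Dx)
                             (smooth_expr_near D g x d Hg Dx)).
  apply filter_imp; intros y [H1 H2]; now apply Hd.
Qed.

Lemma locally_2d_Rabs (c e a b : R) :
  Rabs (a - c) < e -> locally_2d (fun u _ => Rabs (u - c) < e) a b.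
Proof.
  intros H; assert (Hp : 0 < e - Rabs (a - c)) by lra.
  exists (mkposreal _ Hp); simpl; intros u v Hu _.
  replace (u - c) with ((u - a) + (a - c)) by ring.
  generalize (Rabs_triang (u - a) (a - c)); lra.
Qed.

(** The flattening map is [(t, r, a, b) -> (a, b, t - t0, r - h a b)], with inverse [(a, b, y3, y4)
    -> (y3 + t0, y4 + h a b, a, b)]. The bound on [r - r0] stays in [U] because the graph describes
    [S] only there. *)
Lemma smooth_surface_graph (S : R4 -> Prop) :
  (forall t r a b, S (t, r, a, b) ->
     exists (O : R -> R -> Prop) (h : R -> R -> R) (t0 r0 e : R),
       O a b /\ Rabs (r - r0) < e /\
       (forall a b, O a b -> locally_2d O a b) /\ smooth2 O h /\
       forall t r a b, Rabs (r - r0) < e -> O a b ->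
         (S (t, r, a, b) <-> t = t0 /\ r = h a b)) ->
  smooth_surface S.
Proof.
  intros HS [[[t r] a] b] Hp.
  destruct (HS t r a b Hp) as (O & h & t0 & r0 & e & Ho & Hr & Oo & Hh & Hiff).
  set (c := R4coord).
  set (U := fun w : R4 => O (c 2%nat w) (c 3%nat w) /\ Rabs (c 1%nat w - r0) < e).
  set (O' := fun w : R4 => O (c 0%nat w) (c 1%nat w)).
  set (V := fun w : R4 => O' w /\
     Rabs (c 3%nat w + h (c 0%nat w) (c 1%nat w) - r0) < e).
  exists U, V.
  exists (fun w => (c 2%nat w, c 3%nat w, c 0%nat w + - t0,
                    c 1%nat w + (-1) * h (c 2%nat w) (c 3%nat w))).
  exists (fun w => (c 2%nat w + t0, c 3%nat w + h (c 0%nat w) (c 1%nat w),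
                    c 0%nat w, c 1%nat w)).
  assert (Hc := smooth_expr_coord).
  assert (Hh' : smooth_expr O' (fun w => h (c 0%nat w) (c 1%nat w))).
  { apply Hh; auto. }
  split; [split; assumption|]; split.
  - split; [|split; [|split; [|split; [|split]]]].
    + intros w [H1 H2]; apply (filter_and (F := locally w)).
      * apply (open_smooth_preimage (fun _ => True)); auto; apply Hc.
      * apply (open_smooth_preimage (fun _ => True)
                 (fun u _ => Rabs (u - r0) < e) (c 1%nat) (c 1%nat));
          auto; try apply Hc; intros; now apply locally_2d_Rabs.
    + intros w [H1 H2]; apply (filter_and (F := locally w)).
      * apply (open_smooth_preimage (fun _ => True)); auto; apply Hc.
      * assert (Hs : smooth_expr O'
          (fun w => c 3%nat w + h (c 0%nat w) (c 1%nat w))).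
        { apply se_plus; [apply Hc | exact Hh']. }
        apply (open_smooth_preimage O' (fun u _ => Rabs (u - r0) < e)
                 (fun w => c 3%nat w + h (c 0%nat w) (c 1%nat w))
                 (fun w => c 3%nat w + h (c 0%nat w) (c 1%nat w)));
          auto; intros; now apply locally_2d_Rabs.
    + intros [[[t1 r1] a1] b1] [H1 H2]; unfold V, O', c in *; simpl in *.
      repeat split; auto.
      * replace (r1 + -1 * h a1 b1 + h a1 b1 - r0) with (r1 - r0) by ring; auto.
      * repeat f_equal; ring.
    + intros [[[y1 y2] y3] y4] [H1 H2]; unfold U, O', c in *; simpl in *.
      repeat split; auto; repeat f_equal; ring.
    + apply smooth_on_R4; try apply Hc.
      * apply se_plus; [apply Hc | apply se_const].
      * apply se_plus; [apply Hc | apply smooth_expr_opp].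
        apply Hh; try apply Hc; now intros w [H1 _].
    + apply smooth_on_R4; try apply Hc.
      * apply se_plus; [apply Hc | apply se_const].
      * apply se_plus; [apply Hc | ].
        apply Hh; try apply Hc; now intros w [H1 _].
  - intros [[[t1 r1] a1] b1] [H1 H2]; unfold c in *; simpl in *.
    rewrite Hiff by assumption; lra.
Qed.

Lemma smooth1_sin : smooth1 (fun _ => True) sin.
Proof.
  exists (fun f => exists a b, forall x, f x = a * sin x + b * cos x); split.
  - exists 1, 0; intros x; ring.
  - intros g [a [b Hg]]; exists (fun x => - b * sin x + a * cos x); split.
    + now exists (- b), a.
    + intros x _; apply is_derive_ext with (fun x => a * sin x + b * cos x).
      * intros; symmetry; apply Hg.
      * auto_derive; [easy | ring].
Qed.

(** ** The angular integrals *)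

Ltac cont2 :=
  lazymatch goal with
  | |- continuity_2d_pt (fun _ _ => ?c) _ _ => apply continuity_2d_pt_const
  | |- continuity_2d_pt (fun u _ => u) _ _ => apply continuity_2d_pt_id1
  | |- continuity_2d_pt (fun _ v => v) _ _ => apply continuity_2d_pt_id2
  | |- continuity_2d_pt (fun _ _ => _ + _) _ _ =>
      apply continuity_2d_pt_plus; cont2
  | |- continuity_2d_pt (fun _ _ => _ - _) _ _ =>
      apply continuity_2d_pt_minus; cont2
  | |- continuity_2d_pt (fun _ _ => - _) _ _ =>
      apply continuity_2d_pt_opp; cont2
  | |- continuity_2d_pt (fun _ _ => _ * _) _ _ =>
      apply continuity_2d_pt_mult; cont2
  | |- continuity_2d_pt (fun _ _ => _ / _) _ _ =>
      apply continuity_2d_pt_mult; cont2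
  | |- continuity_2d_pt (fun _ _ => / _) _ _ =>
      apply continuity_2d_pt_inv; [cont2 | ]
  | |- continuity_2d_pt (fun _ _ => _ ^ ?k) _ _ =>
      apply (continuity_1d_2d_pt_comp (fun x => x ^ k));
      [apply continuity_pt_filterlim, (ex_derive_continuous (fun x => x ^ k));
       auto_derive; trivial | cont2]
  | |- continuity_2d_pt (fun _ _ => sqrt _) _ _ =>
      apply (continuity_1d_2d_pt_comp sqrt);
      [apply continuity_pt_filterlim, continuous_sqrt | cont2]
  | |- continuity_2d_pt (fun _ _ => sin _) _ _ =>
      apply (continuity_1d_2d_pt_comp sin); [apply continuity_sin | cont2]
  | |- continuity_2d_pt (fun _ _ => cos _) _ _ =>
      apply (continuity_1d_2d_pt_comp cos); [apply continuity_cos | cont2]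
  | _ => idtac
  end.

Ltac eqR := match goal with |- ?x = ?y => change (@eq R x y) end.

Section Angular.

Context (a L : R) (ha : 0 < a) (hL : 0 < L).

(* Under [tan theta' = s tan theta_star], with [l = sin^2 theta_star]:
   [P = a sin theta_star cos theta_star nn / mm], [Delta_theta = dd / mm^2],
   [d theta' / P = Gk 0 s l ds] and [Phat / Delta_theta d theta' = ES s l ds].
   Up to a factor, [Gk j] is the j-th derivative of [Gk 0] in [l]. *)
Definition nn (s : R) : R := sqrt (1 + L - s ^ 2).
Definition mm (s l : R) : R := sqrt (1 - l + l * s ^ 2).
Definition dd (s l : R) : R := (1 + L) * (1 - l) + l * s ^ 2.

Definition Gk (j : nat) (s l : R) : R :=
  (1 - s ^ 2) ^ j / (a * nn s * mm s l ^ (2 * j + 1)).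
Definition G (j : nat) (s l : R) : R := RInt (fun u => Gk j u l) s 1.

Definition OmG (s l : R) : Prop :=
  0 < 1 + L - s ^ 2 /\ 0 < 1 - l + l * s ^ 2 /\ 0 < dd s l.
Definition domG (s l : R) : Prop := 0 < s < 1 /\ 0 < dd s l.

Lemma domG_OmG s l u : 0 < s -> 0 < dd s l -> s <= u <= 1 -> OmG u l.
Proof.
  unfold OmG, dd; intros hs hd hu.
  assert (hu2 : s ^ 2 <= u ^ 2 <= 1) by (split; nra).
  repeat split; [lra | |].
  - destruct (Rle_dec l 0); [|destruct (Rle_dec l 1)]; [nra|nra|].
    assert (0 < L * (l - 1)) by (apply Rmult_lt_0_compat; lra); nra.
  - destruct (Rle_dec l 0); [|nra].
    assert (0 <= L * (-l)) by (apply Rmult_le_pos; lra); nra.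
Qed.

Lemma OmG_open s l : OmG s l -> locally_2d OmG s l.
Proof.
  intros (h1 & h2 & h3).
  apply locally_2d_and; [|apply locally_2d_and].
  - apply (locally_2d_pos (fun s l => 1 + L - s ^ 2)); [cont2 | exact h1].
  - apply (locally_2d_pos (fun s l => 1 - l + l * s ^ 2)); [cont2 | exact h2].
  - apply (locally_2d_pos dd); [unfold dd; cont2 | exact h3].
Qed.

Lemma domG_open s l : domG s l -> locally_2d domG s l.
Proof.
  intros ([h1 h2] & h3).
  apply locally_2d_and; [apply locally_2d_and|].
  - apply (locally_2d_pos (fun s l => s)); [cont2 | exact h1].
  - apply locally_2d_impl with (fun s l : R => 0 < 1 - s).
    + apply locally_2d_forall; intros; lra.
    + apply (locally_2d_pos (fun s l => 1 - s)); [cont2 | lra].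
  - apply (locally_2d_pos dd); [unfold dd; cont2 | exact h3].
Qed.

Lemma domG_range s l : domG s l ->
  locally_2d (fun s l => forall u, Rmin s 1 <= u <= Rmax s 1 -> OmG u l) s l.
Proof.
  intros h; generalize (domG_open s l h); apply locally_2d_impl.
  apply locally_2d_forall; intros y z [hy hz] u.
  rewrite Rmin_left, Rmax_right by lra; apply domG_OmG; lra.
Qed.

Lemma OmG_pos s l : OmG s l ->
  0 < nn s /\ 0 < mm s l /\ nn s ^ 2 = 1 + L - s ^ 2 /\
  mm s l ^ 2 = 1 - l + l * s ^ 2 /\ 0 < dd s l.
Proof.
  intros (h1 & h2 & h3); unfold nn, mm.
  repeat split; try apply sqrt_lt_R0; auto; rewrite pow2_sqrt; lra.
Qed.

Lemma Gk_continuity j s l : OmG s l -> continuity_2d_pt (Gk j) s l.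
Proof.
  intros h; destruct (OmG_pos s l h) as (h1 & h2 & _).
  unfold Gk, nn, mm; cont2.
  apply Rgt_not_eq, Rmult_lt_0_compat; [now apply Rmult_lt_0_compat|].
  now apply pow_lt.
Qed.

Lemma is_derive_sqrt_quotient (f : R -> R) (x df c : R) :
  is_derive f x df -> 0 < f x -> c = df / 2 ->
  is_derive (fun t => sqrt (f t)) x (c / sqrt (f x)).
Proof.
  intros hf hp ->; evar_last; [apply (is_derive_sqrt f x df hf hp)|].
  assert (h := sqrt_lt_R0 _ hp); simpl; field; lra.
Qed.

Lemma mm_derive_l s l : OmG s l -> is_derive (mm s) l (- (1 - s ^ 2) / 2 / mm s l).
Proof.
  intros (_ & h & _).
  apply (is_derive_sqrt_quotient (fun l => 1 - l + l * s ^ 2) l (- (1 - s ^ 2)));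
    [auto_derive; [easy | ring] | exact h | simpl; lra].
Qed.

Lemma mm_derive_s s l : OmG s l -> is_derive (fun s => mm s l) s (l * s / mm s l).
Proof.
  intros (_ & h & _).
  apply (is_derive_sqrt_quotient (fun s => 1 - l + l * s ^ 2) s (2 * l * s));
    [auto_derive; [easy | ring] | exact h | simpl; lra].
Qed.

Lemma nn_derive s : 0 < 1 + L - s ^ 2 -> is_derive nn s (- s / nn s).
Proof.
  intros h.
  apply (is_derive_sqrt_quotient (fun s => 1 + L - s ^ 2) s (- 2 * s));
    [auto_derive; [easy | ring] | exact h | simpl; lra].
Qed.

(** As [mm^2] has [l]-derivative [-(1 - s^2)], each differentiation contributes a factor [1 - s^2]
    and two more powers of [1 / mm]; up to constants the family is closed. *)
Lemma Gk_derive j s l : OmG s l ->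
  is_derive (Gk j s) l ((2 * INR j + 1) / 2 * Gk (S j) s l).
Proof.
  intros h; destruct (OmG_pos s l h) as (h1 & h2 & _).
  assert (hm := mm_derive_l s l h).
  assert (hp : 0 < mm s l ^ (2 * j)) by now apply pow_lt.
  unfold Gk.
  evar_last.
  - apply (is_derive_ext (fun l => (1 - s ^ 2) ^ j / (a * nn s) * / mm s l ^ (2 * j + 1))).
    + intros t; unfold Rdiv; rewrite (Rinv_mult (a * nn s)); apply Rmult_assoc.
    + apply is_derive_scal.
      apply is_derive_inv; [|apply pow_nonzero; lra].
      apply is_derive_pow, hm.
  - replace (Init.Nat.pred (2 * j + 1)) with (2 * j)%nat by lia.
    replace (2 * S j + 1)%nat with (2 * j + 3)%nat by lia.
    rewrite !pow_add, plus_INR, mult_INR, pow_1.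
    change (INR 2) with 2; change (INR 1) with 1.
    change ((1 - s ^ 2) ^ S j) with ((1 - s ^ 2) * (1 - s ^ 2) ^ j).
    set (p := mm s l ^ (2 * j)) in *.
    eqR; field; repeat split; lra.
Qed.

Lemma G_differentiable j s l : domG s l ->
  differentiable_pt_lim (G j) s l (- Gk j s l)
    ((2 * INR j + 1) / 2 * G (S j) s l).
Proof.
  intros h.
  assert (hr := domG_range s l h).
  replace ((2 * INR j + 1) / 2 * G (S j) s l)
    with (RInt (fun u => (2 * INR j + 1) / 2 * Gk (S j) u l) s 1).
  - apply (RInt_param_differentiable (Gk j)
             (fun s l => (2 * INR j + 1) / 2 * Gk (S j) s l) OmG).
    + apply OmG_open.
    + intros; now apply Gk_derive.
    + intros; now apply Gk_continuity.
    + intros; apply continuity_2d_pt_mult;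
        [apply continuity_2d_pt_const | now apply Gk_continuity].
    + exact hr.
  - apply (RInt_scal (V := R_CompleteNormedModule)).
    apply (@ex_RInt_continuous R_CompleteNormedModule); intros z hz.
    apply continuity_2d_pt_fix_snd, Gk_continuity.
    now apply (locally_2d_singleton _ _ _ hr).
Qed.

(* [Ys] is the s-derivative of [Yf], and [Yf] is the boundary term for which
   the l-derivative of [ES] is [a^2 / 2 Gk 0 + Ys].  [E1] is the value of
   [int_0^theta Phat / Delta_theta + a^2 / 2 f] at [theta = theta_star]. *)
Definition Yf (s l : R) : R := a / 2 * (nn s * s / (mm s l * dd s l)).
Definition Ys (s l : R) : R :=
  a / 2 * ((nn s - s ^ 2 / nn s) / (mm s l * dd s l)
           - nn s * s * (l * s) / (mm s l ^ 3 * dd s l)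
           - nn s * s * (2 * l * s) / (mm s l * dd s l ^ 2)).
Definition ES (s l : R) : R := a * (l * (1 - l)) * nn s / (mm s l * dd s l).
Definition E1 (l : R) : R := - (a / (2 * sqrt L)) * ln (1 - L / (1 + L) * l).
Definition EE (s l : R) : R := E1 l - RInt (fun u => ES u l) s 1.

Lemma Yf_derive s l : OmG s l -> is_derive (fun s => Yf s l) s (Ys s l).
Proof.
  intros h; destruct (OmG_pos s l h) as (h1 & h2 & h3 & h4 & h5).
  assert (hn := nn_derive s (proj1 h)).
  assert (hm := mm_derive_s s l h).
  assert (hd : is_derive (fun s => dd s l) s (2 * l * s)).
  { unfold dd; auto_derive; [easy | ring]. }
  evar_last.
  - apply is_derive_scal.
    apply (is_derive_div (fun s => nn s * s) (fun s => mm s l * dd s l)).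
    + apply (is_derive_mult nn (fun s => s) s _ _ hn (is_derive_id s)).
      intros; apply Rmult_comm.
    + apply (is_derive_mult (fun s => mm s l) (fun s => dd s l) s _ _ hm hd).
      intros; apply Rmult_comm.
    + apply Rgt_not_eq, Rmult_lt_0_compat; lra.
  - unfold Ys, plus, mult, one; simpl; field; repeat split; lra.
Qed.

Lemma ES_derive s l : OmG s l ->
  is_derive (ES s) l (a ^ 2 / 2 * Gk 0 s l + Ys s l).
Proof.
  intros h; destruct (OmG_pos s l h) as (h1 & h2 & h3 & h4 & h5).
  assert (hm := mm_derive_l s l h).
  assert (hd : is_derive (dd s) l (- nn s ^ 2)).
  { unfold dd; auto_derive; [easy | rewrite h3; ring]. }
  evar_last.
  - unfold ES.
    apply (is_derive_div (fun l => a * (l * (1 - l)) * nn s)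
             (fun l => mm s l * dd s l)).
    + instantiate (1 := a * (1 - 2 * l) * nn s).
      auto_derive; [easy | ring].
    + apply (is_derive_mult (mm s) (dd s) l _ _ hm hd); intros; apply Rmult_comm.
    + apply Rgt_not_eq, Rmult_lt_0_compat; lra.
  - unfold Gk, Ys, plus, mult; simpl (_ + _)%nat; simpl AbsRing.sort.
    (* The goal with denominators cleared; it holds only modulo the values of [nn s ^ 2] and
       [mm s l ^ 2]. *)
    assert (hP : nn s ^ 2 * (2 * (1 - 2 * l) * mm s l ^ 2 * dd s l + l * (1 - l) *
                   ((1 - s ^ 2) * dd s l + 2 * mm s l ^ 2 * nn s ^ 2))
               = mm s l ^ 2 * dd s l ^ 2 + (nn s ^ 2 - s ^ 2) * mm s l ^ 2 * dd s l
                 - nn s ^ 2 * s ^ 2 * l * dd s l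
                 - 2 * nn s ^ 2 * l * s ^ 2 * mm s l ^ 2).
    { rewrite h3, h4; unfold dd; ring. }
    match type of hP with ?p = ?q =>
      transitivity (a / (2 * mm s l ^ 3 * dd s l ^ 2 * nn s) * p);
      [|rewrite hP] end;
    simpl; field; repeat split; lra.
Qed.

Lemma ES_continuity s l : OmG s l -> continuity_2d_pt ES s l.
Proof.
  intros h; destruct (OmG_pos s l h) as (h1 & h2 & h3 & h4 & h5).
  unfold ES, mm, nn, dd in *; cont2.
  apply Rgt_not_eq, Rmult_lt_0_compat; lra.
Qed.

Lemma Ys_continuity s l : OmG s l -> continuity_2d_pt Ys s l.
Proof.
  intros h; destruct (OmG_pos s l h) as (h1 & h2 & h3 & h4 & h5).
  unfold Ys, mm, nn, dd in *; cont2; try lra;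
  apply Rgt_not_eq, Rmult_lt_0_compat; try lra; apply pow_lt; lra.
Qed.

(** [E1] is the primitive of [Yf 1] vanishing at 0. Its closed form makes sense for [l] slightly
    outside [0, 1], where nothing is known of [f]. *)
Lemma E1_derive l : 0 < 1 + L - L * l -> is_derive E1 l (Yf 1 l).
Proof.
  intros h.
  assert (h0 : 0 < sqrt L) by now apply sqrt_lt_R0.
  assert (h1 : L = sqrt L ^ 2) by (rewrite pow2_sqrt; lra).
  assert (h2 : 1 - L / (1 + L) * l = (1 + L - L * l) / (1 + L)) by (field; lra).
  unfold E1; auto_derive.
  - unfold Rminus in h2; rewrite h2; apply Rdiv_lt_0_compat; lra.
  - unfold Yf, nn, mm, dd.
    replace (1 - l + l * 1 ^ 2) with 1 by ring.
    replace (1 + L - 1 ^ 2) with L by ring.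
    rewrite sqrt_1; unfold Rminus in h2; rewrite h2.
    apply Rminus_diag_uniq.
    transitivity (a / (2 * sqrt L * (1 + L - L * l)) * (L - sqrt L ^ 2));
      [field; repeat split; lra | rewrite <- h1; ring].
Qed.

(** Integrating [Ys] leaves boundary terms at [s] and at 1; the one at 1 cancels against the
    derivative of [E1]. *)
Lemma EE_differentiable s l : domG s l ->
  differentiable_pt_lim EE s l (ES s l) (Yf s l - a ^ 2 / 2 * G 0 s l).
Proof.
  intros h.
  assert (hr := domG_range s l h).
  assert (hO : forall u, s <= u <= 1 -> OmG u l).
  { intros u hu; apply domG_OmG with s; try apply h; exact hu. }
  destruct h as [hs hd].
  assert (h1 : 0 < 1 + L - L * l).
  { destruct (hO 1) as (_ & _ & h); [lra|]; unfold dd in h; lra. }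
  assert (hc : forall g, (forall s l, OmG s l -> continuity_2d_pt g s l) ->
            forall u, Rmin s 1 <= u <= Rmax s 1 -> continuous (fun s => g s l) u).
  { intros g hg u hu; rewrite Rmin_left, Rmax_right in hu by lra.
    now apply continuity_2d_pt_fix_snd, hg, hO. }
  assert (hI : is_RInt (fun u => a ^ 2 / 2 * Gk 0 u l + Ys u l) s 1
                 (a ^ 2 / 2 * G 0 s l + (Yf 1 l - Yf s l))).
  { apply (is_RInt_plus (V := R_NormedModule)).
    - apply (is_RInt_scal (V := R_NormedModule)).
      apply (@RInt_correct R_CompleteNormedModule).
      apply (@ex_RInt_continuous R_CompleteNormedModule).
      apply hc, Gk_continuity.
    - apply (is_RInt_derive (V := R_CompleteNormedModule) (fun s => Yf s l)).
      + intros u hu; rewrite Rmin_left, Rmax_right in hu by lra.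
        now apply Yf_derive, hO.
      + apply hc, Ys_continuity. }
  assert (hJ := RInt_param_differentiable ES
            (fun s l => a ^ 2 / 2 * Gk 0 s l + Ys s l) OmG 1 s l
            OmG_open ES_derive ES_continuity
            (fun s l h => continuity_2d_pt_plus _ _ _ _
               (continuity_2d_pt_mult _ _ _ _ (continuity_2d_pt_const _ _ _)
                  (Gk_continuity 0 s l h)) (Ys_continuity s l h)) hr).
  cbv beta in hJ; rewrite (is_RInt_unique _ _ _ _ hI) in hJ.
  assert (hE : differentiable_pt_lim (fun _ l => E1 l) s l 0 (Yf 1 l)).
  { apply filterdiff_differentiable_pt_lim.
    eapply filterdiff_ext_lin.
    - apply (filterdiff_comp' (V := R_NormedModule) (W := R_NormedModule)
               (snd : R * R -> R) E1 (s, l) snd (fun z => z * Yf 1 l)).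
      + apply filterdiff_linear, is_linear_snd.
      + now apply E1_derive.
    - intros [u v]; simpl; ring. }
  apply (proj1 (filterdiff_differentiable_pt_lim _ _ _ _ _)).
  eapply filterdiff_ext_lin.
  - apply (filterdiff_minus_fct (V := R_NormedModule)).
    + apply (proj2 (filterdiff_differentiable_pt_lim _ _ _ _ _) hE).
    + apply (proj2 (filterdiff_differentiable_pt_lim _ _ _ _ _) hJ).
  - intros [u v]; simpl; unfold minus, plus, opp; simpl; ring.
Qed.

End Angular.

(** ** The radial integrals *)

Section Radial.

Context (K : KNdS) (rn rm rp rc : R).
Context (hLam : 0 < Lam K) (hmass : 0 < mass K) (hspin : 0 < spin K).
Context (hsub : subextremal K rn rm rp rc).

(** Vieta's relations by divided differences: [d1] and [d2] are the first and second ones, and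
    comparing two second ones forces the four roots to sum to 0. The coefficient of [s^2] then reads
    [Lam / 3 (rp^2 + rm^2 + rc^2 + rp rm + rp rc + rm rc) = 1 - Lam / 3 a^2 < 1], and all summands
    on the left are positive. *)
Lemma Delta_r_factor :
  (forall s, Delta_r K s = - (Lam K / 3) * ((s - rn) * (s - rm) * (s - rp) * (s - rc)))
  /\ Lam K / 3 * rp ^ 2 < 1.
Proof.
  destruct hsub as [(h1 & h2 & h3 & h4) (e1 & e2 & e3 & e4)].
  unfold Delta_r in *.
  set (A := - (Lam K / 3)) in *.
  set (B := 1 - Lam K / 3 * spin K ^ 2).
  set (C := - 2 * mass K).
  set (D := spin K ^ 2 + charge K ^ 2).
  assert (hp : forall s, (s ^ 2 + spin K ^ 2) * (1 - Lam K / 3 * s ^ 2)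
            - 2 * mass K * s + charge K ^ 2 = A * s ^ 4 + B * s ^ 2 + C * s + D).
  { intros s; unfold A, B, C, D; ring. }
  rewrite hp in e1, e2, e3, e4.
  assert (d1 : forall x y, x <> y -> A * x ^ 4 + B * x ^ 2 + C * x + D = 0 ->
    A * y ^ 4 + B * y ^ 2 + C * y + D = 0 ->
    A * (x ^ 3 + x ^ 2 * y + x * y ^ 2 + y ^ 3) + B * (x + y) + C = 0).
  { intros x y hxy hx hy; apply Rmult_eq_reg_l with (x - y); [|lra].
    rewrite Rmult_0_r; transitivity (0 - 0); [rewrite <- hx at 1; rewrite <- hy; ring | ring]. }
  assert (d2 : forall x y z, y <> z ->
    A * (x ^ 3 + x ^ 2 * y + x * y ^ 2 + y ^ 3) + B * (x + y) + C = 0 ->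
    A * (x ^ 3 + x ^ 2 * z + x * z ^ 2 + z ^ 3) + B * (x + z) + C = 0 ->
    A * (x ^ 2 + y ^ 2 + z ^ 2 + x * y + x * z + y * z) + B = 0).
  { intros x y z hyz hy hz; apply Rmult_eq_reg_l with (y - z); [|lra].
    rewrite Rmult_0_r; transitivity (0 - 0); [rewrite <- hy at 1; rewrite <- hz; ring | ring]. }
  assert (f1 := d1 rp rn ltac:(lra) e3 e1).
  assert (f2 := d1 rp rm ltac:(lra) e3 e2).
  assert (f3 := d1 rp rc ltac:(lra) e3 e4).
  assert (g1 := d2 rp rm rn ltac:(lra) f2 f1).
  assert (g2 := d2 rp rm rc ltac:(lra) f2 f3).
  assert (hA : A < 0) by (unfold A; lra).
  assert (hsum : rn + rm + rp + rc = 0).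
  { apply Rmult_eq_reg_l with (A * (rc - rn));
      [|apply Rmult_integral_contrapositive_currified; lra].
    rewrite Rmult_0_r; transitivity (0 - 0); [rewrite <- g2 at 1; rewrite <- g1; ring | ring]. }
  assert (hn : rn = - (rm + rp + rc)) by lra.
  assert (hB : B = - A * (rp ^ 2 + rm ^ 2 + rc ^ 2 + rp * rm + rp * rc + rm * rc)) by lra.
  assert (hC : C = - A * (rp ^ 3 + rp ^ 2 * rm + rp * rm ^ 2 + rm ^ 3) - B * (rp + rm)) by lra.
  assert (hD : D = - A * rp ^ 4 - B * rp ^ 2 - C * rp) by lra.
  split.
  - intros s; rewrite hp, hD, hC, hB, hn; ring.
  - apply Rmult_lt_reg_r with 1; [lra|].
    replace (Lam K / 3) with (- A) by (unfold A; ring).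
    assert (0 < - A * (rm ^ 2 + rc ^ 2 + rp * rm + rp * rc + rm * rc)).
    { apply Rmult_lt_0_compat; [lra|]; nra. }
    assert (0 < - A * spin K ^ 2) by (apply Rmult_lt_0_compat; nra).
    assert (B = 1 + A * spin K ^ 2) by (unfold B, A; ring).
    lra.
Qed.

Lemma Delta_r_neg s : rm < s < rp -> Delta_r K s < 0.
Proof.
  intros hs; destruct hsub as [(h1 & h2 & h3 & h4) _].
  rewrite (proj1 Delta_r_factor).
  assert (0 < (s - rn) * (s - rm)) by (apply Rmult_lt_0_compat; lra).
  assert (0 < (rp - s) * (rc - s)) by (apply Rmult_lt_0_compat; lra).
  assert (0 < Lam K / 3 * (((s - rn) * (s - rm)) * ((rp - s) * (rc - s)))).
  { apply Rmult_lt_0_compat; [lra | now apply Rmult_lt_0_compat]. }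
  lra.
Qed.

Lemma Delta_r_rp : Delta_r K rp = 0.
Proof. apply hsub. Qed.

(** By the bound on [rp] the factor [1 - Lam / 3 s^2] is positive, so only the term [- 2 M s] of
    [Delta_r] is negative. *)
Lemma Delta_r_bound s : rm <= s <= rp -> - Delta_r K s <= 2 * mass K * rp.
Proof.
  intros hs; destruct hsub as [(h1 & h2 & h3 & h4) _].
  assert (h := proj2 Delta_r_factor).
  unfold Delta_r.
  assert (0 < 1 - Lam K / 3 * s ^ 2).
  { assert (s ^ 2 <= rp ^ 2) by nra.
    assert (Lam K / 3 * s ^ 2 <= Lam K / 3 * rp ^ 2) by
      (apply Rmult_le_compat_l; lra); lra. }
  assert (0 <= (s ^ 2 + spin K ^ 2) * (1 - Lam K / 3 * s ^ 2)).
  { apply Rmult_le_pos; nra. }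
  assert (2 * mass K * s <= 2 * mass K * rp) by (apply Rmult_le_compat_l; lra).
  nra.
Qed.

Definition OmH (s l : R) : Prop :=
  0 < (s ^ 2 + spin K ^ 2) ^ 2 - spin K ^ 2 * l * Delta_r K s.
(* [2 M r_+] bounds [- Delta_r] on [r_-, r_+], so the second condition keeps
   the radicand of [Q] positive for negative [l] close to [0]. *)
Definition domH (r l : R) : Prop :=
  rm < r < rp /\ 0 < spin K ^ 2 + l * (2 * mass K * rp).

Lemma OmH_open s l : OmH s l -> locally_2d OmH s l.
Proof.
  intros h; apply (locally_2d_pos (fun s l =>
    (s ^ 2 + spin K ^ 2) ^ 2 - spin K ^ 2 * l * Delta_r K s));
    [unfold Delta_r; cont2 | exact h].
Qed.

Lemma domH_open r l : domH r l -> locally_2d domH r l.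
Proof.
  intros [[h1 h2] h3].
  apply locally_2d_and; [apply locally_2d_and|].
  - apply locally_2d_impl with (fun s l : R => 0 < s - rm).
    + apply locally_2d_forall; intros; lra.
    + apply (locally_2d_pos (fun s l => s - rm)); [cont2 | lra].
  - apply locally_2d_impl with (fun s l : R => 0 < rp - s).
    + apply locally_2d_forall; intros; lra.
    + apply (locally_2d_pos (fun s l => rp - s)); [cont2 | lra].
  - apply (locally_2d_pos (fun s l => spin K ^ 2 + l * (2 * mass K * rp)));
      [cont2 | exact h3].
Qed.

(** For [l >= 0] the sign of [Delta_r] suffices. For [l < 0] the bound on [- Delta_r] gives [a^2
    (-l) (- Delta_r) < a^4 <= (s^2 + a^2)^2]. *)
Lemma domH_OmH r l s : domH r l -> r <= s <= rp -> OmH s l.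
Proof.
  intros [hr hl] hs; unfold OmH.
  assert (hb := Delta_r_bound s ltac:(lra)).
  assert (hneg : Delta_r K s <= 0).
  { destruct (Rle_lt_or_eq_dec s rp) as [h|h]; [lra | |].
    - left; apply Delta_r_neg; lra.
    - right; rewrite h; apply Delta_r_rp. }
  assert (0 < spin K ^ 2) by nra.
  destruct (Rle_dec 0 l) as [h0|h0].
  - assert (0 <= spin K ^ 2 * l * - Delta_r K s).
    { apply Rmult_le_pos; [apply Rmult_le_pos|]; lra. }
    assert (0 < (s ^ 2 + spin K ^ 2) ^ 2) by (apply pow_lt; nra).
    lra.
  - assert (h1 : - l * - Delta_r K s <= - l * (2 * mass K * rp)).
    { apply Rmult_le_compat_l; lra. }
    assert (h2 : spin K ^ 2 * (- l * - Delta_r K s) < spin K ^ 2 * spin K ^ 2).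
    { apply Rmult_lt_compat_l; lra. }
    assert (h3 : spin K ^ 2 * spin K ^ 2 <= (s ^ 2 + spin K ^ 2) ^ 2).
    { assert (0 <= s ^ 2) by nra; nra. }
    lra.
Qed.

Lemma domH_range r l : domH r l ->
  locally_2d (fun r l => forall s, Rmin r rp <= s <= Rmax r rp -> OmH s l) r l.
Proof.
  intros h; generalize (domH_open r l h); apply locally_2d_impl.
  apply locally_2d_forall; intros y z hyz s.
  assert (hy := proj1 hyz).
  rewrite Rmin_left, Rmax_right by lra; now apply domH_OmH.
Qed.

Definition Hk (j : nat) (s l : R) : R :=
  (spin K ^ 2 * Delta_r K s) ^ j / Qhat K s l ^ (2 * j + 1).
Definition H (j : nat) (r l : R) : R := RInt (fun s => Hk j s l) r rp.

Lemma Qhat_pos s l : OmH s l -> 0 < Qhat K s l.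
Proof. apply sqrt_lt_R0. Qed.

Lemma Qhat_sqr s l : OmH s l ->
  Qhat K s l ^ 2 = (s ^ 2 + spin K ^ 2) ^ 2 - spin K ^ 2 * l * Delta_r K s.
Proof. intros h; apply pow2_sqrt; now left. Qed.

Lemma Qhat_derive_l s l : OmH s l ->
  is_derive (Qhat K s) l (- (spin K ^ 2 * Delta_r K s) / 2 / Qhat K s l).
Proof.
  intros h.
  apply (is_derive_sqrt_quotient (fun l =>
           (s ^ 2 + spin K ^ 2) ^ 2 - spin K ^ 2 * l * Delta_r K s) l
           (- (spin K ^ 2 * Delta_r K s)));
    [auto_derive; [easy | ring] | exact h | simpl; lra].
Qed.

Lemma Hk_continuity j s l : OmH s l -> continuity_2d_pt (Hk j) s l.
Proof.
  intros h; assert (h1 := Qhat_pos s l h).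
  unfold Hk, Qhat, Delta_r in *; cont2.
  apply Rgt_not_eq, pow_lt, h1.
Qed.

Lemma Hk_derive j s l : OmH s l ->
  is_derive (Hk j s) l ((2 * INR j + 1) / 2 * Hk (S j) s l).
Proof.
  intros h; assert (h1 := Qhat_pos s l h).
  assert (hm := Qhat_derive_l s l h).
  assert (hp : 0 < Qhat K s l ^ (2 * j)) by now apply pow_lt.
  unfold Hk.
  evar_last.
  - apply is_derive_scal.
    apply is_derive_inv; [|apply pow_nonzero; lra].
    apply is_derive_pow, hm.
  - replace (Init.Nat.pred (2 * j + 1)) with (2 * j)%nat by lia.
    replace (2 * S j + 1)%nat with (2 * j + 3)%nat by lia.
    rewrite !pow_add, plus_INR, mult_INR, pow_1.
    change (INR 2) with 2; change (INR 1) with 1.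
    change ((spin K ^ 2 * Delta_r K s) ^ S j)
      with ((spin K ^ 2 * Delta_r K s) * (spin K ^ 2 * Delta_r K s) ^ j).
    set (p := Qhat K s l ^ (2 * j)) in *.
    eqR; field; repeat split; lra.
Qed.

Lemma H_differentiable j r l : domH r l ->
  differentiable_pt_lim (H j) r l (- Hk j r l)
    ((2 * INR j + 1) / 2 * H (S j) r l).
Proof.
  intros h; assert (hr := domH_range r l h).
  replace ((2 * INR j + 1) / 2 * H (S j) r l)
    with (RInt (fun u => (2 * INR j + 1) / 2 * Hk (S j) u l) r rp).
  - apply (RInt_param_differentiable (Hk j)
             (fun s l => (2 * INR j + 1) / 2 * Hk (S j) s l) OmH).
    + apply OmH_open.
    + intros; now apply Hk_derive.
    + intros; now apply Hk_continuity.
    + intros; apply continuity_2d_pt_mult;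
        [apply continuity_2d_pt_const | now apply Hk_continuity].
    + exact hr.
  - apply (RInt_scal (V := R_CompleteNormedModule)).
    apply (@ex_RInt_continuous R_CompleteNormedModule); intros z hz.
    apply continuity_2d_pt_fix_snd, Hk_continuity.
    now apply (locally_2d_singleton _ _ _ hr).
Qed.

(* [(s^2 + a^2 - Q) / Delta_r] with its singularity at [rp] removed. *)
Definition Bk (s l : R) : R :=
  spin K ^ 2 * l / (s ^ 2 + spin K ^ 2 + Qhat K s l).

Lemma Bk_eq s l : OmH s l -> Delta_r K s <> 0 ->
  (s ^ 2 + spin K ^ 2 - Qhat K s l) / Delta_r K s = Bk s l.
Proof.
  intros h h0; assert (h1 := Qhat_pos s l h); assert (h2 := Qhat_sqr s l h).
  assert (h3 : 0 < s ^ 2 + spin K ^ 2) by nra.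
  unfold Bk; apply Rmult_eq_reg_r with (Delta_r K s * (s ^ 2 + spin K ^ 2 + Qhat K s l)).
  - transitivity ((s ^ 2 + spin K ^ 2) ^ 2 - Qhat K s l ^ 2); [field; exact h0|].
    rewrite h2; field; lra.
  - apply Rmult_integral_contrapositive_currified; lra.
Qed.

(** With [w = s^2 + a^2] and [q = Qhat], the relation [a^2 l Delta_r = w^2 - q^2] collapses the
    quotient rule to [a^2 / (2 q)]. This ties the radial part of [r_star] to [H]. *)
Lemma Bk_derive s l : OmH s l ->
  is_derive (Bk s) l (spin K ^ 2 / 2 * Hk 0 s l).
Proof.
  intros h; assert (h1 := Qhat_pos s l h); assert (h2 := Qhat_sqr s l h).
  assert (h3 : 0 < s ^ 2 + spin K ^ 2) by nra.
  assert (hm : is_derive (fun l => s ^ 2 + spin K ^ 2 + Qhat K s l) l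
                 (- (spin K ^ 2 * Delta_r K s) / 2 / Qhat K s l)).
  { evar_last.
    - apply (is_derive_plus (fun _ => s ^ 2 + spin K ^ 2) (Qhat K s) l zero
               (- (spin K ^ 2 * Delta_r K s) / 2 / Qhat K s l));
        [apply @is_derive_const | now apply Qhat_derive_l].
    - apply Rplus_0_l. }
  evar_last.
  - apply (is_derive_div (fun l => spin K ^ 2 * l)
             (fun l => s ^ 2 + spin K ^ 2 + Qhat K s l) l (spin K ^ 2) (- (spin K ^ 2 * Delta_r K s) / 2 / Qhat K s l)).
    + auto_derive; [easy | ring].
    + exact hm.
    + lra.
  - unfold Hk; simpl (_ + _)%nat.
    set (w := s ^ 2 + spin K ^ 2) in *; set (q := Qhat K s l) in *.
    replace (spin K ^ 2 * l * (- (spin K ^ 2 * Delta_r K s) / 2 / q))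
      with (spin K ^ 2 * (q ^ 2 - w ^ 2) / (2 * q)).
    + eqR; field; lra.
    + eqR; rewrite h2; unfold w; field; lra.
Qed.

Lemma Bk_continuity s l : OmH s l -> continuity_2d_pt Bk s l.
Proof.
  intros h; assert (h1 := Qhat_pos s l h).
  assert (h3 : 0 < s ^ 2 + spin K ^ 2) by nra.
  unfold Bk, Qhat, Delta_r in *; cont2; lra.
Qed.

Definition B0 (r0 r l : R) : R :=
  RInt (fun s => (s ^ 2 + spin K ^ 2) / Delta_r K s) r0 r
  + RInt (fun s => Bk s l) r rp.

(** The two moving limits contribute [(r^2 + a^2) / Delta_r - Bk r l], which is [Q / Delta_r] by
    [Bk_eq]. *)
Lemma B0_differentiable r0 r l : rm < r0 < rp -> domH r l ->
  differentiable_pt_lim (B0 r0) r l (Qhat K r l / Delta_r K r)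
    (spin K ^ 2 / 2 * H 0 r l).
Proof.
  intros hr0 h; assert (hr := domH_range r l h).
  assert (hJ := RInt_param_differentiable Bk
            (fun s l => spin K ^ 2 / 2 * Hk 0 s l) OmH rp r l
            OmH_open Bk_derive Bk_continuity
            (fun s l h => continuity_2d_pt_mult _ _ _ _
               (continuity_2d_pt_const _ _ _) (Hk_continuity 0 s l h)) hr).
  assert (hO := domH_OmH r l r h ltac:(destruct h; lra)).
  assert (hD := Delta_r_neg r (proj1 h)).
  assert (hI : is_derive (fun r => RInt (fun s => (s ^ 2 + spin K ^ 2) / Delta_r K s) r0 r)
                 r ((r ^ 2 + spin K ^ 2) / Delta_r K r)).
  { assert (hc : forall z, rm < z < rp ->
              continuous (fun s => (s ^ 2 + spin K ^ 2) / Delta_r K s) z).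
    { intros z hz; apply (ex_derive_continuous (K := R_AbsRing) (V := R_NormedModule)).
      assert (h0 := Delta_r_neg z hz); unfold Delta_r in *; auto_derive.
      revert h0; simpl; lra. }
    apply (is_derive_RInt (V := R_NormedModule)
             (fun s => (s ^ 2 + spin K ^ 2) / Delta_r K s)
             (fun r => RInt (fun s => (s ^ 2 + spin K ^ 2) / Delta_r K s) r0 r) r0 r).
    - apply (locally_interval _ r rm rp); simpl; try apply h.
      intros y hy1 hy2; apply (@RInt_correct R_CompleteNormedModule).
      apply (@ex_RInt_continuous R_CompleteNormedModule).
      intros z hz; apply hc.
      revert hz; apply Rmin_case; apply Rmax_case; lra.
    - apply hc, h. }
  assert (hE : differentiable_pt_lim
    (fun r _ => RInt (fun s => (s ^ 2 + spin K ^ 2) / Delta_r K s) r0 r) r l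
    ((r ^ 2 + spin K ^ 2) / Delta_r K r) 0).
  { apply differentiable_pt_lim_proj1_0, is_derive_Reals, hI. }
  apply (proj1 (filterdiff_differentiable_pt_lim _ _ _ _ _)).
  eapply filterdiff_ext_lin.
  - apply (filterdiff_plus_fct (V := R_NormedModule)).
    + apply (proj2 (filterdiff_differentiable_pt_lim _ _ _ _ _) hE).
    + apply (proj2 (filterdiff_differentiable_pt_lim _ _ _ _ _) hJ).
  - intros [u v].
    change (u * ((r ^ 2 + spin K ^ 2) / Delta_r K r) + v * 0
            + (u * - Bk r l + v * RInt (fun s => spin K ^ 2 / 2 * Hk 0 s l) r rp)
            = u * (Qhat K r l / Delta_r K r) + v * (spin K ^ 2 / 2 * H 0 r l)).
    rewrite <- (Bk_eq r l hO) by lra.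
    replace (RInt (fun s => spin K ^ 2 / 2 * Hk 0 s l) r rp)
      with (spin K ^ 2 / 2 * H 0 r l).
    + field; lra.
    + symmetry; apply (RInt_scal (V := R_CompleteNormedModule)).
      apply (@ex_RInt_continuous R_CompleteNormedModule); intros z hz.
      apply continuity_2d_pt_fix_snd, Hk_continuity.
      now apply (locally_2d_singleton _ _ _ hr).
Qed.

End Radial.

(** ** Passage to the variables s and l *)

(** Meant for [theta_star = 0] and [PI / 2], where the square root in [Phat] vanishes at the upper
    limit and [RInt_param_differentiable] does not apply. Rescaling to [0, 1] turns the moving limit
    into a parameter, and uniform continuity on a compact set concludes. *)
Lemma continuity_RInt_diagonal (k : R -> R -> R) (y : R) :
  (forall x z, continuity_2d_pt k x z) ->
  continuity_pt (fun z => RInt (fun x => k x z) 0 z) y.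
Proof.
  intros hk.
  assert (hk1 : forall z x, continuous (fun x => k x z) x).
  { intros z x; apply continuity_2d_pt_fix_snd, hk. }
  set (h := fun t z => z * k (z * t + 0) z).
  assert (hh : forall t z, continuity_2d_pt h t z).
  { intros t z; unfold h; apply continuity_2d_pt_mult;
      [apply continuity_2d_pt_id2|].
    apply (continuity_2d_pt_comp k); [cont2 | cont2 | apply hk]. }
  assert (hE : forall z, RInt (fun x => k x z) 0 z = RInt (fun t => h t z) 0 1).
  { intros z; transitivity (RInt (fun x => k x z) (z * 0 + 0) (z * 1 + 0)).
    - f_equal; ring.
    - symmetry; apply (RInt_comp_lin (V := R_CompleteNormedModule) (fun x => k x z)).
      apply (@ex_RInt_continuous R_CompleteNormedModule); intros; apply hk1. }
  assert (hI : forall z, ex_RInt (fun t => h t z) 0 1).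
  { intros z; apply (@ex_RInt_continuous R_CompleteNormedModule); intros.
    apply continuity_2d_pt_fix_snd, hh. }
  apply continuity_pt_locally; intros eps.
  assert (he : 0 < eps / 2) by (generalize (cond_pos eps); lra).
  destruct (uniform_continuity_2d_1d h 0 1 y (fun x _ => hh x y) (mkposreal _ he))
    as [d hd]; simpl in hd.
  exists d; intros z hz; rewrite !hE.
  change (Rabs (minus (RInt (fun t => h t z) 0 1) (RInt (fun t => h t y) 0 1)) < eps).
  rewrite <- (RInt_minus (V := R_CompleteNormedModule)) by apply hI.
  apply Rle_lt_trans with ((1 - 0) * (eps / 2)); [|generalize (cond_pos eps); lra].
  apply abs_RInt_le_const; [lra | |].
  - apply (@ex_RInt_minus R_NormedModule); apply hI.
  - intros t ht; left.
    change (Rabs (z - y) < d) in hz; apply Rabs_def2 in hz.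
    generalize (cond_pos d); intros hdp.
    apply (hd t y t z); try lra.
    rewrite Rminus_diag, Rabs_R0; exact hdp.
Qed.

Section Link.

Context (K : KNdS) (rn rm rp rc : R).
Context (hLam : 0 < Lam K) (hmass : 0 < mass K) (hspin : 0 < spin K).
Context (hsub : subextremal K rn rm rp rc).

Let a := spin K.
Let L := Lam K / 3 * spin K ^ 2.

Lemma L_pos : 0 < L.
Proof. unfold L; apply Rmult_lt_0_compat; nra. Qed.

Lemma Delta_theta_ge x : 1 <= Delta_theta K x.
Proof.
  unfold Delta_theta; generalize L_pos; unfold L; intros.
  assert (0 <= cos x ^ 2) by nra; nra.
Qed.

Lemma sin_cos_pos x : 0 < x < PI / 2 -> 0 < sin x /\ 0 < cos x.
Proof.
  intros hx; generalize PI_RGT_0; intros; split;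
    [apply sin_gt_0 | apply cos_gt_0]; lra.
Qed.

Lemma cos_sqr x : cos x ^ 2 = 1 - sin x ^ 2.
Proof. generalize (sin2_cos2 x); unfold Rsqr; intros; simpl; lra. Qed.

Lemma mm_sqr_trig s psi :
  0 < psi < PI / 2 -> 0 < sin psi ^ 2 * s ^ 2 + cos psi ^ 2 /\
  mm s (sin psi ^ 2) ^ 2 = sin psi ^ 2 * s ^ 2 + cos psi ^ 2 /\
  0 < mm s (sin psi ^ 2).
Proof.
  intros hp; destruct (sin_cos_pos psi hp) as [h1 h2].
  assert (h : 0 < sin psi ^ 2 * s ^ 2 + cos psi ^ 2).
  { assert (0 <= (sin psi * s) ^ 2) by apply pow2_ge_0.
    assert (0 < cos psi ^ 2) by (apply pow_lt; lra); nra. }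
  assert (he : 1 - sin psi ^ 2 + sin psi ^ 2 * s ^ 2
               = sin psi ^ 2 * s ^ 2 + cos psi ^ 2) by (rewrite cos_sqr; ring).
  unfold mm; rewrite he; repeat split; [exact h | | now apply sqrt_lt_R0].
  rewrite pow2_sqrt; lra.
Qed.

Lemma sin_cos_atan s psi : 0 < psi < PI / 2 ->
  sin (atan (s * tan psi)) ^ 2 = s ^ 2 * sin psi ^ 2 / mm s (sin psi ^ 2) ^ 2 /\
  cos (atan (s * tan psi)) ^ 2 = cos psi ^ 2 / mm s (sin psi ^ 2) ^ 2.
Proof.
  intros hp; destruct (sin_cos_pos psi hp) as [h1 h2].
  destruct (mm_sqr_trig s psi hp) as (h3 & h4 & _).
  rewrite h4, sin_atan, cos_atan; unfold tan, Rsqr.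
  assert (h5 : 1 + s * (sin psi / cos psi) * (s * (sin psi / cos psi))
     = (sin psi ^ 2 * s ^ 2 + cos psi ^ 2) / cos psi ^ 2) by (field; lra).
  rewrite h5.
  assert (h6 : 0 < (sin psi ^ 2 * s ^ 2 + cos psi ^ 2) / cos psi ^ 2).
  { apply Rdiv_lt_0_compat; [exact h3 | now apply pow_lt]. }
  assert (h7 := pow2_sqrt _ (Rlt_le _ _ h6)).
  assert (h8 := sqrt_lt_R0 _ h6).
  set (w := sqrt _) in *.
  split.
  - transitivity (s ^ 2 * (sin psi / cos psi) ^ 2 / w ^ 2); [field; lra|].
    rewrite h7; field; lra.
  - transitivity (1 / w ^ 2); [field; lra|].
    rewrite h7; field; lra.
Qed.

Lemma Phat_subst s psi : 0 < psi < PI / 2 -> 0 < s -> s ^ 2 < 1 + L ->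
  Phat K (atan (s * tan psi)) (sin psi ^ 2) =
  a * (sin psi * cos psi * nn L s / mm s (sin psi ^ 2)).
Proof.
  intros hp hs hs2; destruct (sin_cos_pos psi hp) as [h1 h2].
  destruct (mm_sqr_trig s psi hp) as (h3 & h4 & h5).
  destruct (sin_cos_atan s psi hp) as [e1 e2].
  assert (hn : 0 < nn L s) by (apply sqrt_lt_R0; lra).
  assert (hn2 : nn L s ^ 2 = 1 + L - s ^ 2) by (apply pow2_sqrt; lra).
  unfold Phat; fold a; f_equal.
  unfold Delta_theta; fold L; rewrite e1, e2.
  replace (sin psi ^ 2 * (1 + L * (cos psi ^ 2 / mm s (sin psi ^ 2) ^ 2)) -
           s ^ 2 * sin psi ^ 2 / mm s (sin psi ^ 2) ^ 2)
    with ((sin psi * cos psi * nn L s / mm s (sin psi ^ 2)) ^ 2).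
  - apply sqrt_pow2; left; apply Rdiv_lt_0_compat; [|exact h5].
    repeat apply Rmult_lt_0_compat; assumption.
  - transitivity (sin psi ^ 2 * cos psi ^ 2 * nn L s ^ 2 / mm s (sin psi ^ 2) ^ 2);
      [field; lra | rewrite hn2].
    apply Rmult_eq_reg_r with (mm s (sin psi ^ 2) ^ 2); [|apply pow_nonzero; lra].
    transitivity (sin psi ^ 2 * cos psi ^ 2 * (1 + L - s ^ 2)); [field; lra|].
    transitivity (sin psi ^ 2 * (mm s (sin psi ^ 2) ^ 2 + L * cos psi ^ 2)
                  - s ^ 2 * sin psi ^ 2); [|field; lra].
    rewrite h4, cos_sqr; ring.
Qed.

Lemma Delta_theta_subst s psi : 0 < psi < PI / 2 ->
  Delta_theta K (atan (s * tan psi)) =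
  dd L s (sin psi ^ 2) / mm s (sin psi ^ 2) ^ 2.
Proof.
  intros hp; destruct (mm_sqr_trig s psi hp) as (h3 & h4 & h5).
  unfold Delta_theta; fold L; rewrite (proj2 (sin_cos_atan s psi hp)).
  apply Rmult_eq_reg_r with (mm s (sin psi ^ 2) ^ 2); [|apply pow_nonzero; lra].
  transitivity (mm s (sin psi ^ 2) ^ 2 + L * cos psi ^ 2); [field; lra|].
  rewrite h4; unfold dd; rewrite cos_sqr.
  rewrite cos_sqr in h3; field; lra.
Qed.

Lemma tan_quotient theta psi : 0 < theta <= psi -> psi < PI / 2 ->
  0 < tan theta / tan psi <= 1.
Proof.
  intros ht hp.
  assert (0 < tan psi) by (apply tan_gt_0; lra).
  assert (0 < tan theta) by (apply tan_gt_0; lra).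
  split; [now apply Rdiv_lt_0_compat|].
  apply Rmult_le_reg_r with (tan psi); [lra|].
  unfold Rdiv; rewrite Rmult_assoc, Rinv_l, Rmult_1_r, Rmult_1_l by lra.
  destruct (Req_dec theta psi) as [->|]; [lra|].
  left; apply tan_increasing; lra.
Qed.

(** The factor [sin psi cos psi / mm^2] is the [s]-derivative of [atan (s tan psi)]. *)
Lemma RInt_subst_tan (phi : R -> R) theta psi :
  0 < theta <= psi -> psi < PI / 2 ->
  (forall x, theta <= x <= psi -> continuous phi x) ->
  RInt phi theta psi =
  RInt (fun s => sin psi * cos psi / mm s (sin psi ^ 2) ^ 2
                 * phi (atan (s * tan psi))) (tan theta / tan psi) 1.
Proof.
  intros ht hp hc.
  assert (hp' : 0 < psi < PI / 2) by lra.
  destruct (sin_cos_pos psi hp') as [h1 h2].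
  assert (hT : 0 < tan psi) by (apply tan_gt_0; lra).
  set (sg := tan theta / tan psi).
  assert (hs : 0 < sg <= 1) by now apply tan_quotient.
  assert (e1 : atan (sg * tan psi) = theta).
  { unfold sg; replace (tan theta / tan psi * tan psi) with (tan theta) by (field; lra).
    apply atan_tan; lra. }
  assert (e2 : atan (1 * tan psi) = psi) by (rewrite Rmult_1_l; apply atan_tan; lra).
  transitivity (RInt phi (atan (sg * tan psi)) (atan (1 * tan psi)));
    [now rewrite e1, e2 | symmetry].
  apply (RInt_comp (V := R_CompleteNormedModule) phi (fun s => atan (s * tan psi))).
  - rewrite Rmin_left, Rmax_right by lra.
    intros x hx; apply hc.
    assert (hmon : forall u v, u <= v -> atan u <= atan v).
    { intros u v [huv| ->]; [left; now apply atan_increasing | lra]. }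
    generalize (hmon (sg * tan psi) (x * tan psi)) (hmon (x * tan psi) (1 * tan psi)).
    rewrite e1, e2; intros ha hb; split; [apply ha | apply hb];
      apply Rmult_le_compat_r; lra.
  - intros x _.
    destruct (mm_sqr_trig x psi hp') as (h3 & h4 & h5).
    split.
    + auto_derive; [easy|].
      rewrite h4; unfold tan, Rsqr; field; repeat split; lra.
    + assert (hcc : continuity_2d_pt
        (fun x _ => sin psi * cos psi / mm x (sin psi ^ 2) ^ 2) x 0).
      { unfold mm in *; cont2. apply pow_nonzero; lra. }
      exact (continuity_2d_pt_fix_snd _ _ _ hcc).
Qed.

Definition OmP (x z : R) : Prop := 0 < sin z ^ 2 * Delta_theta K x - sin x ^ 2.

(** For fixed [z] the radicand of [P] decreases in [x] on [0, PI / 2]. *)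
Lemma OmP_between x y z : 0 <= x <= y -> y <= PI / 2 -> OmP y z -> OmP x z.
Proof.
  unfold OmP, Delta_theta; fold L; intros hx hy h.
  assert (h1 : 0 <= sin x <= sin y).
  { generalize PI_RGT_0; intros; split; [apply sin_ge_0 | apply sin_incr_1]; lra. }
  assert (h2 : sin x ^ 2 <= sin y ^ 2) by (apply pow_incr; lra).
  assert (h3 : cos y ^ 2 <= cos x ^ 2) by (rewrite !cos_sqr; lra).
  assert (h4 : 0 <= sin z ^ 2) by apply pow2_ge_0.
  assert (h5 : L * cos y ^ 2 <= L * cos x ^ 2).
  { apply Rmult_le_compat_l; [left; apply L_pos | exact h3]. }
  assert (h6 : sin z ^ 2 * (1 + L * cos y ^ 2) <= sin z ^ 2 * (1 + L * cos x ^ 2)).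
  { apply Rmult_le_compat_l; lra. }
  lra.
Qed.

Lemma OmP_diag psi : 0 < psi < PI / 2 -> OmP psi psi.
Proof.
  intros hp; destruct (sin_cos_pos psi hp) as [h1 h2].
  unfold OmP, Delta_theta; fold L.
  replace (sin psi ^ 2 * (1 + L * cos psi ^ 2) - sin psi ^ 2)
    with (sin psi ^ 2 * (L * cos psi ^ 2)) by ring.
  apply Rmult_lt_0_compat; [now apply pow_lt|].
  apply Rmult_lt_0_compat; [apply L_pos | now apply pow_lt].
Qed.

Lemma Phat_pos x z : OmP x z -> 0 < Phat K x (sin z ^ 2).
Proof.
  intros h; apply Rmult_lt_0_compat; [exact hspin | now apply sqrt_lt_R0].
Qed.

Lemma Phat_continuity x z : continuity_2d_pt (fun x z => Phat K x (sin z ^ 2)) x z.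
Proof. unfold Phat, Delta_theta; cont2. Qed.

Lemma Delta_theta_continuity x z : continuity_2d_pt (fun x _ => Delta_theta K x) x z.
Proof. unfold Delta_theta; cont2. Qed.

(** The factor [sin psi cos psi] of the Jacobian cancels against the same factor of [P]; what is
    left depends on [psi] only through [sin psi ^ 2] and stays regular as [psi] tends to 0 or
    [PI / 2]. *)
Lemma RInt_inv_P theta psi : 0 < theta <= psi -> psi < PI / 2 ->
  RInt (fun x => / P K x psi) psi theta =
  - G a L 0 (tan theta / tan psi) (sin psi ^ 2).
Proof.
  intros ht hp; assert (hp' : 0 < psi < PI / 2) by lra.
  destruct (sin_cos_pos psi hp') as [h1 h2].
  assert (hO : forall x, theta <= x <= psi -> OmP x psi).
  { intros x hx; apply OmP_between with psi; [lra | lra | now apply OmP_diag]. }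
  rewrite <- (opp_RInt_swap (V := R_CompleteNormedModule)).
  - change (- RInt (fun x => / Phat K x (sin psi ^ 2)) theta psi =
            - G a L 0 (tan theta / tan psi) (sin psi ^ 2)).
    f_equal.
    rewrite RInt_subst_tan; try assumption.
    + apply RInt_ext.
      assert (hr := tan_quotient theta psi ht hp).
      rewrite Rmin_left, Rmax_right by lra.
      intros s hs.
      assert (hs2 : s ^ 2 < 1 + L) by (generalize L_pos; nra).
      rewrite Phat_subst by lra.
      destruct (mm_sqr_trig s psi hp') as (h3 & h4 & h5).
      assert (hn : 0 < nn L s) by (apply sqrt_lt_R0; lra).
      unfold Gk; simpl (2 * 0 + 1)%nat; unfold a; eqR; field; repeat split; lra.
    + intros x hx.
      apply (continuity_2d_pt_fix_snd (fun x z => / Phat K x (sin z ^ 2)) x psi).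
      apply continuity_2d_pt_inv; [apply Phat_continuity|].
      apply Rgt_not_eq, Phat_pos, hO, hx.
  - apply (@ex_RInt_continuous R_CompleteNormedModule); intros x hx.
    rewrite Rmin_left, Rmax_right in hx by lra.
    apply (continuity_2d_pt_fix_snd (fun x z => / Phat K x (sin z ^ 2)) x psi).
    apply continuity_2d_pt_inv; [apply Phat_continuity|].
    apply Rgt_not_eq, Phat_pos, hO, hx.
Qed.

Lemma Phat_quotient_continuity x z :
  continuity_2d_pt (fun x z => Phat K x (sin z ^ 2) / Delta_theta K x) x z.
Proof.
  apply continuity_2d_pt_mult; [apply Phat_continuity|].
  apply continuity_2d_pt_inv; [apply Delta_theta_continuity|].
  generalize (Delta_theta_ge x); lra.
Qed.

Lemma RInt_Phat theta psi : 0 < theta <= psi -> psi < PI / 2 ->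
  RInt (fun x => Phat K x (sin psi ^ 2) / Delta_theta K x) theta psi =
  RInt (fun s => ES a L s (sin psi ^ 2)) (tan theta / tan psi) 1.
Proof.
  intros ht hp; assert (hp' : 0 < psi < PI / 2) by lra.
  destruct (sin_cos_pos psi hp') as [h1 h2].
  rewrite RInt_subst_tan; try assumption.
  - apply RInt_ext.
    assert (hr := tan_quotient theta psi ht hp).
    rewrite Rmin_left, Rmax_right by lra.
    intros s hs.
    assert (hs2 : s ^ 2 < 1 + L) by (generalize L_pos; nra).
    rewrite Phat_subst, Delta_theta_subst by lra.
    destruct (mm_sqr_trig s psi hp') as (h3 & h4 & h5).
    assert (hd : 0 < dd L s (sin psi ^ 2)).
    { generalize (Delta_theta_ge (atan (s * tan psi))).
      rewrite Delta_theta_subst by lra; intros hge.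
      assert (0 < mm s (sin psi ^ 2) ^ 2) by now apply pow_lt.
      replace (dd L s (sin psi ^ 2)) with
        (dd L s (sin psi ^ 2) / mm s (sin psi ^ 2) ^ 2 * mm s (sin psi ^ 2) ^ 2)
        by (field; lra).
      apply Rmult_lt_0_compat; lra. }
    unfold ES; rewrite <- cos_sqr; eqR; field; split; lra.
  - intros x hx.
    exact (continuity_2d_pt_fix_snd _ x psi (Phat_quotient_continuity x psi)).
Qed.


(** The prescription for [f'] is what cancels the integral of the [lambda]-derivative of
    [Phat / Delta_theta], namely [a^2 / 2] times that of [1 / Phat]. Only the boundary term at
    [theta = psi] survives, and [E1] is its primitive. The difference [D] of the two sides is
    therefore constant on the open interval; continuity extends this to the ends, where [f] need not
    be differentiable. In the variable [psi] the limit [asin (sqrt lambda)] is simply [psi]. *)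
Lemma E_endpoint (f : R -> R) psi : is_f K f -> 0 <= psi <= PI / 2 ->
  RInt (fun x => Phat K x (sin psi ^ 2) / Delta_theta K x) 0 psi
  + a ^ 2 / 2 * f (sin psi ^ 2) = E1 a L (sin psi ^ 2).
Proof.
  intros (hf0 & hfc & hfd) hpsi.
  assert (hLp := L_pos); assert (hPI := PI_RGT_0).
  set (J := fun psi => RInt (fun x => Phat K x (sin psi ^ 2) / Delta_theta K x) 0 psi).
  set (D := fun psi => J psi + a ^ 2 / 2 * f (sin psi ^ 2) - E1 a L (sin psi ^ 2)).
  assert (hsin : forall z, 0 <= sin z ^ 2 <= 1).
  { intros z; generalize (pow2_ge_0 (sin z)) (pow2_ge_0 (cos z)) (cos_sqr z); lra. }
  assert (hE1 : forall z, is_derive (E1 a L) (sin z ^ 2) (Yf a L 1 (sin z ^ 2))).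
  { intros z; apply (E1_derive a L hLp).
    assert (0 <= L * (1 - sin z ^ 2)) by (generalize (hsin z); intros; apply Rmult_le_pos; lra).
    lra. }
  assert (hsq : forall z, is_derive (fun z => sin z ^ 2) z (2 * sin z * cos z)).
  { intros z; auto_derive; [easy | ring]. }
  assert (hD0 : D 0 = 0).
  { unfold D, J; rewrite RInt_point, sin_0.
    replace (0 ^ 2) with 0 by ring; rewrite hf0; unfold E1.
    replace (1 - L / (1 + L) * 0) with 1 by ring; rewrite ln_1.
    unfold zero; simpl; ring. }
  assert (hJ : forall z, continuity_pt J z).
  { intros z; apply (continuity_RInt_diagonal
      (fun x psi => Phat K x (sin psi ^ 2) / Delta_theta K x)).
    apply Phat_quotient_continuity. }
  assert (hcont : forall z, continuity_pt D z).
  { intros z; apply continuity_pt_filterlim.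
    apply (continuous_minus (V := R_NormedModule)
             (fun psi => J psi + a ^ 2 / 2 * f (sin psi ^ 2))
             (fun psi => E1 a L (sin psi ^ 2))).
    - apply (continuous_plus (V := R_NormedModule) J).
      + apply continuity_pt_filterlim, hJ.
      (* [f] is continuous relative to [0, 1] only, but [sin^2] takes all its values there. *)
      + apply (continuous_scal_r (V := R_NormedModule) (a ^ 2 / 2)
                 (fun psi => f (sin psi ^ 2))).
        unfold continuous.
        eapply filterlim_comp; [|apply (hfc (sin z ^ 2)), hsin].
        intros P hP.
        assert (hc : continuous (fun z => sin z ^ 2) z).
        { apply (ex_derive_continuous (fun z => sin z ^ 2)); eexists; apply hsq. }
        generalize (hc _ hP); unfold filtermap.
        apply filter_imp; intros y hy; apply hy, hsin.
    - apply (continuous_comp (fun psi => sin psi ^ 2) (E1 a L)).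
      + apply (ex_derive_continuous (fun z => sin z ^ 2)); eexists; apply hsq.
      + apply (ex_derive_continuous (E1 a L)); eexists; apply hE1. }
  assert (hder : forall z, 0 < z < PI / 2 -> is_derive D z 0).
  { intros z hz; destruct (sin_cos_pos z hz) as [h1 h2].
    assert (hz2 : 0 < sin z ^ 2 < 1).
    { split; [now apply pow_lt|].
      assert (0 < cos z ^ 2) by now apply pow_lt.
      generalize (cos_sqr z); lra. }
    set (k := fun x psi => Phat K x (sin psi ^ 2) / Delta_theta K x).
    set (kz := fun x psi => a ^ 2 * sin psi * cos psi * / Phat K x (sin psi ^ 2)).
    assert (hopen : forall x y, OmP x y -> locally_2d OmP x y).
    { intros x y h; apply (locally_2d_pos (fun x z =>
        sin z ^ 2 * Delta_theta K x - sin x ^ 2)); [unfold Delta_theta; cont2 | exact h]. }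
    assert (hrange : locally_2d (fun y psi => forall x,
              Rmin y 0 <= x <= Rmax y 0 -> OmP x psi) z z).
    { assert (h3 : locally_2d (fun y _ => 0 < y) z z).
      { apply (locally_2d_pos (fun y _ => y)); [cont2 | lra]. }
      assert (h4 : locally_2d (fun y _ => 0 < PI / 2 - y) z z).
      { apply (locally_2d_pos (fun y _ => PI / 2 - y)); [cont2 | lra]. }
      generalize (locally_2d_and _ _ _ _ h3 (locally_2d_and _ _ _ _ h4
                    (hopen z z (OmP_diag z hz)))).
      apply locally_2d_impl, locally_2d_forall; intros y p (hy1 & hy2 & hy3) x.
      rewrite Rmin_right, Rmax_left by lra; intros hx.
      apply OmP_between with y; [exact hx | lra | exact hy3]. }
    assert (hdiff := RInt_param_differentiable k kz OmP 0 z z hopen).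
    (* [RInt_param_differentiable] moves the lower limit, so the integral is reversed; afterwards
       both arguments are set equal to [psi]. *)
    assert (hJd : is_derive J z (k z z - RInt (fun x => kz x z) z 0)).
    { apply is_derive_ext with (fun psi => - RInt (fun x => k x psi) psi 0).
      - intros t; unfold J; fold (k).
        rewrite <- (opp_RInt_swap (V := R_CompleteNormedModule)).
        + apply Ropp_involutive.
        + apply (@ex_RInt_continuous R_CompleteNormedModule); intros x _.
          exact (continuity_2d_pt_fix_snd _ x t (Phat_quotient_continuity x t)).
      - replace (k z z - RInt (fun x => kz x z) z 0)
          with (opp (- k z z * 1 + RInt (fun x => kz x z) z 0 * 1)).
        + apply (is_derive_opp (V := R_NormedModule)).
          apply is_derive_Reals.
          apply (derivable_pt_lim_comp_2d (fun y l => RInt (fun s => k s l) y 0)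
                   (fun t => t) (fun t => t));
            [|apply derivable_pt_lim_id | apply derivable_pt_lim_id].
          apply hdiff; [| | |exact hrange].
          * intros x y h; unfold k, kz.
            assert (hp := sqrt_lt_R0 _ h).
            assert (hge := Delta_theta_ge x).
            evar_last.
            -- apply (is_derive_ext (fun y => / Delta_theta K x * (a *
                 sqrt (sin y ^ 2 * Delta_theta K x - sin x ^ 2)))).
               { intros t; unfold Phat; fold a; apply Rmult_comm. }
               apply is_derive_scal, is_derive_scal.
               apply (is_derive_sqrt_quotient
                 (fun y => sin y ^ 2 * Delta_theta K x - sin x ^ 2) y
                 (2 * sin y * cos y * Delta_theta K x)
                 (sin y * cos y * Delta_theta K x)).
               ++ auto_derive; [easy | ring].
               ++ exact h.
               ++ field.
            -- unfold Phat; fold a; eqR; field; repeat split; unfold a; lra.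
          * intros; apply Phat_quotient_continuity.
          * intros x y h; unfold kz.
            apply continuity_2d_pt_mult; [cont2|].
            apply continuity_2d_pt_inv; [apply Phat_continuity|].
            apply Rgt_not_eq, Phat_pos, h.
        + unfold opp; simpl; ring. }
    assert (hff : is_derive (fun psi => f (sin psi ^ 2)) z
       (2 * sin z * cos z * - RInt (fun x => / Phat K x (sin z ^ 2)) 0 z)).
    { evar_last.
      - apply (is_derive_comp f (fun z => sin z ^ 2)); [apply hfd, hz2 | apply hsq].
      - rewrite sqrt_pow2, asin_sin by lra; reflexivity. }
    assert (hEE : is_derive (fun psi => E1 a L (sin psi ^ 2)) z
       (2 * sin z * cos z * Yf a L 1 (sin z ^ 2))).
    { apply (is_derive_comp (E1 a L) (fun z => sin z ^ 2)); [apply hE1 | apply hsq]. }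
    assert (hkz : RInt (fun x => kz x z) z 0 =
       - (a ^ 2 * sin z * cos z * RInt (fun x => / Phat K x (sin z ^ 2)) 0 z)).
    { assert (hex : ex_RInt (fun x => / Phat K x (sin z ^ 2)) 0 z).
      { apply (@ex_RInt_continuous R_CompleteNormedModule).
        rewrite Rmin_left, Rmax_right by lra; intros x hx.
        apply (continuity_2d_pt_fix_snd (fun x z => / Phat K x (sin z ^ 2)) x z).
        apply continuity_2d_pt_inv; [apply Phat_continuity|].
        apply Rgt_not_eq, Phat_pos, OmP_between with z; [lra | lra | now apply OmP_diag]. }
      rewrite <- (opp_RInt_swap (V := R_CompleteNormedModule)).
      - change (- RInt (fun x => kz x z) 0 z =
          - (a ^ 2 * sin z * cos z * RInt (fun x => / Phat K x (sin z ^ 2)) 0 z)).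
        f_equal; apply (RInt_scal (V := R_CompleteNormedModule)), hex.
      - apply (ex_RInt_scal (V := R_NormedModule)), hex. }
    (* The boundary term is the substitution formula at [s = 1]. *)
    assert (hdiag : k z z = 2 * sin z * cos z * Yf a L 1 (sin z ^ 2)).
    { assert (e := Phat_subst 1 z hz ltac:(lra) ltac:(simpl; lra)).
      assert (e' := Delta_theta_subst 1 z hz).
      rewrite Rmult_1_l, atan_tan in e, e' by lra.
      destruct (mm_sqr_trig 1 z hz) as (_ & _ & h5).
      assert (h6 := Delta_theta_ge z); rewrite e' in h6.
      assert (h7 : 0 < mm 1 (sin z ^ 2) ^ 2) by now apply pow_lt.
      assert (h8 : dd L 1 (sin z ^ 2) <> 0).
      { intros h0; rewrite h0 in h6; unfold Rdiv in h6; rewrite Rmult_0_l in h6; lra. }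
      assert (h9 : mm 1 (sin z ^ 2) = 1).
      { unfold mm; transitivity (sqrt 1); [f_equal; ring | apply sqrt_1]. }
      unfold k; rewrite e, e', h9; unfold Yf; rewrite h9; field; exact h8. }
    evar_last.
    - apply (is_derive_minus (V := R_NormedModule)
               (fun psi => J psi + a ^ 2 / 2 * f (sin psi ^ 2))
               (fun psi => E1 a L (sin psi ^ 2))); [|exact hEE].
      apply (is_derive_plus (V := R_NormedModule) J); [exact hJd|].
      apply (is_derive_scal (fun psi => f (sin psi ^ 2))), hff.
    - rewrite hkz, hdiag.
      set (I := RInt (fun x => / Phat K x (sin z ^ 2)) 0 z).
      set (Y := 2 * sin z * cos z * Yf a L 1 (sin z ^ 2)).
      change (Y - - (a ^ 2 * sin z * cos z * I)
              + a ^ 2 / 2 * (2 * sin z * cos z * - I) - Y = 0).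
      field. }
  assert (hz : D psi = 0).
  { destruct (MVT_gen D 0 psi (fun _ => 0)) as [c [_ hc]].
    - rewrite Rmin_left, Rmax_right by lra; intros x hx; apply hder; lra.
    - intros; apply hcont.
    - rewrite hD0 in hc; lra. }
  unfold D, J in hz; lra.
Qed.

(** The integrand of [varrho] and [Bk] agree on the open interval, where [Delta_r < 0]; this
    suffices for the integrals. *)
Lemma varrho_split (r0 : R) f r theta l :
  domH K rm rp r l ->
  varrho K rp r0 f r theta l =
  B0 K rp r0 r l
  + (RInt (fun x => Phat K x l / Delta_theta K x) 0 theta + a ^ 2 / 2 * f l).
Proof.
  intros h; unfold varrho, B0.
  rewrite (RInt_ext (V := R_CompleteNormedModule)
    (fun s => (s ^ 2 + spin K ^ 2 - Qhat K s l) / Delta_r K s)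
    (fun s => Bk K s l) r rp).
  - unfold a; ring.
  - assert (hr := proj1 h).
    rewrite Rmin_left, Rmax_right by lra; intros s hs.
    apply (Bk_eq K hspin).
    + apply (domH_OmH K rn rm rp rc hLam hmass hspin hsub r); [exact h | lra].
    + apply Rlt_not_eq, (Delta_r_neg K rn rm rp rc hLam hspin hsub); lra.
Qed.

End Link.

(** * Existence of s and l, and r_star in terms of them *)

Section Leaf.

Context (K : KNdS) (rn rm rp rc : R).
Context (hLam : 0 < Lam K) (hmass : 0 < mass K) (hspin : 0 < spin K).
Context (hsub : subextremal K rn rm rp rc).

Let a := spin K.
Let L := Lam K / 3 * spin K ^ 2.
Let hL : 0 < L := L_pos K hLam hspin.

Lemma domH_nonneg r l : rm < r < rp -> 0 <= l -> domH K rm rp r l.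
Proof.
  intros hr hl; split; [exact hr|].
  destruct hsub as [(h1 & h2 & h3 & h4) _].
  assert (0 <= l * (2 * mass K * rp)).
  { apply Rmult_le_pos; [exact hl|].
    apply Rmult_le_pos; [|lra]; lra. }
  assert (0 < spin K ^ 2) by now apply pow_lt.
  lra.
Qed.

Lemma domG_unit s l : 0 < s < 1 -> 0 <= l <= 1 -> domG L s l.
Proof.
  intros hs hl; split; [exact hs|]; unfold dd.
  assert (0 <= L * (1 - l)) by (apply Rmult_le_pos; lra).
  assert (0 <= (1 - l) * (1 - s ^ 2)) by (apply Rmult_le_pos; nra).
  nra.
Qed.

Lemma F_eq r theta psi : 0 < theta <= psi -> psi < PI / 2 ->
  F K rp r theta psi =
  H K rp 0 r (sin psi ^ 2) - G a L 0 (tan theta / tan psi) (sin psi ^ 2).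
Proof.
  intros ht hp; unfold F; rewrite (RInt_inv_P K hLam hspin theta psi ht hp).
  rewrite (RInt_ext (V := R_CompleteNormedModule) (fun s => / Q K s psi)
             (fun s => Hk K 0 s (sin psi ^ 2))).
  - unfold H; fold L a; lra.
  - intros s _; unfold Hk, Qhat, Q.
    simpl (2 * 0 + 1)%nat; rewrite pow_1, pow_O, Rdiv_1_l; reflexivity.
Qed.

Lemma H_pos r l : domH K rm rp r l -> 0 < H K rp 0 r l.
Proof.
  intros h; assert (hO := domH_OmH K rn rm rp rc hLam hmass hspin hsub r l).
  apply RInt_gt_0; [apply h | |].
  - intros s hs; unfold Hk; rewrite pow_O.
    apply Rdiv_lt_0_compat; [lra|]; apply pow_lt, Qhat_pos, hO; [exact h | lra].
  - intros s hs; apply (continuity_2d_pt_fix_snd (Hk K 0)), Hk_continuity, hO;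
      [exact h | lra].
Qed.

(* [s = tan theta / tan theta_star], [l = sin^2 theta_star] and
   [x = sin^2 theta]; at the poles and the equator, where the quotient [s] is
   undefined, it is determined by [G = H]. *)
Definition leaf (r s l x : R) : Prop :=
  0 < s < 1 /\ G a L 0 s l = H K rp 0 r l /\ x * (1 - l + l * s ^ 2) = s ^ 2 * l.

(** Away from the poles and the equator, uniqueness of [theta_star] identifies any solution [(s, l)]
    with the true one. The integral of [Phat / Delta_theta] over [0, theta] is then the integral up
    to [theta_star], known from [E_endpoint], minus the integral of [ES]. At a pole or the equator
    [theta = theta_star] and [ES] vanishes. *)
Lemma leaf_varrho (ts : R -> R -> R) (f : R -> R) r0 r theta s l :
  is_theta_star K rm rp ts -> is_f K f ->
  rm < r < rp -> 0 <= theta <= PI / 2 -> 0 <= l <= 1 ->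
  leaf r s l (sin theta ^ 2) ->
  varrho K rp r0 f r theta (sin (ts r theta) ^ 2) =
  B0 K rp r0 r l + EE a L s l.
Proof.
  intros hts hf hr hth hl (hs & hGH & hx).
  assert (hPI := PI_RGT_0).
  destruct (hts r ltac:(lra)) as (ht1 & ht2 & ht3 & _).
  assert (hE0 : forall l, l * (1 - l) = 0 -> RInt (fun u => ES a L u l) s 1 = 0).
  { intros l' hl'.
    rewrite (RInt_ext (V := R_CompleteNormedModule) _ (fun _ => 0)).
    - rewrite (RInt_const (V := R_CompleteNormedModule)); apply Rmult_0_r.
    - intros u _; unfold ES, Rdiv; rewrite hl'; eqR; ring. }
  unfold EE.
  destruct (Req_dec theta 0) as [h0|h0]; [|destruct (Req_dec theta (PI / 2)) as [h1|h1]].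
  - rewrite h0, ht2, sin_0; rewrite h0, sin_0 in hx.
    assert (hl0 : l = 0).
    { assert (0 < s ^ 2) by (apply pow_lt; lra).
      apply Rmult_eq_reg_l with (s ^ 2); lra. }
    rewrite hl0, hE0 by ring.
    replace (0 ^ 2) with 0 by ring.
    rewrite (varrho_split K rn rm rp rc hLam hmass hspin hsub)
      by (apply domH_nonneg; lra).
    assert (h := E_endpoint K hLam hspin f 0 hf ltac:(lra)).
    rewrite sin_0 in h; replace (0 ^ 2) with 0 in h by ring; fold L a in h |- *.
    rewrite h; ring.
  - rewrite h1, ht3, sin_PI2; rewrite h1, sin_PI2 in hx.
    assert (hl1 : l = 1) by lra.
    rewrite hl1, hE0 by ring.
    replace (1 ^ 2) with 1 by ring.
    rewrite (varrho_split K rn rm rp rc hLam hmass hspin hsub)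
      by (apply domH_nonneg; lra).
    assert (h := E_endpoint K hLam hspin f (PI / 2) hf ltac:(lra)).
    rewrite sin_PI2 in h; replace (1 ^ 2) with 1 in h by ring; fold L a in h |- *.
    rewrite h; ring.
  - assert (hth' : 0 < theta < PI / 2) by lra.
    destruct (sin_cos_pos theta hth') as [k1 k2].
    assert (hT : 0 < tan theta) by (apply tan_gt_0; lra).
    (* The candidate for [theta_star], forced by [s = tan theta / tan psi]. *)
    set (psi := atan (tan theta / s)).
    assert (hTs : tan theta < tan theta / s).
    { apply Rmult_lt_reg_r with s; [lra|].
      unfold Rdiv; rewrite Rmult_assoc, Rinv_l, Rmult_1_r by lra.
      rewrite <- (Rmult_1_r (tan theta)) at 2; apply Rmult_lt_compat_l; lra. }
    assert (hpsi : theta < psi < PI / 2).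
    { split; [|apply atan_bound].
      rewrite <- (atan_tan theta) by lra; now apply atan_increasing. }
    assert (htp : tan psi = tan theta / s) by apply tan_atan.
    assert (hq : tan theta / tan psi = s) by (rewrite htp; field; lra).
    (* For given [s] and [x < 1] the third condition of [leaf] is linear in [l] with a unique
       solution, which [sin psi ^ 2] satisfies. *)
    assert (hlp : sin psi ^ 2 = l).
    { destruct (sin_cos_pos psi ltac:(lra)) as [k3 k4].
      assert (hss : sin psi * cos theta * s = sin theta * cos psi).
      { unfold tan in htp.
        apply Rmult_eq_reg_r with (/ (cos psi * cos theta * s)).
        - transitivity (sin psi / cos psi); [field; lra|].
          rewrite htp; field; lra.
        - apply Rinv_neq_0_compat.
          repeat apply Rmult_integral_contrapositive_currified; lra. }
      assert (hs2 : sin psi ^ 2 * (1 - sin theta ^ 2) * s ^ 2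
                    = sin theta ^ 2 * (1 - sin psi ^ 2)).
      { rewrite <- !cos_sqr.
        transitivity ((sin psi * cos theta * s) ^ 2); [ring|].
        rewrite hss; ring. }
      assert (k5 : 0 < sin theta ^ 2) by now apply pow_lt.
      assert (k6 : 0 < cos theta ^ 2) by now apply pow_lt.
      assert (k7 : 0 < s ^ 2) by (apply pow_lt; lra).
      rewrite cos_sqr in k6.
      apply Rmult_eq_reg_r with ((1 - sin theta ^ 2) * s ^ 2 + sin theta ^ 2).
      - transitivity (sin theta ^ 2); lra.
      - apply Rgt_not_eq, Rplus_lt_0_compat; [now apply Rmult_lt_0_compat | exact k5]. }
    assert (hpe : ts r theta = psi).
    { destruct (ht1 theta hth') as [_ hu]; apply hu.
      split; [lra|].
      rewrite F_eq by lra; rewrite hq, hlp, hGH; ring. }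
    rewrite hpe, hlp.
    rewrite (varrho_split K rn rm rp rc hLam hmass hspin hsub)
      by (apply domH_nonneg; lra).
    assert (h := E_endpoint K hLam hspin f psi hf ltac:(lra)).
    assert (h' := RInt_Phat K hLam hspin theta psi ltac:(lra) ltac:(lra)).
    rewrite hlp in h, h'; rewrite hq in h'; fold L a in h, h' |- *.
    assert (hex : forall u v, ex_RInt (fun x => Phat K x l / Delta_theta K x) u v).
    { intros u v; apply (@ex_RInt_continuous R_CompleteNormedModule).
      intros x _; rewrite <- hlp.
      exact (continuity_2d_pt_fix_snd _ x psi
               (Phat_quotient_continuity K hLam hspin x psi)). }
    assert (hch := RInt_Chasles (V := R_CompleteNormedModule) _ _ _ _
                     (hex 0 theta) (hex theta psi)).
    unfold plus in hch; simpl in hch.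
    lra.
Qed.

Lemma Gk_le_one s : 0 < s < 1 -> Gk a L 0 s 0 <= Gk a L 0 s 1.
Proof.
  intros hs; unfold Gk, mm; simpl (2 * 0 + 1)%nat; rewrite !pow_1, !pow_O.
  replace (1 - 0 + 0 * s ^ 2) with 1 by ring.
  replace (1 - 1 + 1 * s ^ 2) with (s ^ 2) by ring.
  rewrite sqrt_1, sqrt_pow2 by lra.
  assert (0 < nn L s) by (apply sqrt_lt_R0; nra).
  assert (0 < a * nn L s) by now apply Rmult_lt_0_compat.
  apply Rmult_le_compat_l; [lra|].
  apply Rinv_le_contravar; [apply Rmult_lt_0_compat; lra|].
  apply Rmult_le_compat_l; lra.
Qed.

(** At [l = 0] both integrals are elementary: [a H = atan (rp / a) - atan (r / a)] and [a G = atan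
    (1 / sqrt L) - atan (s / nn s)]. Positivity of [s] follows from [rp sqrt L < a], which is the
    inequality [Lam rp^2 < 3]. *)
Lemma leaf_exists_north r : rm < r < rp ->
  exists s, 0 < s < 1 /\ G a L 0 s 0 = H K rp 0 r 0.
Proof.
  intros hr; assert (hH := H_pos r 0 (domH_nonneg r 0 hr (Rle_refl 0))).
  assert (ha : 0 < a) by exact hspin.
  destruct hsub as [(h1 & h2 & h3 & h4) _].
  assert (hrp := proj2 (Delta_r_factor K rn rm rp rc hLam hspin hsub)).
  assert (hHe : H K rp 0 r 0 = (atan (rp / a) - atan (r / a)) / a).
  { apply (is_RInt_unique (V := R_CompleteNormedModule)).
    replace ((atan (rp / a) - atan (r / a)) / a)
      with (minus (atan (rp / a) / a) (atan (r / a) / a))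
      by (unfold minus, plus, opp; simpl; field; lra).
    apply (is_RInt_derive (V := R_CompleteNormedModule) (fun s => atan (s / a) / a)).
    - intros s _; auto_derive; [easy|].
      unfold Hk, Qhat; simpl (2 * 0 + 1)%nat; fold a; rewrite pow_1, pow_O.
      replace ((s ^ 2 + a ^ 2) ^ 2 - a ^ 2 * 0 * Delta_r K s)
        with ((s ^ 2 + a ^ 2) ^ 2) by ring.
      rewrite sqrt_pow2 by nra.
      unfold Rsqr; field; repeat split; nra.
    - rewrite Rmin_left, Rmax_right by lra; intros s hs.
      apply (continuity_2d_pt_fix_snd (Hk K 0)), Hk_continuity.
      apply (domH_OmH K rn rm rp rc hLam hmass hspin hsub r); [|lra].
      now apply domH_nonneg; [|lra]. }
  assert (hsL : 0 < sqrt L) by now apply sqrt_lt_R0.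
  (* The value that [atan (s / nn s)] has to take. *)
  set (be := atan (/ sqrt L) - a * H K rp 0 r 0).
  assert (hb1 : 0 < be).
  { assert (k1 : atan (rp / a) < atan (/ sqrt L)).
    { apply atan_increasing.
      apply Rmult_lt_reg_r with (a * sqrt L); [now apply Rmult_lt_0_compat|].
      replace (rp / a * (a * sqrt L)) with (rp * sqrt L) by (field; lra).
      replace (/ sqrt L * (a * sqrt L)) with a by (field; lra).
      apply Rsqr_incrst_0; [|apply Rmult_le_pos; lra|lra].
      rewrite Rsqr_mult, Rsqr_sqrt by lra.
      unfold L, Rsqr; fold a.
      assert (0 < a ^ 2) by now apply pow_lt.
      nra. }
    assert (k2 : 0 < atan (r / a)).
    { rewrite <- atan_0; apply atan_increasing, Rdiv_lt_0_compat; lra. }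
    unfold be; rewrite hHe.
    replace (a * ((atan (rp / a) - atan (r / a)) / a))
      with (atan (rp / a) - atan (r / a)) by (field; lra).
    lra. }
  assert (hb2 : be < atan (/ sqrt L)).
  { unfold be; assert (0 < a * H K rp 0 r 0) by now apply Rmult_lt_0_compat.
    lra. }
  assert (hb3 := atan_bound (/ sqrt L)).
  set (w := sqrt (1 + L)).
  assert (hw : 0 < w) by (apply sqrt_lt_R0; lra).
  assert (hw2 : w ^ 2 = 1 + L) by (apply pow2_sqrt; lra).
  destruct (sin_cos_pos be ltac:(lra)) as [hsb hcb].
  (* Since [s^2 + nn^2 = w^2], the equation [s / nn = tan be] is solved by [s = w sin be],
     [nn = w cos be]. *)
  set (s := w * sin be).
  assert (hn : nn L s = w * cos be).
  { unfold nn, s; rewrite <- (sqrt_pow2 (w * cos be)).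
    - f_equal; rewrite !Rpow_mult_distr, cos_sqr, hw2; ring.
    - left; now apply Rmult_lt_0_compat. }
  assert (hs0 : 0 < s) by now apply Rmult_lt_0_compat.
  assert (hs1 : s < 1).
  { assert (k : tan be < / sqrt L).
    { rewrite <- (tan_atan (/ sqrt L)); apply tan_increasing; lra. }
    assert (k' : sin be * sqrt L < cos be).
    { unfold tan in k.
      apply Rmult_lt_reg_r with (/ cos be * / sqrt L).
      - apply Rmult_lt_0_compat; now apply Rinv_0_lt_compat.
      - replace (sin be * sqrt L * (/ cos be * / sqrt L)) with (sin be / cos be)
          by (field; lra).
        replace (cos be * (/ cos be * / sqrt L)) with (/ sqrt L) by (field; lra).
        exact k. }
    assert (k2 : (sin be * sqrt L) ^ 2 < cos be ^ 2).
    { assert (0 < sin be * sqrt L) by now apply Rmult_lt_0_compat. nra. }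
    rewrite Rpow_mult_distr, pow2_sqrt, cos_sqr in k2 by lra.
    assert (s ^ 2 < 1) by (unfold s; rewrite Rpow_mult_distr, hw2; lra).
    nra. }
  exists s; split; [lra|].
  assert (hG : G a L 0 s 0 = (atan (1 / nn L 1) - atan (s / nn L s)) / a).
  { assert (hO : forall u, s <= u <= 1 -> OmG L u 0).
    { intros u hu; apply (domG_OmG L hL s); [lra | | exact hu].
      unfold dd; lra. }
    apply (is_RInt_unique (V := R_CompleteNormedModule)).
    replace ((atan (1 / nn L 1) - atan (s / nn L s)) / a)
      with (minus (atan (1 / nn L 1) / a) (atan (s / nn L s) / a))
      by (unfold minus, plus, opp; simpl; field; lra).
    apply (is_RInt_derive (V := R_CompleteNormedModule) (fun s => atan (s / nn L s) / a)).
    - rewrite Rmin_left, Rmax_right by lra; intros u hu.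
      destruct (OmG_pos L u 0 (hO u hu)) as (k1 & _ & k3 & _).
      assert (hnd := nn_derive L u (proj1 (hO u hu))).
      apply (is_derive_ext (fun s => / a * atan (s / nn L s)));
        [intros; apply Rmult_comm|].
      evar_last.
      + apply is_derive_scal.
        apply (is_derive_comp atan (fun s => s / nn L s)).
        * apply is_derive_Reals, derivable_pt_lim_atan.
        * apply (is_derive_div (fun s => s) (nn L) u 1 (- u / nn L u));
            [apply @is_derive_id | exact hnd | lra].
      + unfold Gk, mm; simpl (2 * 0 + 1)%nat; rewrite pow_1, pow_O.
        replace (1 - 0 + 0 * u ^ 2) with 1 by ring; rewrite sqrt_1.
        unfold scal; simpl; unfold mult; simpl; unfold Rsqr.
        eqR; field; repeat split; try lra; nra.
    - rewrite Rmin_left, Rmax_right by lra; intros u hu.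
      now apply (continuity_2d_pt_fix_snd (Gk a L 0)), Gk_continuity, hO. }
  rewrite hG, hn; unfold s.
  replace (w * sin be / (w * cos be)) with (tan be) by (unfold tan; field; lra).
  rewrite atan_tan by lra.
  replace (nn L 1) with (sqrt L) by (unfold nn; f_equal; ring).
  rewrite Rdiv_1_l; unfold be; field; lra.
Qed.

(** Comparison with the pole: passing from [l = 0] to [l = 1] increases [G] and decreases [H]. At
    the polar solution [s0] therefore [G >= H], whereas [G = 0 < H] at [s = 1], and the intermediate
    value theorem applies. *)
Lemma leaf_exists_equator r : rm < r < rp ->
  exists s, 0 < s < 1 /\ G a L 0 s 1 = H K rp 0 r 1.
Proof.
  intros hr; destruct (leaf_exists_north r hr) as [s0 [hs0 h0]].
  assert (ha : 0 < a) by exact hspin.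
  assert (hH1 := H_pos r 1 (domH_nonneg r 1 hr Rle_0_1)).
  (* The range exceeds [u = 1] because continuity of [G] in [s] is needed on both sides of
     [s = 1]. *)
  assert (hO : forall l u, 0 <= l <= 1 -> 0 < u < sqrt (1 + L) -> OmG L u l).
  { intros l u hl hu.
    assert (hu2 : u ^ 2 < 1 + L).
    { rewrite <- (pow2_sqrt (1 + L)) by lra.
      nra. }
    assert (0 < u ^ 2) by (apply pow_lt; lra).
    assert (0 <= L * (1 - l)) by (apply Rmult_le_pos; lra).
    assert (0 < 1 - l + l * u ^ 2).
    { assert (0 <= l * u ^ 2) by (apply Rmult_le_pos; lra).
      destruct (Req_dec l 1) as [->|]; lra. }
    unfold OmG, dd; repeat split; lra. }
  assert (hw : 1 < sqrt (1 + L)).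
  { rewrite <- sqrt_1 at 1; apply sqrt_lt_1; lra. }
  assert (hGle : G a L 0 s0 0 <= G a L 0 s0 1).
  { apply RInt_le; [lra | | |].
    1, 2: apply (@ex_RInt_continuous R_CompleteNormedModule);
      rewrite Rmin_left, Rmax_right by lra; intros u hu;
      apply (continuity_2d_pt_fix_snd (Gk a L 0)), (Gk_continuity a L ha), hO; lra.
    intros u hu; apply Gk_le_one; lra. }
  assert (hHle : H K rp 0 r 1 <= H K rp 0 r 0).
  { assert (hOH : forall l s, 0 <= l -> r <= s <= rp -> OmH K s l).
    { intros l s hl hs; apply (domH_OmH K rn rm rp rc hLam hmass hspin hsub r);
        [now apply domH_nonneg | exact hs]. }
    apply RInt_le; [lra | | |].
    1, 2: apply (@ex_RInt_continuous R_CompleteNormedModule);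
      rewrite Rmin_left, Rmax_right by lra; intros u hu;
      apply (continuity_2d_pt_fix_snd (Hk K 0)), Hk_continuity, hOH; lra.
    intros u hu; unfold Hk; simpl (2 * 0 + 1)%nat; rewrite !pow_1, !pow_O.
    apply Rmult_le_compat_l; [lra|].
    apply Rinv_le_contravar; [apply Qhat_pos, hOH; lra|].
    apply sqrt_le_1_alt.
    assert (hD := Delta_r_neg K rn rm rp rc hLam hspin hsub u ltac:(lra)).
    assert (0 < a ^ 2) by now apply pow_lt.
    fold a; nra. }
  destruct (Rle_lt_or_eq_dec (H K rp 0 r 1) (G a L 0 s0 1)) as [hlt|heq]; [lra | |].
  2: now exists s0.
  destruct (Ranalysis5.IVT_interv (fun s => H K rp 0 r 1 - G a L 0 s 1) s0 1)
    as [s [hs hse]].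
  - intros y hy; apply continuity_pt_minus;
      [apply continuity_pt_const; now intros ? ?|].
    apply continuity_pt_filterlim.
    apply (ex_derive_continuous (fun y => G a L 0 y 1)).
    exists (opp (Gk a L 0 y 1)).
    apply (is_derive_RInt' (V := R_NormedModule) (fun u => Gk a L 0 u 1)
             (fun y => G a L 0 y 1) y 1).
    + apply (locally_interval _ y 0 (sqrt (1 + L))); simpl; try lra.
      intros z hz1 hz2; apply (@RInt_correct R_CompleteNormedModule).
      apply (@ex_RInt_continuous R_CompleteNormedModule); intros u hu.
      apply (continuity_2d_pt_fix_snd (Gk a L 0)), (Gk_continuity a L ha), hO; [lra|].
      revert hu; apply Rmin_case; apply Rmax_case; simpl in *; lra.
    + apply (continuity_2d_pt_fix_snd (Gk a L 0)), (Gk_continuity a L ha), hO; lra.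
  - lra.
  - lra.
  - unfold G; rewrite RInt_point; unfold zero; simpl; lra.
  - exists s; split; [|lra].
    assert (s <> 1); [|lra].
    intros ->; unfold G in hse; rewrite RInt_point in hse; unfold zero in hse;
      simpl in hse; lra.
Qed.

Lemma leaf_exists (ts : R -> R -> R) r theta :
  is_theta_star K rm rp ts -> rm < r < rp -> 0 <= theta <= PI / 2 ->
  exists s l, 0 <= l <= 1 /\ leaf r s l (sin theta ^ 2).
Proof.
  intros hts hr hth; assert (hPI := PI_RGT_0).
  destruct (Req_dec theta 0) as [h0|h0]; [|destruct (Req_dec theta (PI / 2)) as [h1|h1]].
  - destruct (leaf_exists_north r hr) as [s [hs he]].
    exists s, 0; split; [lra|]; repeat split; try lra.
    rewrite h0, sin_0; ring.
  - destruct (leaf_exists_equator r hr) as [s [hs he]].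
    exists s, 1; split; [lra|]; repeat split; try lra.
    rewrite h1, sin_PI2; ring.
  - destruct (hts r ltac:(lra)) as (ht1 & _).
    destruct (ht1 theta ltac:(lra)) as [[hp hF] _].
    set (psi := ts r theta) in *.
    assert (hq := tan_quotient theta psi ltac:(lra) ltac:(lra)).
    assert (hFe := F_eq r theta psi ltac:(lra) ltac:(lra)).
    assert (hpsi : 0 < psi < PI / 2) by lra.
    destruct (sin_cos_pos psi hpsi) as [k1 k2].
    destruct (sin_cos_pos theta ltac:(lra)) as [k3 k4].
    assert (hl : 0 <= sin psi ^ 2 <= 1).
    { generalize (pow2_ge_0 (sin psi)) (pow2_ge_0 (cos psi)) (cos_sqr psi); lra. }
    exists (tan theta / tan psi), (sin psi ^ 2); split; [exact hl|].
    repeat split.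
    + apply hq.
    (* At [s = 1] the integral [G] is over a single point and vanishes, while [H > 0]. *)
    + assert (tan theta / tan psi <> 1); [|lra].
      intros he; rewrite he in hFe.
      assert (hH := H_pos r _ (domH_nonneg r _ hr (proj1 hl))).
      unfold G in hFe; rewrite RInt_point in hFe; unfold zero in hFe; simpl in hFe.
      simpl in hH; lra.
    + lra.
    + assert (ht : tan psi <> 0) by (apply Rgt_not_eq, tan_gt_0; lra).
      rewrite <- cos_sqr.
      transitivity (sin psi ^ 2 * ((sin theta / cos theta) / (sin psi / cos psi)) ^ 2);
        [|unfold tan; ring].
      transitivity (sin theta ^ 2 * cos psi ^ 2 / cos theta ^ 2); [|field; lra].
      unfold tan.
      transitivity (sin theta ^ 2 * cos psi ^ 2 *
        ((cos theta ^ 2 + sin theta ^ 2) / cos theta ^ 2)); [field; lra|].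
      rewrite (cos_sqr theta) at 1; field; lra.
Qed.

End Leaf.

(** * Rules for total derivatives in two variables *)

Lemma differentiable_pt_lim_partials (f fx : R -> R -> R) (x y fy : R) :
  locally_2d (fun u v => is_derive (fun z => f z v) u (fx u v)) x y ->
  is_derive (fun z => f x z) y fy -> continuity_2d_pt fx x y ->
  differentiable_pt_lim f x y (fx x y) fy.
Proof.
  intros h1 h2 h3; apply filterdiff_differentiable_pt_lim.
  apply (is_derive_filterdiff f x y fx fy).
  - now apply (proj1 (locally_2d_locally
      (fun u v => is_derive (fun z => f z v) u (fx u v)) x y)).
  - exact h2.
  - now apply (proj1 (continuity_2d_pt_filterlim fx x y)).
Qed.

Lemma differentiable_pt_lim_fst (x y : R) :
  differentiable_pt_lim (fun u _ => u) x y 1 0.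
Proof. apply differentiable_pt_lim_proj1_0, derivable_pt_lim_id. Qed.

Lemma differentiable_pt_lim_snd (x y : R) :
  differentiable_pt_lim (fun _ v => v) x y 0 1.
Proof.
  intros eps; apply locally_2d_forall; intros u v.
  replace (v - y - (0 * (u - x) + 1 * (v - y))) with 0 by ring.
  rewrite Rabs_R0; apply Rmult_le_pos; [left; apply cond_pos|].
  apply Rle_trans with (1 := Rabs_pos (u - x)), Rmax_l.
Qed.

Lemma differentiable_pt_lim_opp (f : R -> R -> R) (x y lx ly : R) :
  differentiable_pt_lim f x y lx ly ->
  differentiable_pt_lim (fun u v => - f u v) x y (- lx) (- ly).
Proof.
  intros h eps; generalize (h eps); apply locally_2d_impl, locally_2d_forall.
  intros u v; apply Rle_trans; right; rewrite <- Rabs_Ropp; f_equal; ring.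
Qed.

Lemma differentiable_pt_lim_plus (f g : R -> R -> R) (x y lx ly mx my : R) :
  differentiable_pt_lim f x y lx ly -> differentiable_pt_lim g x y mx my ->
  differentiable_pt_lim (fun u v => f u v + g u v) x y (lx + mx) (ly + my).
Proof.
  intros hf hg; apply (proj1 (filterdiff_differentiable_pt_lim _ _ _ _ _)).
  eapply filterdiff_ext_lin.
  - apply (filterdiff_plus_fct (V := R_NormedModule)).
    + apply (proj2 (filterdiff_differentiable_pt_lim _ _ _ _ _) hf).
    + apply (proj2 (filterdiff_differentiable_pt_lim _ _ _ _ _) hg).
  - intros [u v]; simpl; unfold plus; simpl; ring.
Qed.

Lemma differentiable_pt_lim_eq (f : R -> R -> R) (x y lx ly mx my : R) :
  differentiable_pt_lim f x y lx ly -> lx = mx -> ly = my ->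
  differentiable_pt_lim f x y mx my.
Proof. now intros h -> ->. Qed.

(** ** The variables s and l as functions of r and x *)

Definition Xf (s l : R) : R := s ^ 2 * l / (1 - l + l * s ^ 2).
Definition Xs (s l : R) : R := 2 * s * l * (1 - l) / (1 - l + l * s ^ 2) ^ 2.
Definition Xl (s l : R) : R := s ^ 2 / (1 - l + l * s ^ 2) ^ 2.

Lemma Xf_differentiable s l : 0 < 1 - l + l * s ^ 2 ->
  differentiable_pt_lim Xf s l (Xs s l) (Xl s l).
Proof.
  intros h; apply differentiable_pt_lim_partials.
  - assert (hl : locally_2d (fun s l => 0 < 1 - l + l * s ^ 2) s l).
    { apply (locally_2d_pos (fun s l => 1 - l + l * s ^ 2)); [cont2 | exact h]. }
    generalize hl; apply locally_2d_impl, locally_2d_forall; intros u v huv.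
    unfold Xf, Xs; auto_derive; [simpl in huv; lra|].
    field; lra.
  - unfold Xf, Xl; auto_derive; [simpl in h; lra|].
    field; lra.
  - unfold Xs; cont2; apply pow_nonzero; lra.
Qed.

Section Coordinates.

Context (K : KNdS) (rn rm rp rc : R).
Context (hLam : 0 < Lam K) (hmass : 0 < mass K) (hspin : 0 < spin K).
Context (hsub : subextremal K rn rm rp rc).

Let a := spin K.
Let L := Lam K / 3 * spin K ^ 2.
Let hL : 0 < L := L_pos K hLam hspin.
Let ha : 0 < a := hspin.

Lemma domG_pos s l : domG L s l ->
  0 < s < 1 /\ 0 < nn L s /\ 0 < mm s l /\ 0 < dd L s l /\
  mm s l ^ 2 = 1 - l + l * s ^ 2 /\ 0 < 1 - l + l * s ^ 2 /\ 0 < Gk a L 0 s l.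
Proof.
  intros h.
  assert (hO : OmG L s l) by (apply (domG_OmG L hL s); destruct h; lra).
  destruct (OmG_pos L s l hO) as (h1 & h2 & h3 & h4 & h5).
  repeat split; try apply h; auto.
  - apply hO.
  - unfold Gk; rewrite pow_O; apply Rdiv_lt_0_compat; [lra|].
    apply Rmult_lt_0_compat; [now apply Rmult_lt_0_compat | now apply pow_lt].
Qed.

(** [sig_r] and [sig_l] are the partial derivatives of the solution [s(r, l)] of
    [G(s, l) = H(r, l)], by implicit differentiation. *)
Definition sig_r (r s l : R) : R := Hk K 0 r l / Gk a L 0 s l.
Definition sig_l (r s l : R) : R :=
  (G a L 1 s l - H K rp 1 r l) / (2 * Gk a L 0 s l).

Lemma sigma_exists r1 s1 l1 :
  domH K rm rp r1 l1 -> domG L s1 l1 -> G a L 0 s1 l1 = H K rp 0 r1 l1 ->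
  exists sig : R -> R -> R, sig r1 l1 = s1 /\
    locally_2d (fun r l =>
      domH K rm rp r l /\ domG L (sig r l) l /\
      G a L 0 (sig r l) l = H K rp 0 r l /\
      differentiable_pt_lim sig r l (sig_r r (sig r l) l) (sig_l r (sig r l) l)) r1 l1.
Proof.
  intros hH hG heq.
  (* [G] decreases in [s]; the sign meets the positivity demanded by [param_inverse], and the value
     to be inverted becomes [- H]. *)
  destruct (param_inverse (fun l s => - G a L 0 s l)
              (fun l s => - (1 / 2 * G a L 1 s l)) (fun l s => Gk a L 0 s l) l1 s1)
    as (eta & h1 & h2).
  { apply (locally_2d_swap (fun s l => differentiable_pt_lim
      (fun l s => - G a L 0 s l) l s (- (1 / 2 * G a L 1 s l)) (Gk a L 0 s l)
      /\ 0 < Gk a L 0 s l)).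
    generalize (domG_open L s1 l1 hG); apply locally_2d_impl, locally_2d_forall.
    intros s l h; split; [|apply (domG_pos s l h)].
    eapply differentiable_pt_lim_eq.
    - apply (differentiable_pt_lim_comp (fun s l => - G a L 0 s l)
               (fun _ s => s) (fun l _ => l)).
      + apply differentiable_pt_lim_opp, (G_differentiable a L ha hL 0 s l h).
      + apply differentiable_pt_lim_snd.
      + apply differentiable_pt_lim_fst.
    - simpl INR; field.
    - simpl INR; field. }
  assert (hb := locally_2d_singleton _ _ _ h2); cbv beta in hb.
  exists (fun r l => eta l (- H K rp 0 r l)).
  split; [now rewrite <- heq|].
  assert (hHd := H_differentiable K rn rm rp rc hLam hmass hspin hsub 0).
  assert (hHc : continuity_2d_pt (fun r l => - H K rp 0 r l) r1 l1).
  { apply continuity_2d_pt_opp.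
    exact (differentiable_pt_lim_continuity _ _ _ _ _ (hHd r1 l1 hH)). }
  rewrite heq in h1.
  assert (hec : continuity_2d_pt (fun r l => eta l (- H K rp 0 r l)) r1 l1).
  { apply (continuity_2d_pt_comp eta (fun _ l => l)); [cont2 | exact hHc|].
    eapply differentiable_pt_lim_continuity, (locally_2d_singleton _ _ _ h1). }
  assert (k1 := domH_open K rm rp r1 l1 hH).
  assert (k2 : locally_2d (fun r l => domG L (eta l (- H K rp 0 r l)) l) r1 l1).
  { apply (locally_2d_comp (domG L) (fun r l => eta l (- H K rp 0 r l)) (fun _ l => l));
      [exact hec | cont2 |].
    apply domG_open; now rewrite <- heq, hb. }
  assert (k3 := locally_2d_comp _ (fun _ l => l) (fun r l => - H K rp 0 r l)
                  r1 l1 (continuity_2d_pt_id2 _ _) hHc h1).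
  generalize (locally_2d_and _ _ _ _ k1 (locally_2d_and _ _ _ _ k2 k3)).
  apply locally_2d_impl, locally_2d_forall.
  intros r l (q1 & q2 & q3 & q4).
  set (s := eta l (- H K rp 0 r l)) in *.
  destruct (domG_pos s l q2) as (_ & _ & _ & _ & _ & _ & hk).
  repeat split; try apply q1; try apply q2; try lra.
  eapply differentiable_pt_lim_eq.
  - apply (differentiable_pt_lim_comp eta (fun _ l => l) (fun r l => - H K rp 0 r l)).
    + exact q4.
    + apply differentiable_pt_lim_snd.
    + apply differentiable_pt_lim_opp, hHd, q1.
  - unfold sig_r; fold s; field; lra.
  - unfold sig_l; fold s; simpl INR; field; lra.
Qed.

Lemma G1_nonneg s l : domG L s l -> 0 <= G a L 1 s l.
Proof.
  intros h.
  assert (hO : forall u, s <= u <= 1 -> OmG L u l).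
  { intros u hu; apply (domG_OmG L hL s); destruct h; lra. }
  destruct h as [hs _].
  apply RInt_ge_0; [lra | |].
  - apply (@ex_RInt_continuous R_CompleteNormedModule).
    rewrite Rmin_left, Rmax_right by lra; intros u hu.
    now apply (continuity_2d_pt_fix_snd (Gk a L 1)), (Gk_continuity a L ha), hO.
  - intros u hu; destruct (OmG_pos L u l (hO u ltac:(lra))) as (h1 & h2 & _).
    unfold Gk; rewrite pow_1.
    apply Rmult_le_pos; [nra|].
    left; apply Rinv_0_lt_compat, Rmult_lt_0_compat;
      [now apply Rmult_lt_0_compat | now apply pow_lt].
Qed.

Lemma H1_nonpos r l : domH K rm rp r l -> H K rp 1 r l <= 0.
Proof.
  intros h; assert (hr := proj1 h).
  assert (hO := domH_OmH K rn rm rp rc hLam hmass hspin hsub r l).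
  assert (hex : ex_RInt (fun s => Hk K 1 s l) r rp).
  { apply (@ex_RInt_continuous R_CompleteNormedModule).
    rewrite Rmin_left, Rmax_right by lra; intros u hu.
    now apply (continuity_2d_pt_fix_snd (Hk K 1)), Hk_continuity, hO. }
  assert (hge : 0 <= RInt (fun s => - Hk K 1 s l) r rp).
  { apply RInt_ge_0; [lra | now apply (ex_RInt_opp (V := R_NormedModule))|].
    intros u hu; assert (hq := Qhat_pos K u l (hO u h ltac:(lra))).
    assert (hD := Delta_r_neg K rn rm rp rc hLam hspin hsub u ltac:(lra)).
    assert (0 < spin K ^ 2) by now apply pow_lt.
    unfold Hk; rewrite pow_1.
    replace (- (spin K ^ 2 * Delta_r K u / Qhat K u l ^ (2 * 1 + 1)))
      with (spin K ^ 2 * - Delta_r K u * / Qhat K u l ^ (2 * 1 + 1))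
      by (unfold Rdiv; ring).
    left; repeat apply Rmult_lt_0_compat; try lra.
    now apply Rinv_0_lt_compat, pow_lt. }
  assert (ho := RInt_opp (V := R_CompleteNormedModule) (fun s => Hk K 1 s l) r rp hex).
  change (RInt (fun s => - Hk K 1 s l) r rp = - H K rp 1 r l) in ho.
  lra.
Qed.

(* The l-derivative of [x] at fixed [r]. *)
Definition Wf (r s l : R) : R := Xs s l * sig_l r s l + Xl s l.

(** All contributions have the right sign: [G 1 >= 0], [H 1 <= 0] because [Delta_r < 0], and
    [Xs >= 0] for [l] in [0, 1]; [Xl] is strictly positive. *)
Lemma Wf_pos r s l :
  domH K rm rp r l -> domG L s l -> 0 <= l <= 1 -> 0 < Wf r s l.
Proof.
  intros hH hG hl.
  destruct (domG_pos s l hG) as (h1 & _ & _ & _ & _ & h2 & h3).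
  assert (h4 := G1_nonneg s l hG); assert (h5 := H1_nonpos r l hH).
  assert (h6 : 0 < (1 - l + l * s ^ 2) ^ 2) by now apply pow_lt.
  unfold Wf; apply Rplus_le_lt_0_compat.
  - apply Rmult_le_pos.
    + unfold Xs; apply Rmult_le_pos; [|left; now apply Rinv_0_lt_compat].
      repeat apply Rmult_le_pos; lra.
    + unfold sig_l; apply Rmult_le_pos; [lra|].
      left; apply Rinv_0_lt_compat; lra.
  - unfold Xl; apply Rdiv_lt_0_compat; [apply pow_lt; lra | exact h6].
Qed.

(** [lam_r] and [lam_x] are the partial derivatives of [l(r, x)], obtained by solving
    [Xf (s(r, l)) l = x] for [l]. *)
Definition lam_r (r s l : R) : R := - (Xs s l * sig_r r s l) / Wf r s l.
Definition lam_x (r s l : R) : R := / Wf r s l.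

(** Positivity of [Wf] is recorded because [Wf_pos] requires [l] in [0, 1], an interval that [l] may
    leave near a pole or the equator. *)
Definition good_leaf (r s l x : R) : Prop :=
  domH K rm rp r l /\ domG L s l /\ leaf K rp r s l x /\ 0 < Wf r s l.

(** Two nested inversions: [G = H] is solved for [s], then [x = Xf s l], with this [s] inserted, is
    solved for [l]. The quantity [x] rather than [l] is kept as coordinate since it is smooth in
    every chart. *)
Lemma leaf_coordinates r1 s1 l1 x1 :
  rm < r1 < rp -> 0 <= l1 <= 1 -> leaf K rp r1 s1 l1 x1 ->
  exists sg lm : R -> R -> R, sg r1 x1 = s1 /\ lm r1 x1 = l1 /\
    locally_2d (fun r x =>
      good_leaf r (sg r x) (lm r x) x /\
      differentiable_pt_lim lm r x
        (lam_r r (sg r x) (lm r x)) (lam_x r (sg r x) (lm r x)) /\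
      differentiable_pt_lim sg r x
        (sig_r r (sg r x) (lm r x)
         + sig_l r (sg r x) (lm r x) * lam_r r (sg r x) (lm r x))
        (sig_l r (sg r x) (lm r x) * lam_x r (sg r x) (lm r x))) r1 x1.
Proof.
  intros hr1 hl1 (hs1 & heq & hx1).
  assert (hH := domH_nonneg K rn rm rp rc hmass hspin hsub r1 l1 hr1 (proj1 hl1)).
  assert (hG : domG L s1 l1) by (apply (domG_unit K hLam hspin); assumption).
  destruct (sigma_exists r1 s1 l1 hH hG heq) as (sig & hsig & hloc).
  assert (hsc : continuity_2d_pt sig r1 l1).
  { eapply differentiable_pt_lim_continuity, (locally_2d_singleton _ _ _ hloc). }
  (* Continuity at the base point, where [l1] lies in [0, 1], spreads the positivity of [Wf] to a
     neighbourhood. *)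
  assert (hWc : continuity_2d_pt (fun r l => Wf r (sig r l) l) r1 l1).
  { assert (hcomp : forall h, continuity_2d_pt h s1 l1 ->
              continuity_2d_pt (fun r l => h (sig r l) l) r1 l1).
    { intros h hh; apply (continuity_2d_pt_comp h sig (fun _ l => l));
        [exact hsc | cont2 | now rewrite hsig]. }
    destruct (domG_pos s1 l1 hG) as (_ & _ & _ & _ & _ & p1 & p2).
    unfold Wf, sig_l.
    apply continuity_2d_pt_plus; [apply continuity_2d_pt_mult|].
    - apply (hcomp Xs); unfold Xs; cont2; apply pow_nonzero; lra.
    - apply continuity_2d_pt_mult; [apply continuity_2d_pt_minus|].
      + apply (hcomp (G a L 1)).
        exact (differentiable_pt_lim_continuity _ _ _ _ _
                 (G_differentiable a L ha hL 1 s1 l1 hG)).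
      + exact (differentiable_pt_lim_continuity _ _ _ _ _
                 (H_differentiable K rn rm rp rc hLam hmass hspin hsub 1 r1 l1 hH)).
      + apply continuity_2d_pt_inv; [|fold a L; rewrite hsig; lra].
        apply continuity_2d_pt_mult; [cont2|].
        apply (hcomp (Gk a L 0)), (Gk_continuity a L ha).
        apply (domG_OmG L hL s1); destruct hG; lra.
    - apply (hcomp Xl); unfold Xl; cont2; apply pow_nonzero; lra. }
  assert (hWp : locally_2d (fun r l => 0 < Wf r (sig r l) l) r1 l1).
  { apply (locally_2d_pos (fun r l => Wf r (sig r l) l) _ _ hWc).
    rewrite hsig; now apply Wf_pos. }
  assert (hX1 : Xf (sig r1 l1) l1 = x1).
  { rewrite hsig.
    destruct (domG_pos s1 l1 hG) as (_ & _ & _ & _ & _ & p1 & _).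
    unfold Xf; rewrite <- hx1; field; lra. }
  assert (hall := locally_2d_and _ _ _ _ hloc hWp).
  destruct (param_inverse (fun r l => Xf (sig r l) l)
              (fun r l => Xs (sig r l) l * sig_r r (sig r l) l)
              (fun r l => Wf r (sig r l) l) r1 l1) as (lm & h1 & h2).
  { generalize hall; apply locally_2d_impl, locally_2d_forall.
    intros r l ((q1 & q2 & q3 & q4) & q5); split; [|exact q5].
    destruct (domG_pos _ _ q2) as (_ & _ & _ & _ & _ & p1 & _).
    eapply differentiable_pt_lim_eq.
    - apply (differentiable_pt_lim_comp Xf sig (fun _ l => l)).
      + now apply Xf_differentiable.
      + exact q4.
      + apply differentiable_pt_lim_snd.
    - ring.
    - unfold Wf; ring. }
  assert (hb := locally_2d_singleton _ _ _ h2); cbv beta in hb.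
  rewrite hX1 in h1, hb.
  assert (hlc : continuity_2d_pt lm r1 x1).
  { eapply differentiable_pt_lim_continuity, (locally_2d_singleton _ _ _ h1). }
  assert (hall' : locally_2d _ r1 (lm r1 x1)) by (rewrite hb; exact hall).
  assert (k := locally_2d_comp _ (fun r _ => r) lm r1 x1
                 (continuity_2d_pt_id1 _ _) hlc hall').
  exists (fun r x => sig r (lm r x)), lm.
  split; [now rewrite hb|]; split; [exact hb|].
  generalize (locally_2d_and _ _ _ _ k h1); apply locally_2d_impl, locally_2d_forall.
  intros r x (((q1 & q2 & q3 & q4) & q5) & (q6 & q7)).
  set (l := lm r x) in *; set (s := sig r l) in *.
  destruct (domG_pos s l q2) as (p1 & _ & _ & _ & _ & p2 & p3).
  split; [|split].
  - split; [exact q1|]; split; [exact q2|]; split; [|exact q5].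
    split; [exact p1|]; split; [exact q3|].
    rewrite <- q6; unfold Xf; field; lra.
  - exact q7.
  - eapply differentiable_pt_lim_eq.
    + apply (differentiable_pt_lim_comp sig (fun r _ => r) lm).
      * exact q4.
      * apply differentiable_pt_lim_fst.
      * exact q7.
    + unfold lam_r; fold l s; ring.
    + unfold lam_x; fold l s; ring.
Qed.

(* The x-derivative of [r_star]. *)
Definition At (s l : R) : R := a * nn L s * mm s l ^ 3 / (2 * s * dd L s l).

(** The gradients of the angular part and of [x] in [(s, l)] are proportional. The factor [At] is
    [P / Delta_theta] divided by [dx / dtheta = 2 sin theta cos theta], in a form that stays regular
    at the poles and the equator. *)
Lemma At_partials s l : domG L s l ->
  ES a L s l = At s l * Xs s l /\ Yf a L s l = At s l * Xl s l.
Proof.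
  intros h; destruct (domG_pos s l h) as (h1 & h2 & h3 & h4 & h5 & h6 & _).
  unfold ES, Yf, At, Xs, Xl; rewrite <- h5; split; field; repeat split; lra.
Qed.

(** On [G = H] the terms [a^2 H / 2] from [B0] and [- a^2 G / 2] from [EE] cancel. The differential
    is then [Q / Delta_r dr + ES ds + Yf dl], and the last two terms make up [At dx], so the
    derivatives of [sg] and [lm] drop out. *)
Lemma leaf_potential r0 (sg lm : R -> R -> R) r x :
  rm < r0 < rp -> good_leaf r (sg r x) (lm r x) x ->
  differentiable_pt_lim lm r x
    (lam_r r (sg r x) (lm r x)) (lam_x r (sg r x) (lm r x)) ->
  differentiable_pt_lim sg r x
    (sig_r r (sg r x) (lm r x)
     + sig_l r (sg r x) (lm r x) * lam_r r (sg r x) (lm r x))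
    (sig_l r (sg r x) (lm r x) * lam_x r (sg r x) (lm r x)) ->
  differentiable_pt_lim
    (fun r x => B0 K rp r0 r (lm r x) + EE a L (sg r x) (lm r x)) r x
    (Qhat K r (lm r x) / Delta_r K r) (At (sg r x) (lm r x)).
Proof.
  intros hr0 (hH & hG & (_ & heq & _) & hW) hl hs.
  change (G a L 0 (sg r x) (lm r x) = H K rp 0 r (lm r x)) in heq.
  assert (hB := B0_differentiable K rn rm rp rc hLam hmass hspin hsub r0 r (lm r x) hr0 hH).
  assert (hE := EE_differentiable a L ha hL _ _ hG).
  destruct (At_partials _ _ hG) as [e1 e2].
  assert (hD := Delta_r_neg K rn rm rp rc hLam hspin hsub r (proj1 hH)).
  eapply differentiable_pt_lim_eq.
  - apply differentiable_pt_lim_plus.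
    + apply (differentiable_pt_lim_comp (B0 K rp r0) (fun r _ => r) lm);
        [exact hB | apply differentiable_pt_lim_fst | exact hl].
    + apply (differentiable_pt_lim_comp (EE a L) sg lm); [exact hE | exact hs | exact hl].
  - cbv beta; rewrite e1, e2, heq; unfold lam_r, lam_x, Wf in *.
    set (s := sg r x) in *; set (l := lm r x) in *; unfold a; field; lra.
  - cbv beta; rewrite e1, e2, heq; unfold lam_r, lam_x, Wf in *.
    set (s := sg r x) in *; set (l := lm r x) in *; unfold a; field; lra.
Qed.

End Coordinates.

(** ** Smoothness of the level curves *)

(** The operations are those needed to write the derivatives of [s], [l] and [rho]; the side
    conditions keep inverses and square roots differentiable on [I]. *)
Inductive algebra (I : R -> Prop) (B : (R -> R) -> Prop) : (R -> R) -> Prop :=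
  | al_base f : B f -> algebra I B f
  | al_const c : algebra I B (fun _ => c)
  | al_opp f : algebra I B f -> algebra I B (fun x => - f x)
  | al_plus f g :
      algebra I B f -> algebra I B g -> algebra I B (fun x => f x + g x)
  | al_mult f g :
      algebra I B f -> algebra I B g -> algebra I B (fun x => f x * g x)
  | al_inv f :
      algebra I B f -> (forall x, I x -> f x <> 0) -> algebra I B (fun x => / f x)
  | al_sqrt f :
      algebra I B f -> (forall x, I x -> 0 < f x) ->
      algebra I B (fun x => sqrt (f x)).

Lemma al_minus I B f g :
  algebra I B f -> algebra I B g -> algebra I B (fun x => f x - g x).
Proof. intros hf hg; exact (al_plus I B f _ hf (al_opp I B g hg)). Qed.

Lemma al_div I B f g :
  algebra I B f -> algebra I B g -> (forall x, I x -> g x <> 0) ->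
  algebra I B (fun x => f x / g x).
Proof. intros hf hg h; exact (al_mult I B f _ hf (al_inv I B g hg h)). Qed.

Lemma al_pow I B f k : algebra I B f -> algebra I B (fun x => f x ^ k).
Proof.
  intros hf; induction k as [|k IH]; [exact (al_const I B 1)|].
  exact (al_mult I B f _ hf IH).
Qed.

(** Only the generators need attention: the rules of differentiation keep every other member in the
    algebra, which itself is the class required by [smooth1]. *)
Lemma algebra_smooth (I : R -> Prop) (B : (R -> R) -> Prop) :
  (forall f, B f -> exists f', algebra I B f' /\
     forall x, I x -> is_derive f x (f' x)) ->
  forall f, algebra I B f -> smooth1 I f.
Proof.
  intros hB f hf; exists (algebra I B); split; [exact hf|]; clear f hf.
  induction 1 as [f hf|c|f hf [f' [af df]]|f g hf [f' [af df]] hg [g' [ag dg]]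
                 |f g hf [f' [af df]] hg [g' [ag dg]]
                 |f hf [f' [af df]] h|f hf [f' [af df]] h].
  - now apply hB.
  - exists (fun _ => 0); split; [apply al_const|].
    intros x _; apply @is_derive_const.
  - exists (fun x => - f' x); split; [now apply al_opp|].
    intros x hx; apply (is_derive_opp (V := R_NormedModule)), df, hx.
  - exists (fun x => f' x + g' x); split; [now apply al_plus|].
    intros x hx; apply (is_derive_plus (V := R_NormedModule)); auto.
  - exists (fun x => f' x * g x + f x * g' x); split.
    { apply al_plus; now apply al_mult. }
    intros x hx; apply is_derive_Reals, derivable_pt_lim_mult;
      apply is_derive_Reals; auto.
  - exists (fun x => - f' x / (f x ^ 2)); split.
    { apply al_div; [now apply al_opp | now apply al_pow|].
      intros x hx; apply pow_nonzero, h, hx. }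
    intros x hx; apply is_derive_inv; auto.
  - exists (fun x => f' x / (2 * sqrt (f x))); split.
    { apply al_div; [exact af | apply al_mult; [apply al_const | now apply al_sqrt]|].
      intros x hx; generalize (sqrt_lt_R0 _ (h x hx)); lra. }
    intros x hx; apply is_derive_sqrt; auto.
Qed.

Ltac alg :=
  first
  [ assumption
  | lazymatch goal with
    | |- algebra _ _ (fun _ => ?c) => apply al_const
    | |- algebra _ _ (fun _ => _ + _) => apply al_plus; alg
    | |- algebra _ _ (fun _ => _ - _) => apply al_minus; alg
    | |- algebra _ _ (fun _ => - _) => apply al_opp; alg
    | |- algebra _ _ (fun _ => _ * _) => apply al_mult; alg
    | |- algebra _ _ (fun _ => _ ^ _) => apply al_pow; alg
    | |- algebra _ _ (fun _ => _ / _) => apply al_div; [alg | alg | ]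
    | |- algebra _ _ (fun _ => sqrt _) => apply al_sqrt; [alg | ]
    | _ => idtac
    end ].

Section Surface.

Context (K : KNdS) (rn rm rp rc : R).
Context (hLam : 0 < Lam K) (hmass : 0 < mass K) (hspin : 0 < spin K).
Context (hsub : subextremal K rn rm rp rc).

Let a := spin K.
Let L := Lam K / 3 * spin K ^ 2.
Let hL : 0 < L := L_pos K hLam hspin.
Let ha : 0 < a := hspin.

(** Implicit differentiation of [r_star = const]: minus [At] divided by [Q / Delta_r]. *)
Definition curve_slope (r s l : R) : R :=
  - (At K s l * Delta_r K r / Qhat K r l).

Lemma leaf_curve_smooth (I : R -> Prop) (rho sg lm : R -> R) :
  (forall x, I x ->
     good_leaf K rm rp (rho x) (sg x) (lm x) x /\
     is_derive rho x (curve_slope (rho x) (sg x) (lm x)) /\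
     is_derive lm x
       (lam_r K rp (rho x) (sg x) (lm x) * curve_slope (rho x) (sg x) (lm x)
        + lam_x K rp (rho x) (sg x) (lm x)) /\
     is_derive sg x
       ((sig_r K (rho x) (sg x) (lm x)
         + sig_l K rp (rho x) (sg x) (lm x) * lam_r K rp (rho x) (sg x) (lm x))
        * curve_slope (rho x) (sg x) (lm x)
        + sig_l K rp (rho x) (sg x) (lm x) * lam_x K rp (rho x) (sg x) (lm x))) ->
  smooth1 I rho.
Proof.
  intros hI.
  (* All orders [j] are generators because the [l]-derivative raises [j]; the derivatives in [s] and
     [r] are [Gk] and [Hk], algebraic in [rho], [sg] and [lm]. *)
  set (B := fun f : R -> R => f = rho \/ f = sg \/ f = lm \/
    (exists j, f = fun x => G a L j (sg x) (lm x)) \/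
    (exists j, f = fun x => H K rp j (rho x) (lm x))).
  assert (b1 : algebra I B rho) by (apply al_base; now left).
  assert (b2 : algebra I B sg) by (apply al_base; right; now left).
  assert (b3 : algebra I B lm) by (apply al_base; do 2 right; now left).
  assert (b4 : forall j, algebra I B (fun x => G a L j (sg x) (lm x))).
  { intros j; apply al_base; do 3 right; left; now exists j. }
  assert (b5 : forall j, algebra I B (fun x => H K rp j (rho x) (lm x))).
  { intros j; apply al_base; do 4 right; now exists j. }
  assert (hpos : forall x, I x ->
    (0 < 1 + L - sg x ^ 2 /\ 0 < sg x < 1 /\ 0 < nn L (sg x) /\
     0 < mm (sg x) (lm x) /\ 0 < dd L (sg x) (lm x) /\
     0 < 1 - lm x + lm x * sg x ^ 2 /\ 0 < Gk a L 0 (sg x) (lm x)) /\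
    OmH K (rho x) (lm x) /\ 0 < Qhat K (rho x) (lm x) /\
    0 < Wf K rp (rho x) (sg x) (lm x)).
  { intros x hx; destruct (hI x hx) as ((q1 & q2 & _ & q4) & _).
    destruct (domG_pos K hLam hspin _ _ q2) as (p1 & p2 & p3 & p4 & _ & p5 & p6).
    assert (hO := domH_OmH K rn rm rp rc hLam hmass hspin hsub _ _ (rho x) q1
                    ltac:(destruct q1; lra)).
    assert (sg x ^ 2 < 1) by nra.
    split; [repeat split; auto; lra|].
    split; [exact hO|]; split; [now apply Qhat_pos | exact q4]. }
  assert (c1 : algebra I B (fun x => nn L (sg x))).
  { unfold nn; alg; apply hpos. }
  assert (c2 : algebra I B (fun x => mm (sg x) (lm x))).
  { unfold mm; alg; apply hpos. }
  assert (c3 : algebra I B (fun x => dd L (sg x) (lm x))).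
  { unfold dd; alg. }
  assert (c4 : algebra I B (fun x => Delta_r K (rho x))).
  { unfold Delta_r; alg; intros; lra. }
  assert (c5 : algebra I B (fun x => Qhat K (rho x) (lm x))).
  { unfold Qhat; alg; apply hpos. }
  assert (c6 : forall j, algebra I B (fun x => Gk a L j (sg x) (lm x))).
  { intros j; unfold Gk; alg; intros x hx.
    destruct (hpos x hx) as ((_ & _ & p1 & p2 & _) & _).
    apply Rgt_not_eq, Rmult_lt_0_compat;
      [now apply Rmult_lt_0_compat | now apply pow_lt]. }
  assert (c7 : forall j, algebra I B (fun x => Hk K j (rho x) (lm x))).
  { intros j; unfold Hk; alg; intros x hx.
    apply Rgt_not_eq, pow_lt, hpos, hx. }
  assert (c8 : algebra I B (fun x => Xs (sg x) (lm x))).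
  { unfold Xs; alg; intros x hx; apply Rgt_not_eq, pow_lt, hpos, hx. }
  assert (c9 : algebra I B (fun x => Xl (sg x) (lm x))).
  { unfold Xl; alg; intros x hx; apply Rgt_not_eq, pow_lt, hpos, hx. }
  assert (d1 : algebra I B (fun x => sig_r K (rho x) (sg x) (lm x))).
  { unfold sig_r; apply al_div; [apply c7 | apply c6|].
    intros x hx; apply Rgt_not_eq, hpos, hx. }
  assert (d2 : algebra I B (fun x => sig_l K rp (rho x) (sg x) (lm x))).
  { unfold sig_l; apply al_div; [apply al_minus; [apply b4 | apply b5] | |].
    - apply al_mult; [apply al_const | apply c6].
    - intros x hx; destruct (hpos x hx) as ((_ & _ & _ & _ & _ & _ & p) & _).
      fold L a; lra. }
  assert (d3 : algebra I B (fun x => Wf K rp (rho x) (sg x) (lm x))).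
  { unfold Wf; alg. }
  assert (d4 : algebra I B (fun x => lam_r K rp (rho x) (sg x) (lm x))).
  { unfold lam_r; alg; intros x hx; apply Rgt_not_eq, hpos, hx. }
  assert (d5 : algebra I B (fun x => lam_x K rp (rho x) (sg x) (lm x))).
  { unfold lam_x; apply al_inv; [exact d3|].
    intros x hx; apply Rgt_not_eq, hpos, hx. }
  assert (d6 : algebra I B (fun x => At K (sg x) (lm x))).
  { unfold At; fold L a; alg; intros x hx.
    destruct (hpos x hx) as ((_ & p1 & _ & _ & p2 & _) & _).
    apply Rgt_not_eq, Rmult_lt_0_compat; lra. }
  assert (d7 : algebra I B (fun x => curve_slope (rho x) (sg x) (lm x))).
  { unfold curve_slope; alg; intros x hx; apply Rgt_not_eq, hpos, hx. }
  apply (algebra_smooth I B); [|exact b1].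
  set (s' := fun x => (sig_r K (rho x) (sg x) (lm x)
         + sig_l K rp (rho x) (sg x) (lm x) * lam_r K rp (rho x) (sg x) (lm x))
        * curve_slope (rho x) (sg x) (lm x)
        + sig_l K rp (rho x) (sg x) (lm x) * lam_x K rp (rho x) (sg x) (lm x)).
  set (l' := fun x => lam_r K rp (rho x) (sg x) (lm x) * curve_slope (rho x) (sg x) (lm x)
        + lam_x K rp (rho x) (sg x) (lm x)).
  assert (e1 : algebra I B s') by (unfold s'; alg).
  assert (e2 : algebra I B l') by (unfold l'; alg).
  intros f [->|[->|[->|[[j ->]|[j ->]]]]].
  - eexists; split; [exact d7|]; intros x hx; apply (hI x hx).
  - exists s'; split; [exact e1|]; intros x hx; apply (hI x hx).
  - exists l'; split; [exact e2|]; intros x hx; apply (hI x hx).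
  - exists (fun x => - Gk a L j (sg x) (lm x) * s' x
              + (2 * INR j + 1) / 2 * G a L (S j) (sg x) (lm x) * l' x).
    split.
    + apply al_plus; apply al_mult; try assumption; [apply al_opp, c6|].
      apply al_mult; [apply al_const | apply b4].
    + intros x hx; destruct (hI x hx) as ((q1 & q2 & _) & _ & q3 & q4).
      apply is_derive_Reals, (derivable_pt_lim_comp_2d (G a L j)).
      * exact (G_differentiable a L ha hL j _ _ q2).
      * apply is_derive_Reals, q4.
      * apply is_derive_Reals, q3.
  - exists (fun x => - Hk K j (rho x) (lm x) * curve_slope (rho x) (sg x) (lm x)
              + (2 * INR j + 1) / 2 * H K rp (S j) (rho x) (lm x) * l' x).
    split.
    + apply al_plus; apply al_mult; try assumption; [apply al_opp, c7|].
      apply al_mult; [apply al_const | apply b5].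
    + intros x hx; destruct (hI x hx) as ((q1 & q2 & _) & q5 & q3 & q4).
      apply is_derive_Reals, (derivable_pt_lim_comp_2d (H K rp j)).
      * exact (H_differentiable K rn rm rp rc hLam hmass hspin hsub j _ _ q1).
      * apply is_derive_Reals, q5.
      * apply is_derive_Reals, q3.
Qed.

(** * From level curves to surfaces in a chart *)

(** Reflection at the equator preserves both [r_star] and [sin^2 theta], so the two hemispheres are
    treated alike. *)
Lemma rstar_fold (ts : R -> R -> R) (f : R -> R) r0 theta : 0 <= theta <= PI ->
  exists th, 0 <= th <= PI / 2 /\ sin th ^ 2 = sin theta ^ 2 /\
    forall r, rstar K rp r0 f ts r theta
              = varrho K rp r0 f r th (sin (ts r th) ^ 2).
Proof.
  intros h; unfold rstar; destruct (Rle_dec theta (PI / 2)) as [hle|hgt].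
  - exists theta; repeat split; lra.
  - exists (PI - theta); repeat split; try lra.
    now rewrite sin_PI_x.
Qed.

(** With [M = 1 - l + l s^2 > 0] the relation defining [x] gives [s^2 l = x M] and
    [1 - l = (1 - x) M]. *)
Lemma leaf_unit r s l x : leaf K rp r s l x -> domG L s l -> 0 <= x <= 1 -> 0 <= l <= 1.
Proof.
  intros (hs & _ & hx) hG hx1.
  destruct (domG_pos K hLam hspin s l hG) as (_ & _ & _ & _ & _ & hM & _).
  assert (hs2 : 0 < s ^ 2) by (apply pow_lt; lra).
  split.
  - assert (0 <= s ^ 2 * l) by (rewrite <- hx; apply Rmult_le_pos; lra).
    apply Rmult_le_reg_l with (s ^ 2); lra.
  - assert (0 <= (1 - x) * (1 - l + l * s ^ 2)) by (apply Rmult_le_pos; lra).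
    lra.
Qed.

(** Near the base point [r_star] is the restriction to [0 <= x <= 1] of a function [Psi r x] on an
    open set. Since [Psi] is strictly monotone in [r], its level curve is the graph of [rho]. *)
Lemma local_graph (ts : R -> R -> R) (f : R -> R) r0 r1 theta1 :
  is_theta_star K rm rp ts -> is_f K f -> rm < r0 < rp ->
  rm < r1 < rp -> 0 <= theta1 <= PI ->
  exists (d : posreal) (rho : R -> R),
    smooth1 (fun x => Rabs (x - sin theta1 ^ 2) < d) rho /\
    forall r theta, Rabs (r - r1) < d -> 0 <= theta <= PI ->
      Rabs (sin theta ^ 2 - sin theta1 ^ 2) < d ->
      rm < r < rp /\
      (rstar K rp r0 f ts r theta = rstar K rp r0 f ts r1 theta1 <->
       r = rho (sin theta ^ 2)).
Proof.
  intros hts hf hr0 hr1 hth1.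
  assert (hunit : forall z, 0 <= sin z ^ 2 <= 1).
  { intros z; generalize (pow2_ge_0 (sin z)) (pow2_ge_0 (cos z)) (cos_sqr z); lra. }
  destruct (rstar_fold ts f r0 theta1 hth1) as (th & hth & hsin & _).
  destruct (leaf_exists K rn rm rp rc hLam hmass hspin hsub ts r1 th hts hr1 hth)
    as (s1 & l1 & hl1 & hleaf).
  rewrite hsin in hleaf.
  set (x1 := sin theta1 ^ 2) in *.
  destruct (leaf_coordinates K rn rm rp rc hLam hmass hspin hsub r1 s1 l1 x1 hr1 hl1 hleaf)
    as (sg & lm & hsg & hlm & hloc).
  set (Psi := fun r x => B0 K rp r0 r (lm r x) + EE a L (sg r x) (lm r x)).
  (* At actual points of the sphere [x = sin^2 theta] lies in [0, 1], hence so does [l], as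
     [leaf_varrho] requires. *)
  assert (hstar : forall r theta, 0 <= theta <= PI ->
            good_leaf K rm rp r (sg r (sin theta ^ 2)) (lm r (sin theta ^ 2)) (sin theta ^ 2) ->
            rstar K rp r0 f ts r theta = Psi r (sin theta ^ 2)).
  { intros r theta ht (q1 & q2 & q3 & _).
    destruct (rstar_fold ts f r0 theta ht) as (th' & ht' & hs' & ->).
    unfold Psi; apply (leaf_varrho K rn rm rp rc hLam hmass hspin hsub); auto.
    - apply q1.
    - apply leaf_unit with r (sg r (sin theta ^ 2)) (sin theta ^ 2); auto.
    - now rewrite hs'. }
  assert (hbase := locally_2d_singleton _ _ _ hloc); cbv beta in hbase.
  assert (hc := hstar r1 theta1 hth1 (proj1 hbase)); fold x1 in hc.
  (* [Q / Delta_r] is negative, so [- Psi] increases in [r], and the level [c] becomes [- c]. *)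
  destruct (param_inverse (fun x r => - Psi r x)
              (fun x r => - At K (sg r x) (lm r x))
              (fun x r => - (Qhat K r (lm r x) / Delta_r K r)) x1 r1)
    as (eta & h1 & h2).
  { apply (locally_2d_swap (fun r x => differentiable_pt_lim (fun x r => - Psi r x) x r
      (- At K (sg r x) (lm r x)) (- (Qhat K r (lm r x) / Delta_r K r)) /\
      0 < - (Qhat K r (lm r x) / Delta_r K r))).
    generalize hloc; apply locally_2d_impl, locally_2d_forall.
    intros r x (q1 & q2 & q3); split.
    - apply differentiable_pt_lim_opp.
      eapply differentiable_pt_lim_eq.
      + apply (differentiable_pt_lim_comp Psi (fun _ r => r) (fun x _ => x)).
        * apply (leaf_potential K rn rm rp rc hLam hmass hspin hsub r0 sg lm r x hr0 q1 q2 q3).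
        * apply differentiable_pt_lim_snd.
        * apply differentiable_pt_lim_fst.
      + ring.
      + ring.
    - assert (hD := Delta_r_neg K rn rm rp rc hLam hspin hsub r (proj1 (proj1 q1))).
      assert (hQ : 0 < Qhat K r (lm r x)).
      { apply Qhat_pos, (domH_OmH K rn rm rp rc hLam hmass hspin hsub r); [apply q1|].
        destruct q1 as [[hr _] _]; lra. }
      replace (- (Qhat K r (lm r x) / Delta_r K r))
        with (Qhat K r (lm r x) / - Delta_r K r) by (field; lra).
      apply Rdiv_lt_0_compat; lra. }
  set (c := Psi r1 x1) in *.
  set (rho := fun x => eta x (- c)).
  assert (hrho1 : rho x1 = r1) by exact (locally_2d_singleton _ _ _ h2).
  assert (hrc : continuous rho x1).
  { apply (continuity_2d_pt_fix_snd eta).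
    eapply differentiable_pt_lim_continuity, (locally_2d_singleton _ _ _ h1). }
  assert (hcurve : locally x1 (fun x =>
     (good_leaf K rm rp (rho x) (sg (rho x) x) (lm (rho x) x) x /\
      differentiable_pt_lim lm (rho x) x
        (lam_r K rp (rho x) (sg (rho x) x) (lm (rho x) x))
        (lam_x K rp (rho x) (sg (rho x) x) (lm (rho x) x)) /\
      differentiable_pt_lim sg (rho x) x
        (sig_r K (rho x) (sg (rho x) x) (lm (rho x) x)
         + sig_l K rp (rho x) (sg (rho x) x) (lm (rho x) x)
           * lam_r K rp (rho x) (sg (rho x) x) (lm (rho x) x))
        (sig_l K rp (rho x) (sg (rho x) x) (lm (rho x) x)
         * lam_x K rp (rho x) (sg (rho x) x) (lm (rho x) x))))).
  { rewrite <- hrho1 in hloc; destruct hloc as [e he].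
    generalize (filter_and (fun x => ball (rho x1) e (rho x)) (fun x => ball x1 e x)
      (hrc _ (locally_ball (rho x1) e)) (locally_ball x1 e)).
    apply filter_imp; intros x [hx1 hx2]; now apply he. }
  assert (hh1 := locally_2d_1d_const_y _ _ _ h1); cbv beta in hh1.
  (* [d1] serves the points of the curve itself; [d2] serves nearby points [(r, x)], where the left
     inverse turns [Psi r x = c] into [r = rho x]. *)
  destruct (filter_and _ _ hcurve hh1) as [d1 hd1].
  destruct (locally_2d_and _ _ _ _ hloc (locally_2d_swap _ _ _ h2)) as [d2 hd2].
  exists (mkposreal _ (Rmin_stable_in_posreal d1 d2)), rho.
  assert (hm1 := Rmin_l d1 d2); assert (hm2 := Rmin_r d1 d2).
  split.
  - apply leaf_curve_smooth with (sg := fun x => sg (rho x) x) (lm := fun x => lm (rho x) x).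
    cbn [pos]; intros x hx.
    destruct (hd1 x) as [(q1 & q2 & q3) (q4 & q5)].
    { change (Rabs (x - x1) < d1); lra. }
    fold (rho x) in q5; fold (rho x) in q4.
    assert (hder : is_derive rho x (curve_slope (rho x) (sg (rho x) x) (lm (rho x) x))).
    { assert (hD := Delta_r_neg K rn rm rp rc hLam hspin hsub _ (proj1 (proj1 q1))).
      assert (hQ : 0 < Qhat K (rho x) (lm (rho x) x)).
      { apply Qhat_pos, (domH_OmH K rn rm rp rc hLam hmass hspin hsub (rho x)); [apply q1|].
        destruct q1 as [[hr _] _]; lra. }
      apply is_derive_Reals.
      match type of q5 with differentiable_pt_lim _ _ _ ?u ?v =>
        replace (curve_slope (rho x) (sg (rho x) x) (lm (rho x) x))
          with (u * 1 + v * 0) end.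
      - apply (derivable_pt_lim_comp_2d eta (fun x => x) (fun _ => - c));
          [exact q5 | apply derivable_pt_lim_id | apply derivable_pt_lim_const].
      - unfold curve_slope; field; lra. }
    split; [exact q1|]; split; [exact hder|]; split.
    + evar_last.
      * apply is_derive_Reals, (derivable_pt_lim_comp_2d lm rho (fun x => x));
          [exact q2 | apply is_derive_Reals, hder | apply derivable_pt_lim_id].
      * simpl; ring.
    + evar_last.
      * apply is_derive_Reals, (derivable_pt_lim_comp_2d sg rho (fun x => x));
          [exact q3 | apply is_derive_Reals, hder | apply derivable_pt_lim_id].
      * simpl; ring.
  - cbn [pos]; intros r theta hr ht hx.
    destruct (hd2 r (sin theta ^ 2)) as [(q1 & _ & _) q2]; try lra.
    split; [apply q1|].
    rewrite hc, (hstar r theta ht q1).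
    destruct (hd1 (sin theta ^ 2)) as [_ [q4 _]].
    { change (Rabs (sin theta ^ 2 - x1) < d1); lra. }
    split.
    + intros he; rewrite <- q2 at 1; now rewrite he.
    + intros ->; fold (rho (sin theta ^ 2)) in q4; lra.
Qed.

(** The equations [u = u0] and [v = v0] amount to [t = v0 - u0] and [r_star = u0 + v0]. Smoothness
    is asked of [q], the square of the sine of the colatitude, and not of the colatitude [th], which
    is not smooth at a pole. *)
Lemma chart_surface (ts : R -> R -> R) (f : R -> R) r0 u0 v0
    (S : R4 -> Prop) (O : R -> R -> Prop) (q th : R -> R -> R) :
  is_theta_star K rm rp ts -> is_f K f -> rm < r0 < rp ->
  (forall x y, O x y -> locally_2d O x y) ->
  (forall x y, O x y -> 0 <= th x y <= PI /\ sin (th x y) ^ 2 = q x y) ->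
  smooth2 (fun _ _ => True) q -> (forall x y, continuity_2d_pt q x y) ->
  (forall t r x y, S (t, r, x, y) <-> rm < r < rp /\ O x y /\
     (rstar K rp r0 f ts r (th x y) - t) / 2 = u0 /\
     (rstar K rp r0 f ts r (th x y) + t) / 2 = v0) ->
  smooth_surface S.
Proof.
  intros hts hf hr0 hO hth hq hqc hS.
  apply smooth_surface_graph; intros t1 r1 x1 y1 h1.
  destruct (proj1 (hS _ _ _ _) h1) as (hr1 & hO1 & hu1 & hv1).
  destruct (hth x1 y1 hO1) as [ht1 hs1].
  destruct (local_graph ts f r0 r1 (th x1 y1) hts hf hr0 hr1 ht1)
    as (d & rho & hsm & hiff).
  rewrite hs1 in hsm, hiff.
  exists (fun x y => O x y /\ Rabs (q x y - q x1 y1) < d).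
  exists (fun x y => rho (q x y)), t1, r1, d.
  split; [|split; [|split; [|split]]].
  - split; [exact hO1|]; rewrite Rminus_diag, Rabs_R0; apply cond_pos.
  - rewrite Rminus_diag, Rabs_R0; apply cond_pos.
  - intros x y [hxy hd]; apply locally_2d_and; [now apply hO|].
    apply (locally_2d_comp (fun u _ => Rabs (u - q x1 y1) < d) q q);
      [apply hqc | apply hqc | now apply locally_2d_Rabs].
  - intros D g h hg hh hD.
    apply (se_comp D (fun x => Rabs (x - q x1 y1) < d) rho (fun w => q (g w) (h w)));
      [exact hsm | now apply hq | intros w hw; now apply hD].
  - intros t r x y hr [hxy hd].
    destruct (hth x y hxy) as [ht hs].
    destruct (hiff r (th x y) hr ht) as [hrr hi]; [now rewrite hs|].
    rewrite hs in hi; rewrite hS, <- hi.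
    split; [intros (_ & _ & hu & hv); lra|].
    intros [hte hre]; repeat split; try assumption; lra.
Qed.

End Surface.

(** * The charts of the atlas *)

Lemma smooth2_fst_sin : smooth2 (fun _ _ => True) (fun x _ => sin x ^ 2).
Proof.
  intros D f g hf hg _.
  assert (h : smooth_expr D (fun w => sin (f w))).
  { apply (se_comp D (fun _ => True) sin f); [apply smooth1_sin | exact hf | easy]. }
  (* The trailing factor 1 matches the unfolding of [^ 2]. *)
  apply (se_mult D (fun w => sin (f w)) (fun w => sin (f w) * 1)); [exact h|].
  apply (se_mult D (fun w => sin (f w)) (fun _ => 1)); [exact h | apply se_const].
Qed.

Lemma smooth2_sum_sqr : smooth2 (fun _ _ => True) (fun x y => x * x + y * y).
Proof.
  intros D f g hf hg _; apply (se_plus D (fun w => f w * f w) (fun w => g w * g w));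
    now apply se_mult.
Qed.

Lemma disk_open x y : x ^ 2 + y ^ 2 < 1 -> locally_2d (fun x y => x ^ 2 + y ^ 2 < 1) x y.
Proof.
  intros h; apply locally_2d_impl with (fun x y => 0 < 1 - (x ^ 2 + y ^ 2)).
  - apply locally_2d_forall; intros; lra.
  - apply (locally_2d_pos (fun x y => 1 - (x ^ 2 + y ^ 2))); [cont2 | lra].
Qed.

Lemma sin_acos_sqr z : -1 <= z <= 1 -> sin (acos z) ^ 2 = 1 - z ^ 2.
Proof.
  intros h; rewrite sin_acos by lra; rewrite pow2_sqrt; unfold Rsqr; nra.
Qed.

Theorem theorem2p23 :
  forall (K : KNdS) (rn rm rp rc : R),
  0 < Lam K -> 0 < mass K -> 0 < spin K ->
  subextremal K rn rm rp rc ->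
  forall (ts : R -> R -> R), is_theta_star K rm rp ts ->
  forall (f : R -> R), is_f K f ->
  forall r0 : R, rm < r0 < rp ->
  forall u0 v0 : R,
  smooth_2submanifold (BL_atlas rm rp)
    (fun p => black_hole_interior rm rp p /\
              u_null K rp r0 f ts p = u0 /\ v_null K rp r0 f ts p = v0).
Proof.
  intros K rn rm rp rc hLam hmass hspin hsub ts hts f hf r0 hr0 u0 v0 c hc.
  assert (hdisk : forall x y, x ^ 2 + y ^ 2 < 1 ->
            0 <= sqrt (1 - x ^ 2 - y ^ 2) <= 1 /\
            sqrt (1 - x ^ 2 - y ^ 2) ^ 2 = 1 - x ^ 2 - y ^ 2).
  { intros x y h; assert (0 <= x ^ 2 + y ^ 2) by nra.
    split; [split; [apply sqrt_pos|]|apply pow2_sqrt; lra].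
    rewrite <- sqrt_1 at 2; apply sqrt_le_1_alt; lra. }
  destruct hc as [alpha| |].
  - apply (chart_surface K rn rm rp rc hLam hmass hspin hsub ts f r0 u0 v0 _
      (fun x y => 0 < x < PI /\ alpha < y < alpha + 2 * PI)
      (fun x _ => sin x ^ 2) (fun x _ => x) hts hf hr0).
    + intros x y [hx hy].
      assert (hd : 0 < Rmin (Rmin x (PI - x)) (Rmin (y - alpha) (alpha + 2 * PI - y))).
      { repeat apply Rmin_case; lra. }
      exists (mkposreal _ hd); simpl; intros u v hu hv.
      apply Rabs_def2 in hu; apply Rabs_def2 in hv.
      generalize (Rmin_l (Rmin x (PI - x)) (Rmin (y - alpha) (alpha + 2 * PI - y)))
        (Rmin_r (Rmin x (PI - x)) (Rmin (y - alpha) (alpha + 2 * PI - y)))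
        (Rmin_l x (PI - x)) (Rmin_r x (PI - x))
        (Rmin_l (y - alpha) (alpha + 2 * PI - y))
        (Rmin_r (y - alpha) (alpha + 2 * PI - y)); lra.
    + intros x y [hx _]; split; [lra | reflexivity].
    + apply smooth2_fst_sin.
    + intros x y; cont2.
    + intros t r x y; simpl.
      split.
      * intros [(hr & hx & hy) (_ & hu & hv)].
        rewrite acos_cos in hu, hv by lra; tauto.
      * intros (hr & (hx & hy) & hu & hv).
        rewrite acos_cos by lra; repeat split; try tauto; try lra.
        generalize (sin2_cos2 x) (sin2_cos2 y); unfold Rsqr; intros e1 e2.
        transitivity (sin x * sin x * (sin y * sin y + cos y * cos y) + cos x * cos x);
          [ring | rewrite e2; lra].
  (* In the polar caps [sin^2 theta] is the polynomial [x^2 + y^2], which covers the pole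
     [x = y = 0]. *)
  - apply (chart_surface K rn rm rp rc hLam hmass hspin hsub ts f r0 u0 v0 _
      (fun x y => x ^ 2 + y ^ 2 < 1)
      (fun x y => x * x + y * y)
      (fun x y => acos (sqrt (1 - x ^ 2 - y ^ 2))) hts hf hr0).
    + apply disk_open.
    + intros x y h; destruct (hdisk x y h) as [h1 h2]; split; [apply acos_bound|].
      rewrite sin_acos_sqr, h2 by lra; ring.
    + apply smooth2_sum_sqr.
    + intros x y; cont2.
    + intros t r x y; unfold north_chart, range, param, black_hole_interior,
        u_null, v_null.
      split; [tauto|].
      intros (hr & h & hu & hv); destruct (hdisk x y h) as [_ h2].
      rewrite h2; repeat split; try tauto; try lra.
  - apply (chart_surface K rn rm rp rc hLam hmass hspin hsub ts f r0 u0 v0 _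
      (fun x y => x ^ 2 + y ^ 2 < 1)
      (fun x y => x * x + y * y)
      (fun x y => acos (- sqrt (1 - x ^ 2 - y ^ 2))) hts hf hr0).
    + apply disk_open.
    + intros x y h; destruct (hdisk x y h) as [h1 h2]; split; [apply acos_bound|].
      rewrite sin_acos_sqr by lra.
      replace ((- sqrt (1 - x ^ 2 - y ^ 2)) ^ 2)
        with (sqrt (1 - x ^ 2 - y ^ 2) ^ 2) by ring.
      rewrite h2; ring.
    + apply smooth2_sum_sqr.
    + intros x y; cont2.
    + intros t r x y; unfold south_chart, range, param, black_hole_interior,
        u_null, v_null.
      split; [tauto|].
      intros (hr & h & hu & hv); destruct (hdisk x y h) as [_ h2].
      replace ((- sqrt (1 - x ^ 2 - y ^ 2)) ^ 2)
        with (sqrt (1 - x ^ 2 - y ^ 2) ^ 2) by ring.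
      rewrite h2; repeat split; try tauto; try lra.
Qed.
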